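(* Let $(\Omega,\Sigma,m)$ be a compact Borel probability space and let $A\in\mathcal{G}^m$ be a fixed graphop with family of fiber measures $\{\nu_x^A\}_{x\in\Omega}$. Let $b>0$ and assume that the initial condition $\bar\mu_0\in\bar{\mathcal{M}}^b$ is absolutely continuous with density $\rho^0$, where $\rho^0(u,\cdot)\in L^\infty(\Omega,m)$, i.e. $$\mathrm{d}\mu_0^y(u)=\rho^0(u,y)\,\mathrm{d}u\qquad\text{for all } y\in\Omega.$$ Then there is a unique weak solution $\rho$ of the initial value problem $$\partial_t\rho(t,u,x)=-\partial_u(\rho V(\rho))(t,u,x),\quad (t,u,x)\in[0,T]\times\mathbb{T}\times\Omega,\qquad \rho(0,u,x)=\rho^0(u,x),$$ where $V(t,u,x)=V[A,\rho,x](t,u):=C\int_0^{2\pi}(A\rho)(t,\tilde u,x)\,D(\tilde u-u)\,\mathrm{d}\tilde u$.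
   Context: Graphops. A compact Borel probability space $(\Omega,\Sigma,m)$ consists of a compact space $\Omega$, its Borel $\sigma$-algebra $\Sigma$ and a probability measure $m$. A graphop on it is a linear operator $A:L^\infty(\Omega,m)\to L^1(\Omega,m)$ with $\sup_v\|Av\|_1/\|v\|_\infty<\infty$, which is positivity preserving ($v\ge0$ $m$-a.e. implies $Av\ge0$ $m$-a.e.) and self-adjoint ($\int (Av)w\,\mathrm{d}m=\int v(Aw)\,\mathrm{d}m$ for all $v,w\in L^\infty$). Every graphop has a (measurable) family of finite measures $\{\nu_x^A\}_{x\in\Omega}$ on $\Omega$, the fiber measures, with $(Af)(x)=\int_\Omega f(y)\,\mathrm{d}\nu_x^A(y)$ for $m$-a.e. $x$ and all $f\in L^\infty(\Omega,m)$. Fixed representatives $\nu_x^A$, defined for every $x\in\Omega$, are used. $\gamma_A:=\sup_{x\in\Omega}\nu_x^A(\Omega)$, and $\mathcal{G}^m$ is the set of graphops $B$ on $(\Omega,\Sigma,m)$ with $\gamma_B\le1$. The graphop acts on $\rho$ in the node variable: $(A\rho)(t,u,x)=\int_\Omega\rho(t,u,y)\,\mathrm{d}\nu_x^A(y)$. $\mathbb{T}=[0,2\pi)$ regarded as the circle, $|u-v|$ the distance on it. $C>0$ is a constant, $T>0$, $\mathcal{T}=[0,T]$, and $D:\mathbb{T}\to\mathbb{R}$ satisfies $|D(u)-D(v)|\le|u-v|$ and $\max|D|\le1$. $\mathcal{M}_f(\mathbb{T})$ is the set of finite Borel measures on $\mathbb{T}$ with metric $d_{BL}(\mu,\nu)=\sup_{f}|\int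 f\,\mathrm{d}(\mu-\nu)|$, the supremum over $f:\mathbb{T}\to[0,1]$ Lipschitz with constant $\le1$. $\bar{\mathcal{M}}^b$ is the set of measurable $\bar\mu:\Omega\to\mathcal{M}_f(\mathbb{T})$, $x\mapsto\mu^x$, with $\sup_x\mu^x(\mathbb{T})\le b$. Weak solution. A measurable function $\rho:\mathcal{T}\times\mathbb{T}\times\Omega\to\mathbb{R}$ is a weak solution of the initial value problem if for $m$-a.e. $x\in\Omega$: (1) $t\mapsto\int_{\mathbb{T}}\rho(t,u,x)f(u)\,\mathrm{d}u$ is continuous on $\mathcal{T}$ for every $f\in C(\mathbb{T})$; (2) for every $w\in C^1(\mathcal{T}\times\mathbb{T})$ with support in $[0,T)\times\mathbb{T}$, $$\int_0^T\int_{\mathbb{T}}\rho(t,u,x)\big(\partial_tw(t,u)+V(t,u,x)\partial_uw(t,u)\big)\,\mathrm{d}u\,\mathrm{d}t+\int_{\mathbb{T}}w(0,u)\rho^0(u,x)\,\mathrm{d}u=0.$$ *)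

(* Defs.v *)
From HB Require Import structures.
From mathcomp Require Import all_boot all_order all_algebra.
From mathcomp Require Import all_classical all_reals all_analysis.

Set Implicit Arguments.
Unset Strict Implicit.
Unset Printing Implicit Defensive.
Import Order.TTheory GRing.Theory Num.Theory.
Import numFieldNormedType.Exports.

Local Open Scope classical_set_scope.
Local Open Scope ring_scope.

Notation borel_type Omega := (g_sigma_algebraType (@open Omega)).

Section circle.
Context {R : realType}.

(* The circle is represented by its fundamental domain [0, 2 pi[. Functions on
   it that have to be continuous, or evaluated at differences, are given as
   2 pi-periodic functions on R; of all other functions only the values on
   [0, 2 pi[ matter. *)
Definition circle : set R := `[0, 2 * pi[%classic.

Definition circle_dist (u v : R) : R :=
  Num.min `|u - v| (2 * pi - `|u - v|).

Definition periodic2pi (f : R -> R) := forall u, f (u + 2 * pi) = f u.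

Definition interaction (D : R -> R) :=
  [/\ periodic2pi D,
      forall u v, circle u -> circle v -> `|D u - D v| <= circle_dist u v
    & forall u, circle u -> `|D u| <= 1].

Record circle_measure := CircleMeasure {
  circle_mu :> {finite_measure set (measurableTypeR R) -> \bar R} ;
  circle_muC : circle_mu (~` circle) = 0%E }.

Definition BL_test (f : R -> R) :=
  (forall u, circle u -> 0 <= f u <= 1) /\
  (forall u v, circle u -> circle v -> `|f u - f v| <= circle_dist u v).

Definition d_BL (mu nu : circle_measure) : \bar R :=
  ereal_sup [set (`|\int[circle_mu mu]_(u in circle) f u
                    - \int[circle_mu nu]_(u in circle) f u|)%:E | f in BL_test].

Definition BL_open (U : set circle_measure) :=
  forall mu, U mu ->
    exists2 e : R, 0 < e & forall nu, (d_BL mu nu < e%:E)%E -> U nu.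

End circle.
Arguments circle_measure : clear implicits.

Section graphop.
Context {d : measure_display} {Omega : measurableType d} {R : realType}.
Variable m : probability Omega R.

Notation Linfty := (LfunType m (leey (1%E : \bar R))).
Notation L1 := (LfunType m (lexx (1%E : \bar R))).

(* Elements of [Linfty] and [L1] are functions, not classes: an operator between
   the Lebesgue spaces is given on representatives and only considered up to
   m-a.e. equality. In the operator norm, v = 0 contributes 0 as x / 0 = 0. *)
Definition graphop (A : Linfty -> L1) :=
  [/\ (forall v w : Linfty, {ae m, forall x, v x = w x} ->
         {ae m, forall x, A v x = A w x}) /\
      (forall (a : R) (v w : Linfty), {ae m, forall x, A (a *: v + w) x = a * A v x + A w x}),
      (ereal_sup [set (fine 'N[m]_1[EFin \o A v]
                       / fine 'N[m]_+oo[EFin \o v])%:E | v in [set: Linfty]]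
         < +oo)%E,
      forall v : Linfty, {ae m, forall x, 0 <= v x} -> {ae m, forall x, 0 <= A v x}
    & forall v w : Linfty, \int[m]_x (A v x * w x) = \int[m]_x (v x * A w x)].

Definition fiber_measures (A : Linfty -> L1) (nu : R.-ker Omega ~> Omega) :=
  (forall x, (nu x setT < +oo)%E) /\
  (forall f : Linfty, {ae m, forall x, A f x = \int[nu x]_y f y}).

Definition gamma (nu : R.-ker Omega ~> Omega) : \bar R :=
  ereal_sup (range (fun x => nu x setT)).

Definition Gm (A : Linfty -> L1) (nu : R.-ker Omega ~> Omega) :=
  [/\ graphop A, fiber_measures A nu & (gamma nu <= 1)%E].

Definition Mb (b : R) (mu : Omega -> circle_measure R) :=
  (forall U, <<s BL_open >> U -> measurable (mu @^-1` U)) /\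
  (ereal_sup (range (fun x => circle_mu (mu x) setT)) <= b%:E)%E.

Definition has_density (mu : Omega -> circle_measure R) (rho0 : R -> Omega -> R) :=
  forall y, measurable_fun circle (rho0 ^~ y) /\
    forall U : set (measurableTypeR R), measurable U ->
      circle_mu (mu y) U =
      (\int[lebesgue_measure]_(u in U `&` circle) (rho0 u y)%:E)%E.

End graphop.

Section initial_value_problem.
Context {d : measure_display} {Omega : measurableType d} {R : realType}.
Variables (m : probability Omega R) (nu : R.-ker Omega ~> Omega).
Variables (C T : R) (D : R -> R).
Implicit Types rho : R -> R -> Omega -> R.

Local Notation leb := (@lebesgue_measure R).

Definition graphop_act rho (t u : R) (x : Omega) : R := \int[nu x]_y rho t u y.

Definition velocity rho (t u : R) (x : Omega) : R :=
  C * \int[leb]_(v in circle) (graphop_act rho t v x * D (v - u)).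

(* [w] is a C^1 function on [0, T] x circle with partial derivatives [wt] in
   time and [wu] in space, and with support in [0, T[ x circle; at the end points
   t = 0 and t = T, [wt] is the continuous extension of the time derivative. *)
Definition test_function (w wt wu : R -> R -> R) :=
  [/\ forall t, t \in `[0, T] -> periodic2pi (w t),
      [/\ {within `[0, T] `*` setT, continuous (fun p : R * R => w p.1 p.2)},
          {within `[0, T] `*` setT, continuous (fun p : R * R => wt p.1 p.2)} &
          {within `[0, T] `*` setT, continuous (fun p : R * R => wu p.1 p.2)}],
      forall t u : R, t \in `]0, T[ -> is_derive t (1 : R) (w ^~ u) (wt t u),
      forall t u : R, t \in `[0, T] -> is_derive u (1 : R) (w t) (wu t u)
    & closure [set p : R * R | p.1 \in `[0, T] /\ w p.1 p.2 != 0]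
        `<=` [set p | p.1 \in `[0, T[]].

(* The first three clauses on [x] say that the integrals in the definition
   exist as Lebesgue integrals: those of clause (1), those defining the
   velocity, and the one over [0, T] in clause (2). They are needed because
   [Rintegral] has a default value when its integrand is not integrable. *)
Definition weak_solution (rho0 : R -> Omega -> R) rho :=
  measurable_fun
    [set p : measurableTypeR R * measurableTypeR R * Omega |
       p.1.1 \in `[0, T] /\ circle p.1.2]
    (fun p => rho p.1.1 p.1.2 p.2) /\
  {ae m, forall x,
    [/\ forall t, t \in `[0, T] ->
          leb.-integrable circle (fun u => (rho t u x)%:E),
        forall t, t \in `[0, T] ->
          (\int[leb]_(u in circle) \int[nu x]_y `|rho t u y|%:E < +oo)%E,
        (\int[leb]_(t in `[0%R, T])
           ((\int[leb]_(u in circle) `|rho t u x|%:E) *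
            (\int[leb]_(u in circle) \int[nu x]_y `|rho t u y|%:E)) < +oo)%E,
        forall f : R -> R, continuous f -> periodic2pi f ->
          {within `[0, T], continuous
            (fun t => \int[leb]_(u in circle) (rho t u x * f u))}
      & forall w wt wu, test_function w wt wu ->
          \int[leb]_(t in `[0, T]) \int[leb]_(u in circle)
             (rho t u x * (wt t u + velocity rho t u x * wu t u))
          + \int[leb]_(u in circle) (w 0 u * rho0 u x) = 0]}.

(* Densities are identified when they differ on null sets: for m-a.e. x they
   define the same measure on the circle at every time. *)
Definition same_density rho rho' :=
  {ae m, forall x, forall t, t \in `[0, T] ->
     {ae leb, forall u, circle u -> rho t u x = rho' t u x}}.

End initial_value_problem.

(* Main.v *)
(* Existence. The characteristics X(t,u,x) of the mean-field equation
     d/dt X(t,u,x) = C int nu_x(dy) int mu_0^y(dv) D(X(t,v,y) - X(t,u,x))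
   are a fixed point of a contraction for a weighted supremum norm, and the
   solution is a density of the push-forward of mu_0^x by X(t,.,x) modulo 2 pi.
   It exists because the inverse of X(t,.,x) is Lipschitz.

   Uniqueness. Of a weak solution rho one only knows, for a.e. x, that it is a
   signed density and that its mass is integrable against the Lipschitz constant
   of the velocity. Let F_t be the distribution function of rho(t,.,x). Testing
   with smooth sawtooth functions that follow a characteristic gamma, one finds
   that F_t(gamma(t)) - F_s(gamma(s)) does not depend on gamma. As
   characteristics keep their order, rho stays nonnegative and its mass is that
   of mu_0^x. Hence the velocity is bounded, outside a null set N of x with
   nu_x(N) = 0 for x outside N; rho(t,.,x) is the push-forward of mu_0^x by the
   flow of its own velocity, and a Gronwall iteration, uniform in x outside N,
   shows that this flow is X. *)
Require Import Defs.
From HB Require Import structures.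
From mathcomp Require Import all_boot all_order all_algebra.
From mathcomp Require Import all_classical all_reals all_analysis.
From mathcomp Require Import measurable_realfun ess_sup_inf ring lra.

Set Implicit Arguments.
Unset Strict Implicit.
Unset Printing Implicit Defensive.
Import Order.TTheory GRing.Theory Num.Theory.
Import numFieldNormedType.Exports.

Local Open Scope classical_set_scope.
Local Open Scope ring_scope.

(** * Integrals and derivatives of real functions *)

(** The difficulty of uniqueness is that only mass times speed is controlled. The sawtooth is the
    right test function because its slope is constant off its jump. The transport term then sees
    only the total mass, the first moment and the mean velocity, and the jump yields the
    distribution function. Densities are compared through distribution functions throughout, since
    smooth tests determine these. A second obstacle is that the equation holds for [m]-a.e. [x],
    while the velocity at [x] is an integral over [nu x]. That almost every [nu x] ignores a given
    null set comes from the graphop acting on classes; iterating this gives one null set that no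
    remaining fiber sees. Finally, flow and solution must be jointly measurable in time, position
    and node. The fixed point is therefore sought among measurable functions, and the solution is
    given by an explicit formula instead of chosen densities. *)

Section Rintegral_lemmas.
Context d (T : measurableType d) (R : realType) (mu : {measure set T -> \bar R}).
Implicit Types (D : set T) (f g : T -> R).

Lemma Rintegrable_le D f g : measurable D -> measurable_fun D f ->
  (forall x, D x -> `|f x| <= g x) -> mu.-integrable D (EFin \o g) ->
  mu.-integrable D (EFin \o f).
Proof.
move=> mD mf fg; apply: le_integrable => //; first exact/measurable_EFinP.
by move=> x Dx /=; rewrite lee_fin (le_trans (fg _ Dx))// ler_norm.
Qed.

Lemma eq_Rintegrable D f g : measurable D -> (forall x, D x -> f x = g x) ->
  mu.-integrable D (EFin \o f) -> mu.-integrable D (EFin \o g).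
Proof.
by move=> mD fg; apply: eq_integrable => // x /set_mem Dx /=; rewrite fg.
Qed.

Lemma RintegrableP D f : measurable D -> mu.-integrable D (EFin \o f) -> measurable_fun D f.
Proof. by move=> mD /measurable_int /measurable_EFinP. Qed.

Lemma normr_Rintegral_le D f g : measurable D -> measurable_fun D f ->
  (forall x, D x -> `|f x| <= g x) -> mu.-integrable D (EFin \o g) ->
  `|\int[mu]_(x in D) f x| <= \int[mu]_(x in D) g x.
Proof.
move=> mD mf fg ig; have iff := Rintegrable_le mD mf fg ig.
apply: le_trans (le_normr_Rintegral mD iff) _.
by apply: le_Rintegral => //; exact: integrable_norm.
Qed.

Lemma RintegrableD D f g : measurable D -> mu.-integrable D (EFin \o f) ->
  mu.-integrable D (EFin \o g) -> mu.-integrable D (EFin \o (fun x => f x + g x)).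
Proof. by move=> mD fi gi; have := integrableD mD fi gi; exact. Qed.

Lemma RintegrableB D f g : measurable D -> mu.-integrable D (EFin \o f) ->
  mu.-integrable D (EFin \o g) -> mu.-integrable D (EFin \o (fun x => f x - g x)).
Proof. by move=> mD fi gi; have := integrableB mD fi gi; exact. Qed.

Lemma RintegrableZl D f (k : R) : measurable D -> mu.-integrable D (EFin \o f) ->
  mu.-integrable D (EFin \o (fun x => k * f x)).
Proof. by move=> mD fi; have := integrableZl mD k fi; exact. Qed.

Lemma RintegrableZr D f (k : R) : measurable D -> mu.-integrable D (EFin \o f) ->
  mu.-integrable D (EFin \o (fun x => f x * k)).
Proof. by move=> mD fi; have := integrableZr mD k fi; exact. Qed.

Lemma RintegrableMr D f g (k : R) : measurable D -> mu.-integrable D (EFin \o f) ->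
  measurable_fun D g -> (forall x, D x -> `|g x| <= k) ->
  mu.-integrable D (EFin \o (fun x => f x * g x)).
Proof.
move=> mD fi mg gk; have mf := RintegrableP mD fi.
apply: (@Rintegrable_le _ _ (fun x => `|f x| * k)) => //.
- exact: measurable_funM.
- by move=> x Dx; rewrite normrM ler_wpM2l// gk.
- by apply: (@RintegrableZr _ (fun x => `|f x|) k) => //; exact: integrable_norm.
Qed.

Lemma Rdominated_cvg D (f_ : nat -> T -> R) f g : measurable D ->
  (forall n, measurable_fun D (f_ n)) -> measurable_fun D f ->
  {ae mu, forall x, D x -> f_ ^~ x @ \oo --> f x} ->
  (forall n x, D x -> `|f_ n x| <= g x) -> mu.-integrable D (EFin \o g) ->
  (fun n => \int[mu]_(x in D) f_ n x) @ \oo --> \int[mu]_(x in D) f x.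
Proof.
move=> mD mf_ mf cf fg ig.
have [] := @dominated_convergence _ _ _ mu D mD (fun n => EFin \o f_ n) (EFin \o f) (EFin \o g).
- by move=> n; exact/measurable_EFinP.
- exact/measurable_EFinP.
- apply: filterS cf => x h Dx; apply: cvg_EFin; last exact: h.
  by apply: nearW => n.
- exact: ig.
- by apply: aeW => x n Dx /=; rewrite lee_fin fg.
move=> iff _ h; apply: fine_cvg.
rewrite fineK; first exact: h.
exact: integrable_fin_num iff.
Qed.

Lemma ae_eq_Rintegral D f g : measurable D -> measurable_fun D f -> measurable_fun D g ->
  {ae mu, forall x, D x -> f x = g x} -> \int[mu]_(x in D) f x = \int[mu]_(x in D) g x.
Proof.
move=> mD mf mg fg; congr fine; apply: ae_eq_integral => //; try exact/measurable_EFinP.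
by apply: filterS fg => x h Dx /=; rewrite h.
Qed.
End Rintegral_lemmas.

(** * Iterated integrals and measurability in parameters *)

Section Fubini.
Local Open Scope ereal_scope.
Context d1 d2 (T1 : measurableType d1) (T2 : measurableType d2) (R : realType).
Variables (m1 : {sigma_finite_measure set T1 -> \bar R}) (m2 : {sigma_finite_measure set T2 -> \bar R}).

(** [Rintegral] replaces an infinite inner integral by a default value. Absolute integrability
    confines this to a null set of outer points, so both iterated integrals agree with those for the
    product measure. *)
Lemma RFubini (A : set T1) (B : set T2) (f : T1 -> T2 -> R) :
  measurable A -> measurable B -> measurable_fun setT (fun p : T1 * T2 => f p.1 p.2) ->
  \int[m1]_(x in A) \int[m2]_(y in B) `|f x y|%:E < +oo ->
  (\int[m1]_(x in A) \int[m2]_(y in B) f x y = \int[m2]_(y in B) \int[m1]_(x in A) f x y)%R.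
Proof.
move=> mA mB mf fi.
pose F (p : T1 * T2) := ((f p.1 p.2)%:E : \bar R).
(* Extension by zero reduces the statement to Fubini on the whole product. *)
pose g := F \_ (A `*` B).
have mAB : measurable (A `*` B) by apply: measurableX.
have mg : measurable_fun setT g.
  apply/(measurable_restrictT _ mAB); apply: measurable_funTS.
  exact/measurable_EFinP.
have gx x : A x -> forall y, g (x, y) = ((EFin \o f x) \_ B) y.
  by move=> Ax y; rewrite /g !patchE in_setX mem_set//= /F.
have gx0 x : ~ A x -> forall y, g (x, y) = 0.
  by move=> Ax y; rewrite /g patchE in_setX memNset.
have gy y : B y -> forall x, g (x, y) = ((EFin \o f^~ y) \_ A) x.
  by move=> By x; rewrite /g !patchE in_setX (mem_set By) andbT.
have gy0 y : ~ B y -> forall x, g (x, y) = 0.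
  by move=> By x; rewrite /g patchE in_setX (memNset By) andbF.
have ig : (m1 \x m2).-integrable setT g.
  apply/integrable12ltyP => //; move: fi; rewrite integral_mkcond/=; congr (_ < _).
  apply: eq_integral => x _; rewrite patchE; case: ifPn => [/set_mem xA|/negP xA].
    rewrite integral_mkcond; apply: eq_integral => y _; rewrite gx// !patchE.
    by case: ifPn => //; rewrite abse0.
  rewrite integral0_eq// => y _; rewrite gx0 ?abse0//.
  by move=> ?; apply: xA; rewrite inE.
have I1 x : A x -> \int[m2]_y g (x, y) = \int[m2]_(y in B) (f x y)%:E.
  by move=> Ax; rewrite [RHS]integral_mkcond; apply: eq_integral => y _; rewrite gx.
have I2 y : B y -> \int[m1]_x g (x, y) = \int[m1]_(x in A) (f x y)%:E.
  by move=> Ax; rewrite [RHS]integral_mkcond; apply: eq_integral => x _; rewrite gy.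
transitivity (fine (\int[m1]_x \int[m2]_y g (x, y))).
  congr fine; rewrite integral_mkcond.
  apply: ae_eq_integral => //.
  - apply/(measurable_restrictT _ mA)/measurable_EFinP.
    apply: (eq_measurable_fun (fine \o fubini_F m2 g)).
      by move=> x /set_mem Ax /=; rewrite /fubini_F I1.
    apply: measurable_funTS; apply: measurableT_comp => //.
    exact: (measurable_fubini_F ig).
  - exact: (measurable_fubini_F ig).
  (* Only for almost every [x] is the section integrable, so that its integral is finite and
     unchanged by [fine]. *)
  - apply: filterS (ae_integrable1 ig) => x /= ix _; rewrite patchE.
    case: ifPn => [/set_mem xA|/negP xA].
      by move: (integrable_fin_num measurableT ix); rewrite I1// => h; rewrite /Rintegral fineK.
    rewrite integral0_eq// => y _; rewrite gx0//.
    by move=> ?; apply: xA; rewrite inE.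
rewrite (Fubini ig).
congr fine; rewrite [RHS]integral_mkcond; apply/esym.
apply: ae_eq_integral => //.
- apply/(measurable_restrictT _ mB)/measurable_EFinP.
  apply: (eq_measurable_fun (fine \o fubini_G m1 g)).
    by move=> x /set_mem Ax /=; rewrite /fubini_G I2.
  apply: measurable_funTS; apply: measurableT_comp => //.
  exact: (measurable_fubini_G ig).
- exact: (measurable_fubini_G ig).
- apply: filterS (ae_integrable2 ig) => x /= ix _; rewrite patchE.
  case: ifPn => [/set_mem xA|/negP xA].
    by move: (integrable_fin_num measurableT ix); rewrite I2// => h; rewrite /Rintegral fineK.
  rewrite integral0_eq// => y _; rewrite gy0//.
  by move=> ?; apply: xA; rewrite inE.
Qed.
End Fubini.

Lemma mitv (R : realType) (i : interval R) : measurable ([set` i] : set (measurableTypeR R)).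
Proof. exact: measurable_itv. Qed.

Section measurable_Rintegral.
Local Open Scope ereal_scope.
Context d1 d2 (T1 : measurableType d1) (T2 : measurableType d2) (R : realType).

Lemma measurable_ge0_integral (m2 : {sigma_finite_measure set T2 -> \bar R}) (B : set T2) (H : T1 -> T2 -> \bar R) :
  measurable B -> (forall x y, 0 <= H x y) -> measurable_fun setT (fun p : T1 * T2 => H p.1 p.2) ->
  measurable_fun setT (fun x => \int[m2]_(y in B) H x y).
Proof.
move=> mB H0 mH.
rewrite [X in measurable_fun _ X](_ : _ = fubini_F m2
     (fun p => H p.1 p.2 * (\1_B p.2)%:E)); last first.
  apply/funext => x; rewrite integral_mkcond /fubini_F; apply: eq_integral => y _.
  by rewrite patchE/= indicE; case: ifPn => _; rewrite ?mule1 ?mule0.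
apply: measurable_fun_fubini_tonelli_F.
  apply: emeasurable_funM => //; apply/measurable_EFinP.
  by apply: measurableT_comp => //; exact: measurable_indic.
by move=> p; rewrite mule_ge0// lee_fin.
Qed.

Lemma measurable_Rintegral (m2 : {sigma_finite_measure set T2 -> \bar R}) (B : set T2) (H : T1 -> T2 -> R) :
  measurable B -> measurable_fun setT (fun p : T1 * T2 => H p.1 p.2) ->
  measurable_fun setT (fun x => \int[m2]_(y in B) H x y)%R.
Proof.
move=> mB mH; apply: measurableT_comp => //.
rewrite [X in measurable_fun _ X](_ : _ = (fun x => (\int[m2]_(y in B) (fun y => (H x y)%:E)^\+ y)
   - (\int[m2]_(y in B) (fun y => (H x y)%:E)^\- y))); last first.
  by apply/funext => x; rewrite integralE.
have mE : measurable_fun setT (fun p : T1 * T2 => (H p.1 p.2)%:E) by exact/measurable_EFinP.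
apply: emeasurable_funB; apply: measurable_ge0_integral => //.
- apply: eq_measurable_fun (measurable_funepos mE) => p _.
  by rewrite !funeposE.
- apply: eq_measurable_fun (measurable_funeneg mE) => p _.
  by rewrite !funenegE.
Qed.

Lemma measurable_kRintegral (k : R.-sfker T1 ~> T2) (H : T1 -> T2 -> R) :
  measurable_fun setT (fun p : T1 * T2 => H p.1 p.2) ->
  measurable_fun setT (fun x => \int[k x]_y H x y)%R.
Proof.
move=> mH; apply: measurableT_comp => //.
rewrite [X in measurable_fun _ X](_ : _ = (fun x => (\int[k x]_y (fun p : T1 * T2 => (H p.1 p.2)%:E)^\+ (x, y))
   - (\int[k x]_y (fun p : T1 * T2 => (H p.1 p.2)%:E)^\- (x, y)))); last first.
  apply/funext => x; rewrite integralE.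
  by congr (_ - _); apply: eq_integral => y _; rewrite ?funeposE ?funenegE.
have mE : measurable_fun setT (fun p : T1 * T2 => (H p.1 p.2)%:E) by exact/measurable_EFinP.
apply: emeasurable_funB.
- exact: (@measurable_fun_integral_sfinite_kernel _ _ _ _ _ _ k (@funepos_ge0 _ _ _) (measurable_funepos mE)).
- exact: (@measurable_fun_integral_sfinite_kernel _ _ _ _ _ _ k (@funeneg_ge0 _ _ _) (measurable_funeneg mE)).
Qed.
End measurable_Rintegral.

Lemma measurable_pair1 d1 d2 d3 (T1 : measurableType d1) (T2 : measurableType d2) (T3 : measurableType d3)
  (H : T1 -> T2 -> T3) x : measurable_fun setT (fun p : T1 * T2 => H p.1 p.2) -> measurable_fun setT (H x).
Proof. by move=> mH; exact: (measurableT_comp mH (pair1_measurable x)). Qed.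

Lemma measurable_pair2 d1 d2 d3 (T1 : measurableType d1) (T2 : measurableType d2) (T3 : measurableType d3)
  (H : T1 -> T2 -> T3) y : measurable_fun setT (fun p : T1 * T2 => H p.1 p.2) -> measurable_fun setT (H ^~ y).
Proof. by move=> mH; exact: (measurableT_comp mH (pair2_measurable y)). Qed.

Lemma cvg_dist_le (R : realType) (u v : nat -> R) (a : R) :
  v @ \oo --> (0 : R) -> (forall n, `|u n - a| <= v n) -> u @ \oo --> a.
Proof.
move=> v0 uv; apply/cvgrPdist_le => eps eps0.
near=> n; rewrite distrC; apply: le_trans (uv n) _.
near: n; exact: (cvgr_le 0 v0).
Unshelve. all: by end_near. Qed.

(** Supplies the finiteness that [RFubini] and [Rintegral_triangle] ask for. *)
Lemma iterated_lty d1 d2 (T1 : measurableType d1) (T2 : measurableType d2) (R : realType)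
    (m1 : {sigma_finite_measure set T1 -> \bar R}) (m2 : {sigma_finite_measure set T2 -> \bar R})
    (A : set T1) (B : set T2) (F : T1 -> T2 -> R) (a : T1 -> R) (b : T2 -> R) :
  measurable A -> measurable B -> measurable_fun setT (fun p : T1 * T2 => F p.1 p.2) ->
  m1.-integrable A (EFin \o a) -> m2.-integrable B (EFin \o b) ->
  (forall x y, A x -> B y -> `|F x y| <= a x * b y) ->
  (\int[m1]_(x in A) \int[m2]_(y in B) `|F x y|%:E < +oo)%E.
Proof.
move=> mA mB mF ia ib Fab.
have ma := RintegrableP mA ia; have mb := RintegrableP mB ib.
have ia' := integrable_norm ia; have ib' := integrable_norm ib.
pose K := (\int[m2]_(y in B) `|b y|%:E)%E.
have K0 : (0 <= K)%E by apply: integral_ge0 => y _; rewrite lee_fin.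
have Kfin : K \is a fin_num by have := integrable_fin_num mB ib'.
apply: (@le_lt_trans _ _ (\int[m1]_(x in A) (`|a x| * fine K)%:E)%E); last first.
  exact: integrable_lty (RintegrableZr (fine K) mA ia').
apply: ge0_le_integral => //.
- by move=> x _; apply: integral_ge0 => y _; rewrite lee_fin.
- apply: measurable_funTS; apply: measurable_ge0_integral => //.
  by apply/measurable_EFinP; exact: measurableT_comp.
- apply/measurable_EFinP; apply: measurable_funM => //; exact: measurableT_comp.
move=> x Ax; rewrite EFinM fineK//.
rewrite -ge0_integralZl//; last by apply/measurable_EFinP; exact: measurableT_comp.
apply: ge0_le_integral => //.
- apply/measurable_EFinP/measurable_funTS/measurableT_comp => //; exact: measurable_pair1 mF.
- apply/measurable_EFinP; apply: measurable_funM => //; exact: measurableT_comp.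
move=> y By; rewrite -EFinM lee_fin -normrM.
by apply: le_trans (Fab x y Ax By) _; exact: ler_norm.
Qed.

Lemma eq_RintegralL (R : realType) (D : set R) (f g : R -> R) : (forall x, D x -> f x = g x) ->
  \int[lebesgue_measure]_(x in D) f x = \int[lebesgue_measure]_(x in D) g x.
Proof. by move=> fg; apply: eq_Rintegral => x /set_mem; exact: fg. Qed.

Section real_derivatives.
Context {R : realType}.
Implicit Types (f g : R -> R) (x a b c : R).

Lemma dR_eq f x a b : is_derive x (1 : R) f a -> a = b -> is_derive x (1 : R) f b.
Proof. by move=> h <-. Qed.

Lemma dR_cst c x : is_derive x (1 : R) (fun=> c) 0.
Proof. exact: is_derive_cst. Qed.

Lemma dR_id x : is_derive x (1 : R) (fun y : R => y) 1.
Proof. exact: is_derive_id. Qed.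

Lemma dR_add f g x a b : is_derive x (1 : R) f a -> is_derive x (1 : R) g b ->
  is_derive x (1 : R) (fun y => f y + g y) (a + b).
Proof. by move=> df dg; exact: is_deriveD. Qed.

Lemma dR_sub f g x a b : is_derive x (1 : R) f a -> is_derive x (1 : R) g b ->
  is_derive x (1 : R) (fun y => f y - g y) (a - b).
Proof. by move=> df dg; exact: is_deriveB. Qed.

Lemma dR_mul f g x a b : is_derive x (1 : R) f a -> is_derive x (1 : R) g b ->
  is_derive x (1 : R) (fun y => f y * g y) (a * g x + f x * b).
Proof.
move=> df dg; apply: (dR_eq (is_deriveM df dg)).
by rewrite /GRing.scale/= addrC mulrC [X in _ + X]mulrC addrC [X in X + _]mulrC addrC mulrC.
Qed.

Lemma dR_mulc c g x b : is_derive x (1 : R) g b -> is_derive x (1 : R) (fun y => c * g y) (c * b).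
Proof. by move=> dg; exact: is_deriveZ. Qed.

Lemma dR_inv f x a : f x != 0 -> is_derive x (1 : R) f a ->
  is_derive x (1 : R) (fun y => (f y)^-1) (- a / f x ^+ 2).
Proof.
move=> fx df; apply: (dR_eq (is_deriveV fx df)).
by rewrite /GRing.scale/= mulNr mulrC mulNr.
Qed.

Lemma dR_exp n x : is_derive x (1 : R) (fun y => y ^+ n.+1) (n.+1%:R * x ^+ n).
Proof.
have := @is_deriveX R R id n.+1 x (1 : R) 1 (is_derive_id _ _).
rewrite (_ : id ^+ n.+1 = fun y => y ^+ n.+1).
  by move=> h; apply: (dR_eq h); rewrite /GRing.scale/= mulr1.
by apply/funext => y; elim: (n) => // m ih; rewrite exprS [RHS]exprS -ih.
Qed.

Lemma dR_comp f g x a b : is_derive (g x) (1 : R) f a -> is_derive x (1 : R) g b ->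
  is_derive x (1 : R) (fun y => f (g y)) (a * b).
Proof. by move=> df dg; exact: is_derive1_comp. Qed.

Lemma dR_continuous f (f' : R -> R) : (forall x : R, is_derive x (1 : R) f (f' x)) -> continuous f.
Proof. by move=> df x; apply/differentiable_continuous/derivable1_diffP; have := df x. Qed.
End real_derivatives.

(** Banach's theorem for the distance weighted by [h], on functions that may be unbounded and
    infinitely far apart. Completeness of a function space is replaced by the closedness of [P]
    under pointwise limits, which measurability satisfies. *)
Lemma contraction_fixpoint (R : realType) (J : Type) (h : J -> R) (P : (J -> R) -> Prop)
    (F : (J -> R) -> J -> R) (x0 : J -> R) :
  (forall j, 0 <= h j) -> P x0 -> (forall X, P X -> P (F X)) ->
  (forall (Xn : nat -> J -> R) X, (forall n, P (Xn n)) ->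
     (forall j, Xn ^~ j @ \oo --> X j) -> P X) ->
  (forall X Y (K : R), 0 <= K -> P X -> P Y -> (forall j, `|X j - Y j| <= K * h j) ->
     forall j, `|F X j - F Y j| <= K / 2 * h j) ->
  (exists K : R, 0 <= K /\ forall j, `|F x0 j - x0 j| <= K * h j) ->
  exists X, P X /\ forall j, F X j = X j.
Proof.
move=> h0 Px0 PF Pcl Fc [K [K0 hK]].
pose x n := iter n F x0.
have Px n : P (x n) by elim: n => //= n ih; exact: PF.
pose c n : R := K * 2^-1 ^+ n.
have c0 n : 0 <= c n by rewrite mulr_ge0// exprn_ge0.
have cS n : c n.+1 = c n / 2 by rewrite /c exprS; ring.
have dx n j : `|x n.+1 j - x n j| <= c n * h j.
  elim: n j => [j|n ih j]; first by rewrite /c expr0 mulr1; exact: hK.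
  by rewrite cS; exact: (Fc (x n.+1) (x n) (c n) (c0 n) (Px _) (Px _) ih).
have cc j : (fun n => 2 * c n * h j) @ \oo --> 0.
  rewrite (_ : (fun n => 2 * c n * h j) = (fun n => 2 * K * h j * 2^-1 ^+ n)); last first.
    by apply/funext => n; rewrite /c; ring.
  rewrite -[X in _ --> X](mulr0 (2 * K * h j)); apply: cvgM; [exact: cvg_cst|apply: cvg_expr].
  by rewrite gtr0_norm ?invr_gt0// invf_lt1// ltr1n.
(* [2 * c n * h j] dominates the tail of the telescoping series. Subtracting it makes the iterates
   nondecreasing, adding it makes them nonincreasing, so they converge at each [j] by
   monotonicity. *)
pose u j n := x n j - 2 * c n * h j.
have uv j n : x n j = u j n + 2 * c n * h j by rewrite /u subrK.
have ndu j : nondecreasing_seq (u j).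
  apply/nondecreasing_seqP => n; rewrite /u cS.
  by have := dx n j; rewrite ler_norml => /andP[]; lra.
have niv j : nonincreasing_seq (fun n => x n j + 2 * c n * h j).
  apply/nonincreasing_seqP => n; rewrite cS.
  by have := dx n j; rewrite ler_norml => /andP[]; lra.
have hu j n : u j n <= x 0%N j + 2 * c 0%N * h j.
  apply: le_trans (niv j _ _ (leq0n n)).
  by rewrite /u; have := mulr_ge0 (c0 n) (h0 j); lra.
have cvu j : cvgn (u j).
  apply: nondecreasing_is_cvgn; first exact: ndu.
  by exists (x 0%N j + 2 * c 0%N * h j) => _ [n _ <-]; exact: hu.
pose X j := limn (u j).
have cvx j : x ^~ j @ \oo --> X j.
  rewrite (_ : x^~ j = fun n => u j n + 2 * c n * h j); last by apply/funext => n; exact: uv.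
  by rewrite -[X j]addr0; apply: cvgD; [exact: cvu|exact: cc].
have XB n j : `|X j - x n j| <= 2 * c n * h j.
  rewrite ler_norml; apply/andP; split.
    by have := nondecreasing_cvgn_le (ndu j) (cvu j) n; rewrite -/(X j) /u; lra.
  have : X j <= x n j + 2 * c n * h j; last lra.
  apply: limr_le; first exact: cvu.
  near=> m; have mn : (n <= m)%N by near: m; exact: nbhs_infty_ge.
  apply: le_trans (niv j _ _ mn).
  by rewrite /u; have := mulr_ge0 (c0 m) (h0 j); lra.
have PX : P X by apply: (Pcl x).
exists X; split=> // j.
have FX n : `|F X j - X j| <= 2 * c n * h j.
  have := Fc X (x n) (2 * c n) (mulr_ge0 (ler0n _ _) (c0 n)) PX (Px n) (XB n) j.
  have := XB n.+1 j; rewrite cS /= -/(x n).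
  move=> h1 h2; have -> : F X j - X j = (F X j - F (x n) j) + (F (x n) j - X j) by ring.
  rewrite (le_trans (ler_normD _ _))//; rewrite distrC in h1; lra.
apply/eqP; rewrite -subr_eq0 -normr_le0.
rewrite -(cvg_lim (@Rhausdorff R) (cc j)).
apply: limr_ge; first by apply/cvg_ex; exists 0; exact: cc.
by near=> n; exact: FX.
Unshelve. all: by end_near. Qed.

Lemma RFTC2 (R : realType) (f F : R -> R) (a b : R) : a <= b ->
  (forall x : R, is_derive x (1 : R) F (f x)) -> continuous f ->
  \int[lebesgue_measure]_(x in `[a, b]) f x = F b - F a.
Proof.
rewrite le_eqVlt => /predU1P[<- _ _|ab dF cf].
  by rewrite set_itv1 Rintegral_set1 subrr.
have cF : continuous F by move=> x; apply/differentiable_continuous/derivable1_diffP; have := dF x.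
rewrite /Rintegral (@continuous_FTC2 _ f F)//.
- exact: continuous_subspaceT.
- split; [by move=> x _; have := dF x| |].
  + by apply: cvg_at_right_filter; exact: cF.
  + by apply: cvg_at_left_filter; exact: cF.
- by move=> x _; rewrite derive1E; have [] := dF x.
Qed.

Lemma is_derive_expRM (R : realType) (M x : R) :
  is_derive x (1 : R) (fun r => expR (M * r)) (M * expR (M * x)).
Proof.
have d1 : is_derive x (1 : R) (fun r => M * r) M.
  apply: is_derive_eq; exact: mulr1.
have := @is_derive1_comp R expR (fun r => M * r) x _ _ (is_derive_expR _) d1.
by rewrite mulrC.
Qed.

Lemma Rintegral_expRM (R : realType) (M s t : R) : M != 0 -> s <= t ->
  \int[lebesgue_measure]_(r in `[s, t]) expR (M * r) = (expR (M * t) - expR (M * s)) / M.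
Proof.
move=> M0 st; transitivity (M^-1 * expR (M * t) - M^-1 * expR (M * s)); last first.
  by rewrite -mulrBr mulrC.
apply: (@RFTC2 _ (fun r => expR (M * r)) (fun r => M^-1 * expR (M * r)) s t st).
- move=> x; have := is_derive_expRM M x => d.
  by apply: is_derive_eq; rewrite /GRing.scale/= mulrA mulVf// mul1r.
- move=> x; apply: continuous_comp; last exact: continuous_expR.
  by apply: cvgM; [exact: cvg_cst|exact: cvg_id].
Qed.

(** This gives Picard iteration and Gronwall's inequality the factor 1/2 for a Lipschitz constant
    that is merely integrable. Up to some level the constant is absorbed by a large [M]; what
    exceeds the level has a small integral. *)
Lemma exp_weight (R : realType) (l : R -> R) (a b : R) :
  (forall t, 0 <= l t) -> lebesgue_measure.-integrable `[a, b] (EFin \o l) ->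
  exists M : R, 0 < M /\ forall s t, a <= s -> s <= t -> t <= b ->
    \int[lebesgue_measure]_(r in `[s, t]) (l r * expR (M * r)) <= expR (M * t) / 2.
Proof.
move=> l0 il.
have ml : measurable_fun `[a, b] l by move/integrableP : (il) => [/measurable_EFinP].
(* The part of [l] above the level [n]; its integral tends to 0 by dominated convergence. *)
pose e n r := Num.max (l r - n%:R) 0.
have me n : measurable_fun `[a, b] (e n).
  apply: measurable_maxr => //; exact: measurable_funB.
have ce : (fun n => \int[lebesgue_measure]_(r in `[a, b]) e n r) @ \oo --> (0 : R).
  rewrite -[X in _ --> X](_ : \int[lebesgue_measure]_(r in `[a, b]) (0 : R) = 0); last first.
    by rewrite Rintegral_cst// mul0r.
  apply: (@Rdominated_cvg _ _ R lebesgue_measure `[a,b]%classic e (cst 0) l) => //.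
  - apply: aeW => r _; apply: cvg_near_cst; near=> n.
    rewrite /e; apply/max_idPr; rewrite subr_le0.
    by near: n; exact: nbhs_infty_ger.
  - move=> n r _; rewrite /e ger0_norm ?le_max ?lexx ?orbT// ge_max l0 andbT.
    by rewrite lerBlDr lerDl.
have : \forall n \near \oo, \int[lebesgue_measure]_(r in `[a, b]) e n r <= 1 / 8.
  by apply: (cvgr_le 0 ce); lra.
move=> [n _ /(_ n (leqnn n))] /= he.
(* The bounded part then contributes at most a quarter of [expR (M * t)] and the excess at most an
   eighth. Using [n.+1] in place of [n] keeps [M] positive. *)
exists (4 * n.+1%:R); split; first by rewrite mulr_gt0.
move=> s t as_ st tb; set M := 4 * _.
have M0 : 0 < M by rewrite mulr_gt0.
have sub : `[s, t]%classic `<=` `[a, b]%classic by apply: subset_itv; rewrite bnd_simp.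
have ie : lebesgue_measure.-integrable `[a, b] (EFin \o e n).
  apply: (Rintegrable_le (mitv _) (me n) _ il) => r _.
  rewrite /e ger0_norm ?le_max ?lexx ?orbT// ge_max l0 andbT.
  by rewrite lerBlDr lerDl.
have cexp : continuous (fun r => expR (M * r)).
  move=> r; apply: continuous_comp; last exact: continuous_expR.
  by apply: cvgM; [exact: cvg_cst|exact: cvg_id].
have mexp (A : set R) : measurable_fun A (fun r => expR (M * r)).
  by apply: measurable_funTS; exact: continuous_measurable_fun.
have iexp : lebesgue_measure.-integrable `[s, t] (EFin \o (fun r => expR (M * r))).
  by apply: continuous_compact_integrable; [exact: segment_compact|exact: continuous_subspaceT].
have lef r : s <= r <= t -> l r * expR (M * r) <= n.+1%:R * expR (M * r) + e n r * expR (M * t).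
  move=> /andP[sr rt].
  have h1 : expR (M * r) <= expR (M * t) by rewrite ler_expR ler_pM2l.
  have e0 : 0 <= e n r by rewrite le_max lexx orbT.
  have le : l r <= n.+1%:R + e n r.
    rewrite -natr1; have : l r - n%:R <= e n r by rewrite le_max lexx.
    lra.
  apply: le_trans (_ : (n.+1%:R + e n r) * expR (M * r) <= _).
    by rewrite ler_wpM2r// expR_ge0.
  by rewrite mulrDl lerD2l ler_wpM2l.
have ies : lebesgue_measure.-integrable `[s, t] (EFin \o e n) by exact: integrableS ie.
have i1 : lebesgue_measure.-integrable `[s, t] (EFin \o (fun r => n.+1%:R * expR (M * r))).
  exact: RintegrableZl (mitv _) iexp.
have i2 : lebesgue_measure.-integrable `[s, t] (EFin \o (fun r => e n r * expR (M * t))).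
  exact: RintegrableZr (mitv _) ies.
have i12 := RintegrableD (mitv _) i1 i2.
apply: (@le_trans _ _ (\int[lebesgue_measure]_(r in `[s, t]) (n.+1%:R * expR (M * r) + e n r * expR (M * t)))).
  apply: le_Rintegral => //.
  - apply: (@Rintegrable_le _ _ _ lebesgue_measure _ _ (fun r => n.+1%:R * expR (M * r) + e n r * expR (M * t))) => //.
    + have mls : measurable_fun `[s, t] l by apply: measurable_funS sub ml.
      by apply: measurable_funM => //; exact: mexp.
    + move=> r; rewrite /= in_itv/= => /lef.
      by rewrite ger0_norm// mulr_ge0// expR_ge0.
rewrite RintegralD// RintegralZl// RintegralZr// Rintegral_expRM ?gt_eqF//.
have h2 : \int[lebesgue_measure]_(r in `[s, t]) e n r <= 1 / 8.
  apply: le_trans he.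
  rewrite /Rintegral; apply: fine_le; [by have := integrable_fin_num (mitv _) ies|by have := integrable_fin_num (mitv _) ie|].
  apply: ge0_subset_integral => //; first by apply/measurable_EFinP; exact: me.
  by move=> r _; rewrite lee_fin le_max lexx orbT.
have h3 : n.+1%:R * ((expR (M * t) - expR (M * s)) / M) = (expR (M * t) - expR (M * s)) / 4.
  by rewrite /M; field.
rewrite h3; move: (ler_wpM2r (expR_ge0 (M * t)) h2) (expR_ge0 (M * t)) (expR_ge0 (M * s)).
move: (expR _) (expR _) (Rintegral _ _ _) => E E' Q; clear; lra.
Unshelve. all: by end_near. Qed.

Lemma continuous_Rintegrable (R : realType) (f : R -> R) (a b : R) : continuous f ->
  lebesgue_measure.-integrable `[a, b] (EFin \o f).
Proof.
by move=> cf; apply: continuous_compact_integrable; [exact: segment_compact|exact: continuous_subspaceT].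
Qed.

Lemma is_derive_primitive (R : realType) (f : R -> R) (a x : R) : continuous f -> a < x ->
  is_derive x (1 : R) (fun t => \int[lebesgue_measure]_(r in `[a, t]) f r) (f x).
Proof.
move=> cf ax.
have xx : x < x + 1 by rewrite ltrDl.
have [d1 d2] := continuous_FTC1_closed xx (continuous_Rintegrable a (x + 1) cf) ax (cf x).
by rewrite -d2 derive1E; exact/derivableP.
Qed.

Lemma Rintegral_split (R : realType) (f : R -> R) (a b c : R) : a <= b -> b <= c ->
  lebesgue_measure.-integrable `[a, c] (EFin \o f) ->
  \int[lebesgue_measure]_(x in `[a, c]) f x =
  \int[lebesgue_measure]_(x in `[a, b]) f x + \int[lebesgue_measure]_(x in `[b, c]) f x.
Proof.
move=> ab bc ifn.
have ib : lebesgue_measure.-integrable `[b, c] (EFin \o f).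
  by apply: integrableS ifn => //; apply: subset_itvr; rewrite bnd_simp.
have := @Rintegral_itvB R f (BLeft a) (BRight c) b ifn.
rewrite !bnd_simp => /(_ ab bc) /eqP; rewrite subr_eq addrC => /eqP ->.
rewrite Rintegral_itv_obnd_cbnd//.
by apply: integrableS ib => //; apply: subset_itv_oc_cc.
Qed.

Lemma Rintegral_triangle (R : realType) (F : R -> R -> R) (s t : R) :
  measurable_fun setT (fun p : measurableTypeR R * measurableTypeR R => F p.1 p.2) ->
  (\int[lebesgue_measure]_(x in `[s, t]) \int[lebesgue_measure]_(y in `[s, t]) `|F x y|%:E < +oo)%E ->
  \int[lebesgue_measure]_(x in `[s, t]) \int[lebesgue_measure]_(y in `[x, t]) F x y =
  \int[lebesgue_measure]_(y in `[s, t]) \int[lebesgue_measure]_(x in `[s, y]) F x y.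
Proof.
move=> mF Fi.
(* The indicator of [x <= y] turns the triangle into a square. *)
pose G x y := F x y * (x <= y)%R%:R.
have mG : measurable_fun setT (fun p : measurableTypeR R * measurableTypeR R => G p.1 p.2).
  apply: measurable_funM => //.
  have mle : measurable_fun setT (fun p : measurableTypeR R * measurableTypeR R => p.1 <= p.2).
    exact: measurable_fun_ler.
  apply: (measurableT_comp (f := fun b : bool => b%:R : R)) mle => //.
have Gi : (\int[lebesgue_measure]_(x in `[s, t]) \int[lebesgue_measure]_(y in `[s, t]) `|G x y|%:E < +oo)%E.
  apply: le_lt_trans Fi.
  have mGx x : measurable_fun setT (fun y : measurableTypeR R => `|G x y|%:E).
    apply/measurable_EFinP/measurableT_comp => //.
    exact: (measurableT_comp mG (pair1_measurable x)).
  have mFx x : measurable_fun setT (fun y : measurableTypeR R => `|F x y|%:E).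
    apply/measurable_EFinP/measurableT_comp => //.
    exact: (measurableT_comp mF (pair1_measurable x)).
  have mm (H : R -> R -> R) : measurable_fun setT (fun p : measurableTypeR R * measurableTypeR R => H p.1 p.2) ->
     measurable_fun `[s, t] (fun x : measurableTypeR R => \int[lebesgue_measure]_(y in `[s, t]) `|H x y|%:E)%E.
    move=> mH; apply: measurable_funTS; apply: measurable_ge0_integral => //.
    by apply/measurable_EFinP; exact: measurableT_comp.
  apply: ge0_le_integral => //.
  - by move=> x _; exact: integral_ge0.
  - exact: mm.
  - exact: mm.
  - move=> x _; apply: ge0_le_integral => //.
    + by apply: measurable_funTS; exact: mGx.
    + by apply: measurable_funTS; exact: mFx.
    + move=> y _; rewrite lee_fin /G normrM.
      by case: (x <= y)%R; rewrite ?normr1 ?normr0 ?mulr1 ?mulr0.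
have := RFubini (mitv _) (mitv _) mG Gi.
rewrite [X in X = _ -> _](_ : _ = \int[lebesgue_measure]_(x in `[s, t]) \int[lebesgue_measure]_(y in `[x, t]) F x y); last first.
  apply: eq_Rintegral => x /set_mem; rewrite /= in_itv/= => /andP[sx xt].
  rewrite [LHS]Rintegral_mkcond [RHS]Rintegral_mkcond; congr Rintegral; apply/funext => y.
  rewrite !patchE !mem_setE !in_itv/= /G.
  case: (leP x y) => xy; last by rewrite mulr0 if_same.
  by rewrite mulr1 (le_trans sx xy).
move=> ->.
apply: eq_Rintegral => x /set_mem; rewrite /= in_itv/= => /andP[sx xt].
rewrite [LHS]Rintegral_mkcond [RHS]Rintegral_mkcond; congr Rintegral; apply/funext => y.
rewrite !patchE !mem_setE !in_itv/= /G.
case: (leP y x) => xy; last by rewrite mulr0 if_same andbF.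
by rewrite mulr1 (le_trans xy xt).
Qed.

(** [gam] is only absolutely continuous, so the classical chain rule does not apply to it. It does
    apply to primitives of continuous approximations of [g] in L1, and these converge to [gam]
    uniformly. *)
Lemma chain_AC (R : realType) (f f' g gam : R -> R) (s t B : R) : s <= t ->
  (forall x : R, is_derive x (1 : R) f (f' x)) -> continuous f' -> (forall x, `|f' x| <= B) ->
  lebesgue_measure.-integrable `[s, t] (EFin \o g) ->
  (forall r, s <= r <= t -> gam r = gam s + \int[lebesgue_measure]_(x in `[s, r]) g x) ->
  f (gam t) - f (gam s) = \int[lebesgue_measure]_(r in `[s, t]) (f' (gam r) * g r).
Proof.
move=> st df cf' bf ig hgam.
have B0 : 0 <= B by rewrite (le_trans _ (bf 0)).
have cgam (h : R -> R) : lebesgue_measure.-integrable `[s, t] (EFin \o h) ->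
    measurable_fun `[s, t] (fun r => gam s + \int[lebesgue_measure]_(x in `[s, r]) h x).
  move=> ih; apply: subspace_continuous_measurable_fun => //.
  move=> x; apply: cvgD; first exact: cvg_cst.
  exact: parameterized_integral_continuous.
have mst : (lebesgue_measure (`[s, t]%classic : set R) < +oo)%E.
  by rewrite lebesgue_measure_itv/=; case: ifPn => // _; rewrite -EFinD ltry.
have [gn [cgn ign gn0]] := approximation_continuous_integrable (mitv `[s, t]) mst ig.
pose gamn n r := gam s + \int[lebesgue_measure]_(x in `[s, r]) gn n x.
pose e n := \int[lebesgue_measure]_(x in `[s, t]) `|g x - gn n x|.
have ie n : lebesgue_measure.-integrable `[s, t] (EFin \o (fun x => `|g x - gn n x|)).
  by apply: integrable_norm => //; exact: RintegrableB.
have e0 : e @ \oo --> 0.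
  apply: fine_cvg; exact: gn0.
have hgn n r : s <= r <= t -> `|gamn n r - gam r| <= e n.
  move=> /andP[sr rt]; rewrite hgam ?sr// /gamn opprD addrACA subrr add0r.
  have sub : `[s, r]%classic `<=` `[s, t]%classic by apply: subset_itvl; rewrite bnd_simp.
  have i1 : lebesgue_measure.-integrable `[s, r] (EFin \o g) by apply: integrableS ig.
  have i2 : lebesgue_measure.-integrable `[s, r] (EFin \o gn n) by apply: integrableS (ign n).
  rewrite distrC -RintegralB//.
  apply: (le_trans (le_normr_Rintegral (mitv _) (RintegrableB (mitv _) i1 i2))).
  rewrite /Rintegral; apply: fine_le.
  - apply: integrable_fin_num => //; apply: integrable_norm; exact: RintegrableB.
  - by apply: integrable_fin_num => //; exact: ie.
  - apply: ge0_subset_integral => //.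
    by have /measurable_int := ie n.
have hn n : f (gamn n t) - f (gamn n s) = \int[lebesgue_measure]_(r in `[s, t]) (f' (gamn n r) * gn n r).
  (* A primitive based at [s - 1] is differentiable at [s] as well; [cc] compensates for the added
     integral. *)
  pose cc := gam s - \int[lebesgue_measure]_(x in `[s - 1, s]) gn n x.
  have s1s : s - 1 < s by rewrite ltrBlDr ltrDl.
  have gnE r : s <= r -> gamn n r = cc + \int[lebesgue_measure]_(x in `[s - 1, r]) gn n x.
    move=> sr; rewrite /cc (Rintegral_split (ltW s1s) sr (continuous_Rintegrable _ _ (cgn n))).
    by rewrite addrA subrK.
  pose G r := cc + \int[lebesgue_measure]_(x in `[s - 1, r]) gn n x.
  have dG r : s - 1 < r -> is_derive r (1 : R) G (gn n r).
    move=> sr; have h := is_derive_primitive (cgn n) sr.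
    by have := is_deriveD (is_derive_cst cc r (1 : R)) h; rewrite add0r.
  rewrite !gnE ?lexx// -!/(G _).
  move: st; rewrite le_eqVlt => /predU1P[->|st'].
    by rewrite set_itv1 Rintegral_set1 subrr.
  have cG r : s - 1 < r -> {for r, continuous G}.
    by move=> /dG [+ _]; move=> /derivable1_diffP /differentiable_continuous.
  have cfG r : s - 1 < r -> {for r, continuous (f' \o G)}.
    by move=> sr; apply: continuous_comp; [exact: cG|exact: cf'].
  rewrite (_ : \int[_]_(r in _) _ = \int[lebesgue_measure]_(r in `[s, t]) (f' (G r) * gn n r)); last first.
    apply: eq_Rintegral => r /set_mem; rewrite /= in_itv/= => /andP[sr _]; by rewrite gnE.
  rewrite /Rintegral (@continuous_FTC2 _ _ (f \o G))//.
  - apply: continuous_in_subspaceT => r /set_mem; rewrite /= in_itv/= => /andP[sr _].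
    by apply: cvgM; [apply: cfG; exact: lt_le_trans sr|exact: cgn].
  - have cfGG r : s - 1 < r -> {for r, continuous (f \o G)}.
      move=> sr; apply: continuous_comp; first exact: cG.
      by apply/differentiable_continuous/derivable1_diffP; have := df (G r).
    split.
    + move=> x; rewrite in_itv/= => /andP[sx _].
      have h1 := dG x (lt_trans s1s sx).
      by have [] := @is_derive1_comp R f G x _ _ (df (G x)) h1.
    + by apply: cvg_at_right_filter; exact: cfGG.
    + by apply: cvg_at_left_filter; apply: cfGG; exact: lt_trans st'.
  - move=> x; rewrite in_itv/= => /andP[sx _].
    have h1 := dG x (lt_trans s1s sx).
    by rewrite derive1E; have [_ ->] := @is_derive1_comp R f G x _ _ (df (G x)) h1.
have mf' : measurable_fun setT f' by exact: continuous_measurable_fun.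
have mgamn n : measurable_fun `[s, t] (gamn n) by exact: cgam.
have mgam : measurable_fun `[s, t] gam.
  apply: (eq_measurable_fun (fun r => gam s + \int[lebesgue_measure]_(x in `[s, r]) g x)); last exact: cgam.
  by move=> r /set_mem; rewrite /= in_itv/= => /hgam.
have mfg (h : R -> R) : measurable_fun `[s, t] h -> measurable_fun `[s, t] (f' \o h).
  by move=> mh; exact: measurableT_comp.
have ifg (h k : R -> R) : measurable_fun `[s, t] h -> lebesgue_measure.-integrable `[s, t] (EFin \o k) ->
    lebesgue_measure.-integrable `[s, t] (EFin \o (fun r => f' (h r) * k r)).
  move=> mh ik; rewrite (_ : (fun r => _) = (fun r => k r * f' (h r))); last by apply/funext => r; rewrite mulrC.
  apply: (@RintegrableMr _ _ _ lebesgue_measure _ k (f' \o h) B) => //; first exact: mfg.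
  by move=> x _; exact: bf.
have cv r : s <= r <= t -> gamn ^~ r @ \oo --> gam r.
  by move=> srt; apply: (cvg_dist_le e0) => n; exact: hgn.
have A1 : (fun n => f (gamn n t) - f (gamn n s)) @ \oo --> f (gam t) - f (gam s).
  have cfx x : {for x, continuous f} by apply/differentiable_continuous/derivable1_diffP; have := df x.
  apply: cvgB; apply: continuous_cvg; try exact: cfx; apply: cv; by rewrite ?lexx ?st.
have A2 : (fun n => \int[lebesgue_measure]_(r in `[s, t]) (f' (gamn n r) * gn n r)) @ \oo -->
    \int[lebesgue_measure]_(r in `[s, t]) (f' (gam r) * g r).
  pose I1 n := \int[lebesgue_measure]_(r in `[s, t]) (f' (gamn n r) * (gn n r - g r)).
  pose I2 n := \int[lebesgue_measure]_(r in `[s, t]) (f' (gamn n r) * g r).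
  (* [I1] tends to 0 by the convergence in L1; [I2] converges by dominated convergence, as [f'] is
     continuous. *)
  rewrite (_ : (fun n => _) = (fun n => I1 n + I2 n)); last first.
    apply/funext => n; rewrite -RintegralD//.
    - by apply: eq_Rintegral => r _; rewrite -mulrDr subrK.
    - by apply: ifg => //; exact: RintegrableB.
    - exact: ifg.
  rewrite -[X in _ --> X]add0r; apply: cvgD.
    have Be0 : (fun n => B * e n) @ \oo --> 0.
      by rewrite -[X in _ --> X](mulr0 B); apply: cvgM; [exact: cvg_cst|exact: e0].
    apply: (cvg_dist_le Be0) => n; rewrite subr0.
    rewrite -RintegralZl//; apply: normr_Rintegral_le => //.
    + by apply: measurable_funM; [exact: mfg|apply: measurable_funB; [have /measurable_int/measurable_EFinP := ign n|have /measurable_int/measurable_EFinP := ig]].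
    + by move=> r _; rewrite normrM distrC ler_wpM2r// bf.
    + exact: RintegrableZl.
  apply: (@Rdominated_cvg _ _ R lebesgue_measure `[s, t]%classic (fun n r => f' (gamn n r) * g r) _ (fun r => B * `|g r|)) => //.
  - by move=> n; have /measurable_int/measurable_EFinP := ifg _ _ (mgamn n) ig.
  - by have /measurable_int/measurable_EFinP := ifg _ _ mgam ig.
  - apply: aeW => r; rewrite /= in_itv/= => srt.
    apply: cvgM; last exact: cvg_cst.
    by apply: continuous_cvg; [exact: cf'|exact: cv].
  - by move=> n r _; rewrite normrM ler_wpM2r.
  - by apply: RintegrableZl => //; exact: integrable_norm.
have := cvg_unique (@Rhausdorff R) A1; apply.
by move: A2; under eq_fun do rewrite -hn.
Qed.

(** * Weak derivatives in time *)

Section weak_time_derivative.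
Context {R : realType}.
Implicit Types (f g k m : R -> R).
Local Notation leb := (@lebesgue_measure R).
Local Notation mR := (measurableTypeR R).

(** Composition with it extends a function continuous within [0, T] to a continuous function on the
    line, with the same values on [0, T]. *)
Definition clamp (T t : R) : R := Num.max 0 (Num.min t T).

Lemma clamp_itv T t : 0 <= T -> 0 <= clamp T t <= T.
Proof. by move=> T0; rewrite /clamp le_max lexx ge_max T0 ge_min lexx orbT. Qed.

Lemma clamp_id T t : 0 <= t <= T -> clamp T t = t.
Proof. by move=> /andP[t0 tT]; rewrite /clamp (min_idPl tT); apply/max_idPr. Qed.

Lemma clamp_continuous T : continuous (clamp T).
Proof.
move=> x; apply: (@continuous_max _ _ (cst 0) (fun t => Num.min t T)); first exact: cvg_cst.
by apply: (@continuous_min _ _ id (cst T)); [exact: cvg_id|exact: cvg_cst].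
Qed.

Lemma clamp_comp_continuous f T : 0 <= T -> {within `[0, T], continuous f} ->
  continuous (f \o clamp T).
Proof.
move=> T0 /subspace_continuousP cf x.
have cx : `[0, T]%classic (clamp T x) by rewrite /= in_itv/= clamp_itv.
have h := cf _ cx.
apply: cvg_comp h.
move=> A; rewrite /within/= nbhs_simpl/= => /clamp_continuous.
rewrite nbhs_simpl/=; apply: filterS => y /=; apply.
by rewrite /= in_itv/= clamp_itv.
Qed.

(** By nonnegativity all partial integrals vanish too, so the primitive is constant and its
    derivative [f] is zero. *)
Lemma Rintegral_eq0_continuous f T : continuous f ->
  (forall x, 0 <= x <= T -> 0 <= f x) -> \int[leb]_(x in `[0, T]) f x = 0 ->
  forall x, 0 < x < T -> f x = 0.
Proof.
move=> cf f0 I0 x /andP[x0 xT].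
pose F t := \int[leb]_(r in `[0, t]) f r.
have F0 t : 0 <= t <= T -> F t = 0.
  move=> /andP[t0 tT].
  have := Rintegral_split t0 tT (continuous_Rintegrable 0 T cf).
  rewrite I0 => /esym/eqP; rewrite paddr_eq0.
  - by move=> /andP[/eqP ].
  - apply: Rintegral_ge0 => y; rewrite /= in_itv/= => /andP[y0 yt].
    by rewrite f0// y0 (le_trans yt).
  - apply: Rintegral_ge0 => y; rewrite /= in_itv/= => /andP[y0 yt].
    by rewrite f0// yt (le_trans t0).
have dF := is_derive_primitive cf x0.
have xF : x \in `]0, T[ by rewrite in_itv/= x0.
have d0 : is_derive x (1 : R) F 0.
  apply: (@derive1_at_min R F 0 T x) => //.
  - by rewrite (le_trans (ltW x0) (ltW xT)).
  - by move=> y; rewrite in_itv/= => /andP[y0 _]; have [] := is_derive_primitive cf y0.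
  - move=> y; rewrite in_itv/= => /andP[y0 yT].
    by rewrite !F0 ?(ltW y0) ?(ltW yT) ?(ltW x0) ?(ltW xT).
have [_ e1] := dF; have [_ e2] := d0.
by rewrite -e1 e2.
Qed.

Lemma Rmeasurable_bool (d : measure_display) (X : measurableType d) (b : X -> bool) :
  measurable_fun setT b -> measurable_fun setT (fun x => (b x)%:R : R).
Proof. by move=> mb; apply: (measurableT_comp (f := fun b : bool => b%:R : R)) mb => //. Qed.

(** The deviation [K] of [k] from its claimed value, cut off near [T], is itself used as the
    derivative of a test function. After Fubini on the triangle the identity says that the integral
    of [K ^+ 2] times the cutoff is zero. *)
Lemma du_bois_reymond k m (k0 T : R) : 0 < T -> {within `[0, T], continuous k} ->
  leb.-integrable `[0, T] (EFin \o m) ->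
  (forall th th' : R -> R, {within `[0, T], continuous th} -> continuous th' ->
    (forall x : R, 0 <= x -> is_derive x (1 : R) th (th' x)) ->
    (exists2 e : R, 0 < e & forall t, T - e <= t -> th t = 0) ->
    \int[leb]_(t in `[0, T]) (th' t * k t + th t * m t) + th 0 * k0 = 0) ->
  forall t, 0 <= t <= T -> k t = k0 + \int[leb]_(r in `[0, t]) m r.
Proof.
move=> T0 ck im hw.
have mm : measurable_fun `[0, T] m by have /measurable_int/measurable_EFinP := im.
pose J (t : R) : R := \int[leb]_(r in `[0, t]) m r.
have cJ : {within `[0, T], continuous J}.
  by apply: parameterized_integral_continuous => //; exact: ltW.
have cK1 : {within `[0, T], continuous (fun t => k t - k0 - J t)}.
  move=> x; apply: cvgB; last exact: cJ.
  by apply: cvgB; [exact: ck|exact: cvg_cst].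
pose K := (fun t => k t - k0 - J t) \o clamp T.
have cK : continuous K by exact: clamp_comp_continuous (ltW T0) cK1.
have KE (t : R) : 0 <= t <= T -> K t = k t - k0 - J t by move=> h; rewrite /K/= clamp_id.
suff K0 (e : R) : 0 < e -> forall t : R, 0 < t < T - e -> K t = 0.
  have KT t : 0 < t < T -> K t = 0.
    move=> /andP[t0 tT]; apply: (K0 ((T - t) / 2)); lra.
  have KTT t : 0 <= t <= T -> K t = 0.
    move=> /andP[t0 tT].
    (* Points on the way from [t] to the midpoint lie in the open interval, so the end points are
       reached by continuity. *)
    pose u (n : nat) := t + (T / 2 - t) * (2^-1 * n.+1%:R^-1).
    have cu : u @ \oo --> t.
      rewrite -[X in _ --> X]addr0; apply: cvgD; first exact: cvg_cst.
      rewrite -[X in _ --> X](mulr0 (T / 2 - t)); apply: cvgM; first exact: cvg_cst.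
      rewrite -[X in _ --> X](mulr0 (2^-1)); apply: cvgM; first exact: cvg_cst.
      exact: cvg_harmonic.
    have Ku : (K \o u) @ \oo --> K t by apply: continuous_cvg => //; exact: cK.
    apply: (cvg_unique (@Rhausdorff R) Ku).
    rewrite (_ : K \o u = cst 0); first exact: cvg_cst.
    apply/funext => n /=; apply: KT.
    have h1 : 0 < 2^-1 * n.+1%:R^-1 :> R by rewrite mulr_gt0// invr_gt0.
    have h2 : 2^-1 * n.+1%:R^-1 < 1 :> R.
      have : n.+1%:R^-1 <= 1 :> R by rewrite invf_le1// ler1n.
      have : 0 < n.+1%:R^-1 :> R by rewrite invr_gt0.
      move: (n.+1%:R^-1) => z; clear; lra.
    rewrite /u; move: (2^-1 * _) h1 h2 => l h1 h2; apply/andP; split; nra.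
  move=> t tT; have := KTT t tT; rewrite KE// => /eqP.
  by rewrite subr_eq0 => /eqP h; rewrite -/(J t) -h addrC subrK.
move=> e0.
(* The second factor is zero from [T - e] on, so that the primitive [th] can be made to vanish there
   as the test functions must. *)
pose psi (t : R) : R := K t * Num.max 0 (T - e - t).
have cpsi : continuous psi.
  move=> x; apply: cvgM; first exact: cK.
  apply: (@continuous_max _ _ (cst 0) (fun t => T - e - t)); first exact: cvg_cst.
  by apply: cvgB; [exact: cvg_cst|exact: cvg_id].
(* Starting the integral at -1 makes the primitive differentiable at 0 too. *)
pose P (t : R) : R := \int[leb]_(r in `[-1, t]) psi r.
have dP (x : R) : 0 <= x -> is_derive x (1 : R) P (psi x).
  by move=> x0; apply: is_derive_primitive => //; lra.
pose th (t : R) : R := P t - P T.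
have PT (t : R) : T - e <= t -> P t = P T.
  move=> tT.
  have psi0 r : T - e <= r -> psi r = 0.
    by move=> rT; rewrite /psi (max_idPl _) ?mulr0// subr_le0.
  have I0 a b : T - e <= a -> \int[leb]_(r in `[a, b]) psi r = 0.
    move=> Ta; rewrite (@eq_Rintegral _ _ _ _ _ (cst 0)).
      by rewrite Rintegral_cst// mul0r.
    by move=> r /set_mem; rewrite /= in_itv/= => /andP[ar _]; rewrite psi0// (le_trans Ta).
  have [t1|t1] := leP t (-1).
    have e1 : T - e <= -1 by rewrite (le_trans tT).
    by rewrite /P !I0.
  have [tT'|Tt] := leP t T.
    by rewrite /P (Rintegral_split (ltW t1) tT' (continuous_Rintegrable _ _ cpsi)) (I0 t T)// addr0.
  have T1 : -1 <= T by lra.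
  rewrite /P (Rintegral_split T1 (ltW Tt) (continuous_Rintegrable _ _ cpsi)) (I0 T t) ?addr0//; lra.
have cth : {within `[0, T], continuous th}.
  apply: continuous_in_subspaceT => x; rewrite inE/= in_itv/= => /andP[x0 _].
  apply: cvgB; last exact: cvg_cst.
  by apply/differentiable_continuous/derivable1_diffP; have := dP x x0.
have dth (x : R) : 0 <= x -> is_derive x (1 : R) th (psi x).
  by move=> x0; have := is_deriveB (dP x x0) (is_derive_cst (P T) x (1 : R)); rewrite subr0.
have th0 : exists2 e : R, 0 < e & forall t, T - e <= t -> th t = 0.
  by exists e => // t tT; rewrite /th PT// subrr.
have thE (t : R) : 0 <= t <= T -> th t = - \int[leb]_(r in `[t, T]) psi r.
  move=> /andP[t0 tT]; rewrite /th /P.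
  have t1 : -1 <= t by lra.
  by rewrite (Rintegral_split t1 tT (continuous_Rintegrable _ _ cpsi)) opprD addrA subrr add0r.
have mpsi : measurable_fun setT psi by exact: continuous_measurable_fun.
have [B hB] : exists B : R, forall x, 0 <= x <= T -> `|psi x| <= B.
  have [|c _ hc] := @EVT_max R (fun x => `|psi x|) 0 T (ltW T0).
    apply: continuous_subspaceT => x; apply: continuous_comp; [exact: cpsi|exact: norm_continuous].
  by exists `|psi c| => x x0; apply: hc; rewrite in_itv/=.
have B0 : 0 <= B by apply: (le_trans _ (hB 0 _)) => //; rewrite lexx ltW.
have ithm : leb.-integrable `[0, T] (EFin \o (fun x => th x * m x)).
  rewrite (_ : (fun x => _) = (fun x => m x * th x)); last by apply/funext => x; rewrite mulrC.
  have cnth : {within `[0, T], continuous (fun x => `|th x|)}.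
    by move=> x; apply: continuous_comp; [exact: cth|exact: norm_continuous].
  have [c _ hc] := EVT_max (ltW T0) cnth.
  have mth : measurable_fun `[0, T] th by exact: subspace_continuous_measurable_fun.
  apply: (@RintegrableMr _ _ _ leb _ _ _ `|th c| (mitv _) im mth) => x xT.
  exact: hc.
have tri : \int[leb]_(t in `[0, T]) (th t * m t) = - \int[leb]_(t in `[0, T]) (psi t * J t).
  pose m' : R -> R := m \_ `[0, T].
  have m'E x : x \in `[0, T]%classic -> m' x = m x by move=> xT; rewrite /m' patchE xT.
  have im' : leb.-integrable `[0, T] (EFin \o m').
    by apply: (eq_Rintegrable (mitv _) _ im) => x xT; rewrite /m' patchE mem_set.
  have mm' : measurable_fun setT m' by apply/(measurable_restrictT _ (mitv _)).
  pose F (x y : R) : R := m' x * psi y.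
  have mF : measurable_fun setT (fun p : mR * mR => F p.1 p.2).
    by apply: measurable_funM; [exact: measurableT_comp mm' _|exact: measurableT_comp mpsi _].
  have Fi : (\int[leb]_(x in `[0%R, T]) \int[leb]_(y in `[0%R, T]) `|F x y|%:E < +oo)%E.
    have ipsi := continuous_Rintegrable 0 T cpsi.
    apply: (iterated_lty (mitv _) (mitv _) mF (integrable_norm im') (integrable_norm ipsi)) => x y _ _.
    by rewrite /F normrM.
  have := Rintegral_triangle mF Fi; rewrite /F => E.
  transitivity (- \int[leb]_(x in `[0, T]) \int[leb]_(y in `[x, T]) (m' x * psi y)).
    rewrite [in RHS](@eq_Rintegral _ mR R leb _ (fun x => -1 * (th x * m x))).
      by rewrite (RintegralZl (-1) (mitv _) ithm) mulN1r opprK.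
    move=> x xT; rewrite thE; last by move/set_mem : (xT); rewrite /= in_itv.
    rewrite (RintegralZl (m' x) (mitv _) (continuous_Rintegrable x T cpsi)).
    have -> : m' x = m x by exact: m'E.
    by rewrite [LHS]mulrC mulN1r mulNr opprK.
  rewrite E; congr (- _); apply: eq_Rintegral => x /set_mem; rewrite /= in_itv/= => /andP[x0 xT].
  have sub : `[0, x]%classic `<=` `[0, T]%classic by apply: subset_itvl; rewrite bnd_simp.
  have im'x : leb.-integrable `[0, x] (EFin \o m') by apply: integrableS im'.
  rewrite (RintegralZr (psi x) (mitv _) im'x) mulrC; congr (_ * _).
  by apply: eq_Rintegral => y /set_mem yx; apply: m'E; apply/mem_set/sub.
have ick h : {within `[0, T], continuous h} -> leb.-integrable `[0, T] (EFin \o (fun x => psi x * h x)).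
  move=> ch; apply: continuous_compact_integrable; first exact: segment_compact.
  by move=> x; apply: cvgM; [exact: (continuous_subspaceT cpsi)|exact: ch].
have := hw th psi cth cpsi dth th0.
rewrite RintegralD//; last exact: ick.
rewrite tri thE ?lexx ?ltW// => E.
have I0 : \int[leb]_(t in `[0, T]) (psi t * K t) = 0.
  rewrite (@eq_Rintegral _ mR R leb _ (fun t => psi t * k t - (psi t * k0 + psi t * J t))); last first.
    by move=> x /set_mem; rewrite /= in_itv/= => xT; rewrite KE//; ring.
  have ik0 := ick _ (continuous_subspaceT (@cst_continuous R R k0)).
  rewrite RintegralB//; [|exact: ick|exact: (RintegrableD (mitv _) ik0 (ick _ cJ))].
  rewrite RintegralD//; last exact: ick.
  rewrite RintegralZr//; last exact: continuous_Rintegrable.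
  by rewrite -[RHS]E; ring.
move=> t /andP[t0 tT].
have h : psi t * K t = 0.
  apply: (@Rintegral_eq0_continuous (fun t => psi t * K t) T) => //.
  - by move=> x; apply: cvgM; [exact: cpsi|exact: cK].
  - move=> x _; rewrite /psi mulrAC -expr2 mulr_ge0// ?sqr_ge0// le_max lexx//.
  - by rewrite t0/=; lra.
move: h; rewrite /psi mulrAC -expr2 (max_idPr _); last by rewrite subr_ge0; lra.
move=> /eqP; rewrite mulf_eq0 sqrf_eq0 => /orP[/eqP//|]; rewrite subr_eq0 => /eqP; lra.
Qed.
End weak_time_derivative.

(** * Transport of densities on the circle *)

Section circle_transport.
Context {R : realType}.
Local Notation leb := (@lebesgue_measure R).
Local Notation mR := (measurableTypeR R).

Lemma mcircle : measurable (circle : set mR).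
Proof. exact: measurable_itv. Qed.

Lemma periodic_nat (f : R -> R) n u : periodic2pi f -> f (u + 2 * pi * n%:R) = f u.
Proof.
move=> pf; elim: n u => [|n ih] u; first by rewrite mulr0 addr0.
rewrite -natr1 (_ : u + _ = u + 2 * pi * n%:R + 2 * pi); last by ring.
by rewrite pf ih.
Qed.

Lemma periodic_int (f : R -> R) (n : int) u : periodic2pi f -> f (u + 2 * pi * n%:~R) = f u.
Proof.
move=> pf; case: n => n; first exact: periodic_nat.
by rewrite -(periodic_nat n.+1 (u + _) pf) NegzE mulrNz -addrA mulrN addNr addr0.
Qed.

Definition wrap (u : R) : R := u - 2 * pi * (Num.floor (u / (2 * pi)))%:~R.

Lemma wrap_circle u : circle (wrap u).
Proof.
have p0 : 0 < 2 * pi :> R by rewrite mulr_gt0// pi_gt0.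
rewrite /circle /= in_itv/= /wrap; set k := Num.floor _.
have := @floor_le R (u / (2 * pi)); have := @floorD1_gt R (u / (2 * pi)).
rewrite -/k intrD ltr_pdivrMr// ler_pdivlMr//.
by move=> h1 h2; apply/andP; split; nra.
Qed.

Lemma periodic_wrap (f : R -> R) u : periodic2pi f -> f (wrap u) = f u.
Proof. by move=> pf; rewrite /wrap -mulrN -mulrNz periodic_int. Qed.

Lemma measurable_wrap : measurable_fun setT (wrap : mR -> mR).
Proof.
apply: measurable_funB => //; apply: measurable_funM => //.
apply: (measurableT_comp (f := fun x : R => (Num.floor x)%:~R : R)).
  by apply: nondecreasing_measurable => // x y xy; rewrite ler_int le_floor.
exact: measurable_funM.
Qed.

Lemma periodic_bounded (f : R -> R) : continuous f -> periodic2pi f ->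
  exists2 B : R, 0 < B & forall u, `|f u| <= B.
Proof.
move=> cf pf; have p0 : 0 <= 2 * pi :> R by rewrite mulr_ge0// pi_ge0.
have [|c _ hc] := @EVT_max R (fun x => `|f x|) 0 (2 * pi) p0.
  apply: continuous_subspaceT => x; apply: continuous_comp; [exact: cf|exact: norm_continuous].
exists (`|f c| + 1); first by rewrite ltr_wpDl.
move=> u; rewrite -(periodic_wrap u pf) ler_wpDr//; apply: hc.
by have := wrap_circle u; rewrite /circle/= !in_itv/= => /andP[-> /ltW ->].
Qed.

(* [rho t] is a signed density on the circle, extended by [0] to the line. As in
   the definition of weak solutions, the bound [l] on the velocity and on its
   Lipschitz constant is only known to be integrable against the mass of [rho]. *)
Record transport (T : R) (rho V : R -> R -> R) (l : R -> R) : Prop := Transport {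
  tr_mrho : measurable_fun setT (fun p : mR * mR => rho p.1 p.2) ;
  tr_circle : forall t u, ~ circle u -> rho t u = 0 ;
  tr_irho : forall t, 0 <= t <= T -> leb.-integrable setT (EFin \o rho t) ;
  tr_mV : measurable_fun setT (fun p : mR * mR => V p.1 p.2) ;
  tr_pV : forall t, periodic2pi (V t) ;
  tr_ml : measurable_fun setT (l : mR -> mR) ;
  tr_V : forall t u, `|V t u| <= l t ;
  tr_VL : forall t u v, `|V t u - V t v| <= l t * `|u - v| ;
  tr_Nl : leb.-integrable `[0, T] (EFin \o (fun t => (\int[leb]_u `|rho t u|) * l t)) ;
  tr_cont : forall f, continuous f -> periodic2pi f ->
    {within `[0, T], continuous (fun t => \int[leb]_u (rho t u * f u))} }.

Section transport.
Variables (T : R) (rho V : R -> R -> R) (l : R -> R).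
Hypothesis tr : transport T rho V l.

Definition tmass t := \int[leb]_u `|rho t u|.

Lemma tr_l0 t : 0 <= l t.
Proof. exact: le_trans (tr_V tr t 0). Qed.

Lemma tmass_ge0 t : 0 <= tmass t.
Proof. by apply: Rintegral_ge0. Qed.

Lemma tr_mrho1 t : measurable_fun setT (rho t : mR -> R).
Proof. exact: measurable_pair1 (tr_mrho tr). Qed.

Lemma tr_mV1 t : measurable_fun setT (V t : mR -> R).
Proof. exact: measurable_pair1 (tr_mV tr). Qed.

Lemma tr_imul t (f : R -> R) B : 0 <= t <= T -> measurable_fun setT (f : mR -> R) ->
  (forall u, `|f u| <= B) -> leb.-integrable setT (EFin \o (fun u => rho t u * f u)).
Proof.
by move=> tT mf fB; apply: (RintegrableMr measurableT (tr_irho tr tT) mf (k := B)).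
Qed.

Lemma tr_imulV t (f : R -> R) B : 0 <= t <= T -> measurable_fun setT (f : mR -> R) ->
  (forall u, `|f u| <= B) -> leb.-integrable setT (EFin \o (fun u => rho t u * (V t u * f u))).
Proof.
move=> tT mf fB; apply: (@tr_imul _ _ (l t * B)) => //.
  by apply: measurable_funM => //; exact: tr_mV1.
by move=> u; rewrite normrM ler_pM// (tr_V tr).
Qed.

Lemma tr_bound t (f : R -> R) B : 0 <= t <= T -> measurable_fun setT (f : mR -> R) ->
  (forall u, `|f u| <= B) -> `|\int[leb]_u (rho t u * f u)| <= tmass t * B.
Proof.
move=> tT mf fB; rewrite /tmass -RintegralZr//; last exact: (integrable_norm (tr_irho tr tT)).
apply: normr_Rintegral_le => //.
- by apply: measurable_funM => //; exact: tr_mrho1.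
- by move=> u _; rewrite normrM ler_wpM2l.
- exact: (RintegrableZr B measurableT (integrable_norm (tr_irho tr tT))).
Qed.

Lemma tr_boundV t (f : R -> R) B : 0 <= t <= T -> measurable_fun setT (f : mR -> R) ->
  (forall u, `|f u| <= B) -> `|\int[leb]_u (rho t u * (V t u * f u))| <= tmass t * l t * B.
Proof.
move=> tT mf fB; rewrite -mulrA; apply: tr_bound => //.
  by apply: measurable_funM => //; exact: tr_mV1.
by move=> u; rewrite normrM ler_pM// (tr_V tr).
Qed.

Lemma tr_mint (F : R -> R -> R) : measurable_fun setT (fun p : mR * mR => F p.1 p.2) ->
  measurable_fun setT ((fun t => \int[leb]_u (rho t u * F t u)) : mR -> R).
Proof.
move=> mF; apply: measurable_Rintegral => //.
by apply: measurable_funM => //; exact: (tr_mrho tr).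
Qed.

Lemma tr_iV (F : R -> R -> R) B s t : 0 <= s -> t <= T -> measurable_fun setT (fun p : mR * mR => F p.1 p.2) ->
  (forall r u, `|F r u| <= B) ->
  leb.-integrable `[s, t] (EFin \o (fun r => \int[leb]_u (rho r u * (V r u * F r u)))).
Proof.
move=> s0 tT mF FB.
have sub : `[s, t]%classic `<=` `[0, T]%classic by apply: subset_itv; rewrite bnd_simp.
apply: (@Rintegrable_le _ _ _ leb _ _ (fun r => tmass r * l r * B)) => //.
- apply: measurable_funTS; apply: (@tr_mint (fun r u => V r u * F r u)).
  by apply: measurable_funM => //; exact: (tr_mV tr).
- move=> r /sub; rewrite /= in_itv/= => rT; apply: tr_boundV => //.
  exact: measurable_pair1 mF.
- apply: RintegrableZr => //; apply: integrableS (tr_Nl tr) => //.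
Qed.

(** Test functions that are products of a function of time and one of position reduce the weak
    formulation to [du_bois_reymond] for the pairing of [rho t] with [f]. *)
Lemma transport_weak (r0 : R -> R) : 0 < T -> leb.-integrable circle (EFin \o r0) ->
  (forall w wt wu, test_function T w wt wu ->
     \int[leb]_(t in `[0, T]) \int[leb]_u (rho t u * (wt t u + V t u * wu t u))
     + \int[leb]_(u in circle) (w 0 u * r0 u) = 0) ->
  forall f f' : R -> R, periodic2pi f -> periodic2pi f' ->
  (forall x : R, is_derive x (1 : R) f (f' x)) -> continuous f' ->
  forall t, 0 <= t <= T -> \int[leb]_u (rho t u * f u) =
    \int[leb]_(u in circle) (f u * r0 u) + \int[leb]_(s in `[0, t]) \int[leb]_u (rho s u * (V s u * f' u)).
Proof.
move=> T0 ir0 hw f f' pf pf' df cf'.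
have cf : continuous f.
  by move=> x; apply/differentiable_continuous/derivable1_diffP; have := df x.
have [B B0 hB] := periodic_bounded cf pf.
have [B' B'0 hB'] := periodic_bounded cf' pf'.
have mf : measurable_fun setT (f : mR -> R) by exact: continuous_measurable_fun.
have mf' : measurable_fun setT (f' : mR -> R) by exact: continuous_measurable_fun.
pose F (r u : R) := f' u.
have mF : measurable_fun setT (fun p : mR * mR => F p.1 p.2) by exact: measurableT_comp mf' _.
have if0 : leb.-integrable circle (EFin \o (fun u => f u * r0 u)).
  apply: (eq_Rintegrable mcircle _ (RintegrableMr mcircle ir0 (measurable_funTS mf) (fun x _ => hB x))).
  by move=> x _; rewrite mulrC.
apply: du_bois_reymond => //.
- exact: (tr_cont tr).
- exact: (@tr_iV F B').
move=> th th' cth cth' dth [e e0 the].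
pose w (t u : R) := th t * f u.
have tw : test_function T w (fun t u => th' t * f u) (fun t u => th t * f' u).
  (* Clamping the time turns continuity within the strip into continuity on the plane. *)
  have cc (g h : R -> R) : {within `[0, T], continuous g} -> continuous h ->
      {within `[0, T] `*` setT, continuous (fun p : R * R => g p.1 * h p.2)}.
    move=> cg ch.
    apply: (@subspace_eq_continuous _ _ _ (fun p : R * R => (g \o clamp T) p.1 * h p.2)).
      by move=> p; rewrite inE => -[/= + _]; rewrite in_itv/= => /clamp_id ->.
    apply: continuous_subspaceT => p; apply: cvgM.
      apply: (@cvg_comp _ _ _ fst (g \o clamp T) _ (nbhs p.1)); first exact: cvg_fst.
      exact: (clamp_comp_continuous (ltW T0) cg).
    by apply: (@cvg_comp _ _ _ snd h _ (nbhs p.2)); [exact: cvg_snd|exact: ch].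
  split.
  - by move=> t _ u; rewrite /w pf.
  - by split; apply: cc => //; exact: continuous_subspaceT.
  - move=> t u; rewrite in_itv/= => /andP[t0 _].
    have h := dth t (ltW t0).
    rewrite (_ : w ^~ u = f u *: th); last by apply/funext => x; rewrite /w mulrC.
    by rewrite mulrC; exact: (is_deriveZ (f u) h).
  - move=> t u _.
    by have := is_deriveZ (th t) (df u).
  - have cl : closed [set p : R * R | p.1 \in `[0, T - e]].
      have := @closed_comp _ _ (fst : R * R -> R) `[0, T - e]%classic.
      by apply => [x _|]; [exact: cvg_fst|exact: itv_closed].
    apply: (@subset_trans _ [set p : R * R | p.1 \in `[0, T - e]]).
      rewrite [X in _ `<=` X](closure_id _).1//; apply: closureS => -[t u] /=.
      rewrite /= !in_itv/= => -[/andP[-> tT]]; apply: contraNT; rewrite -ltNge/= => /ltW te.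
      by rewrite /w the// mul0r.
    move=> p /=; rewrite !in_itv/= => /andP[-> h]; rewrite (le_lt_trans h)//.
    by rewrite ltrBlDr ltrDl.
have := hw _ _ _ tw; rewrite /w.
have -> : \int[leb]_(u in circle) (th 0 * f u * r0 u) = th 0 * \int[leb]_(u in circle) (f u * r0 u).
  rewrite -(RintegralZl _ mcircle if0); apply: eq_Rintegral => u _; by rewrite mulrA.
move=> E; rewrite -[RHS]E; congr (_ + _); apply: eq_RintegralL => t; rewrite /= in_itv/= => tT.
have i1 := tr_imul tT mf hB.
have i2 := tr_imulV tT mf' hB'.
rewrite -(RintegralZl _ measurableT i1) -(RintegralZl _ measurableT i2).
rewrite -(RintegralD measurableT (RintegrableZl _ measurableT i1) (RintegrableZl _ measurableT i2)).
by apply: eq_Rintegral => u _; ring.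
Qed.
End transport.
End circle_transport.

(** * Smooth approximations of the sawtooth *)

Section sawtooth.
Context {R : realType}.
Implicit Types (q r x : R).

Lemma sin_periodic2pi : periodic2pi (@sin R).
Proof. by move=> u; rewrite (_ : 2 * pi = pi *+ 2) ?mulr_natl//; exact: sinD2pi. Qed.

Lemma cos_periodic2pi : periodic2pi (@cos R).
Proof. by move=> u; rewrite (_ : 2 * pi = pi *+ 2) ?mulr_natl//; exact: cosD2pi. Qed.

Lemma derive_ge0_le (f f' : R -> R) x : (forall x : R, is_derive x (1 : R) f (f' x)) ->
  continuous f' -> (forall y, 0 <= y <= x -> 0 <= f' y) -> 0 <= x -> f 0 <= f x.
Proof.
move=> df cf f0 x0; rewrite -subr_ge0 -(RFTC2 x0 df cf).
by apply: Rintegral_ge0 => y; rewrite /= in_itv/=; exact: f0.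
Qed.

Lemma sin_lex x : 0 <= x -> sin x <= x.
Proof.
move=> x0; have := @derive_ge0_le (fun y => y - sin y) (fun y => 1 - cos y) x.
rewrite sin0 subr0 subr_ge0; apply => //.
by move=> y; apply: cvgB; [exact: cvg_cst|exact: continuous_cos].
Qed.

Lemma cos_ge_quadratic x : 0 <= x -> 1 - x ^+ 2 / 2 <= cos x.
Proof.
move=> x0; have := @derive_ge0_le (fun y => cos y - 1 + y ^+ 2 / 2) (fun y => y - sin y) x.
rewrite cos0 subrr expr0n mul0r addr0 => h.
suff : 0 <= cos x - 1 + x ^+ 2 / 2 by lra.
apply: h => //.
- move=> y; apply: (dR_eq (dR_add (dR_sub (is_derive_cos y) (dR_cst 1 y)) (dR_mul (dR_exp 1 y) (dR_cst 2^-1 y)))).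
  by field.
- by move=> y; apply: cvgB; [exact: cvg_id|exact: continuous_sin].
- by move=> y /andP[y0 _]; rewrite subr_ge0 sin_lex.
Qed.

Lemma sin_ge_cubic x : 0 <= x -> x - x ^+ 3 / 6 <= sin x.
Proof.
move=> x0; have := @derive_ge0_le (fun y => sin y - y + y ^+ 3 / 6) (fun y => cos y - 1 + y ^+ 2 / 2) x.
rewrite sin0 subrr expr0n mul0r addr0 => h.
suff : 0 <= sin x - x + x ^+ 3 / 6 by lra.
apply: h => //.
- move=> y; apply: (dR_eq (dR_add (dR_sub (is_derive_sin y) (dR_id y)) (dR_mul (dR_exp 2 y) (dR_cst 6^-1 y)))).
  by field.
- move=> y; apply: cvgD; first by apply: cvgB; [exact: continuous_cos|exact: cvg_cst].
  by apply: cvgM; [exact: exprn_continuous|exact: cvg_cst].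
- by move=> y /andP[y0 _]; have := cos_ge_quadratic y0; lra.
Qed.

(** The cubic bound exceeds [x / 3] as long as [x ^+ 2 <= 4], and [pi / 2] is below 2. *)
Lemma sin_ge_third x : 0 <= x <= pi / 2 -> x / 3 <= sin x.
Proof.
move=> /andP[x0 xpi]; apply: le_trans (sin_ge_cubic x0).
have x2 : x <= 2 by apply: (le_trans xpi); apply/ltW/pihalf_lt2.
suff : 0 <= x * (4 - x ^+ 2) by lra.
by rewrite mulr_ge0// subr_ge0; nra.
Qed.

Lemma cos_half r : cos r = 1 - 2 * sin (r / 2) ^+ 2.
Proof.
rewrite [in LHS](_ : r = (r / 2) *+ 2); last by rewrite mulr2n; field.
by rewrite cos_mulr2n cos2sin2; ring.
Qed.

(** [1 - cos r] is twice the square of [sin (r / 2)], whose absolute value is at least a sixth of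
    that of [r]; hence the 18. *)
Lemma one_minus_cos_ge r : `|r| <= pi -> r ^+ 2 / 18 <= 1 - cos r.
Proof.
move=> rpi; rewrite -(cos_norm r) -(real_normK (num_real r)).
have r0 := normr_ge0 r; move: (`|r|) r0 rpi => {}r r0 rpi.
have h : r / 2 / 3 <= sin (r / 2) by apply: sin_ge_third; apply/andP; split; lra.
rewrite cos_half; nra.
Qed.

(** The squared modulus of [1 - q * exp (i r)], the denominator of the Poisson kernel; [saw q r] is
    minus the argument of that complex number. *)
Definition saw_den q r := 1 - 2 * q * cos r + q ^+ 2.
(* [saw q r] is the sum of [q ^ n sin (n r) / n]: it tends to the sawtooth
   [(pi - wrap r) / 2] as [q] tends to 1. *)
Definition saw q r := atan (q * sin r / (1 - q * cos r)).
Definition saw1 q r := (q * cos r - q ^+ 2) / saw_den q r.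
Definition saw2 q r := - (q * sin r * (1 - q ^+ 2)) / saw_den q r ^+ 2.

Lemma saw_den_ge q r : 0 <= q -> (1 - q) ^+ 2 <= saw_den q r.
Proof. by move=> q0; rewrite /saw_den; have := cos_le1 r; nra. Qed.

Lemma saw_den_gt0 q r : 0 <= q < 1 -> 0 < saw_den q r.
Proof.
move=> /andP[q0 q1]; apply: lt_le_trans (saw_den_ge r q0).
by rewrite exprn_gt0// subr_gt0.
Qed.

Lemma one_minus_qcos_gt0 q r : 0 <= q < 1 -> 0 < 1 - q * cos r.
Proof. by move=> /andP[q0 q1]; have := cos_le1 r; nra. Qed.

Lemma is_derive_saw q (r : R) : 0 <= q < 1 -> is_derive r (1 : R) (saw q) (saw1 q r).
Proof.
move=> q01; have q1 := one_minus_qcos_gt0 r q01; have w0 := saw_den_gt0 r q01.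
have q1' : 1 - q * cos r != 0 by rewrite gt_eqF.
have dq := dR_sub (dR_cst 1 r) (dR_mulc q (is_derive_cos r)).
have dh := dR_mul (dR_mulc q (is_derive_sin r)) (@dR_inv R (fun y => 1 - q * cos y) r _ q1' dq).
apply: (dR_eq (dR_comp (is_derive1_atan _) dh)).
rewrite /saw1; have := sin2cos2 r; move: w0; rewrite /saw_den; move: (sin r) (cos r) q1' => s c hc hw hs.
have hw' : 1 - 2 * q * c + q ^+ 2 != 0 by rewrite gt_eqF.
have -> : 1 + (q * s / (1 - q * c)) ^+ 2 = (1 - 2 * q * c + q ^+ 2) / (1 - q * c) ^+ 2.
  rewrite expr_div_n exprMn hs; field; exact: hc.
have -> : q * c / (1 - q * c) + q * s * (- (0 - q * - s) / (1 - q * c) ^+ 2) =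
    (q * c * (1 - q * c) - q ^+ 2 * s ^+ 2) / (1 - q * c) ^+ 2 by field.
by rewrite hs; field; rewrite hc hw'.
Qed.

Lemma is_derive_saw1 q (r : R) : 0 <= q < 1 -> is_derive r (1 : R) (saw1 q) (saw2 q r).
Proof.
move=> q01; have w0 := saw_den_gt0 r q01.
have w0' : saw_den q r != 0 by rewrite gt_eqF.
have dw := dR_add (dR_sub (dR_cst 1 r) (dR_mulc (2 * q) (is_derive_cos r))) (dR_cst (q ^+ 2) r).
have dn := dR_sub (dR_mulc q (is_derive_cos r)) (dR_cst (q ^+ 2) r).
apply: (dR_eq (dR_mul dn (dR_inv w0' dw))).
rewrite /saw2 -/(saw_den q r).

have -> : 1 - q ^+ 2 = saw_den q r + 2 * (q * cos r - q ^+ 2) by rewrite /saw_den; ring.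
by move: (saw_den q r) w0' => w w0'; field.
Qed.

Lemma continuous_saw_den q : continuous (saw_den q).
Proof.
move=> x; apply: cvgD; last exact: cvg_cst.
apply: cvgB; first exact: cvg_cst.
by apply: cvgM; [exact: cvg_cst|exact: continuous_cos].
Qed.

Lemma continuous_saw2 q : 0 <= q < 1 -> continuous (saw2 q).
Proof.
move=> q01 x; apply: cvgM.
  apply: cvgN; apply: cvgM; last exact: cvg_cst.
  by apply: cvgM; [exact: cvg_cst|exact: continuous_sin].
apply: cvgV; first by rewrite expf_neq0// gt_eqF// saw_den_gt0.
by apply: (@continuous_comp _ _ _ (saw_den q) (fun x => x ^+ 2)); [exact: continuous_saw_den|exact: exprn_continuous].
Qed.

Lemma saw_periodic q : periodic2pi (saw q).
Proof. by move=> u; rewrite /saw sin_periodic2pi cos_periodic2pi. Qed.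

Lemma saw1_periodic q : periodic2pi (saw1 q).
Proof. by move=> u; rewrite /saw1 /saw_den cos_periodic2pi. Qed.

Lemma saw2_periodic q : periodic2pi (saw2 q).
Proof. by move=> u; rewrite /saw2 /saw_den sin_periodic2pi cos_periodic2pi. Qed.

Lemma saw_bound q r : `|saw q r| <= 2.
Proof.
rewrite ler_norml /saw; set a := q * _ / _.
have := atan_gtNpi2 a; have := atan_ltpi2 a; have := @pihalf_lt2 R; lra.
Qed.

(** The quotient is the Poisson kernel. It is nonnegative and concentrates at the multiples of
    [2 * pi] as [q] tends to 1, which leaves the slope [- (1 / 2)] elsewhere. *)
Lemma saw1E q r : 0 <= q < 1 -> saw1 q r = ((1 - q ^+ 2) / saw_den q r - 1) / 2.
Proof.
move=> q01; have /lt0r_neq0 := saw_den_gt0 r q01.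
by rewrite /saw1 /saw_den => h; field.
Qed.

(** The slope blows up near [r = 0] as [q] tends to 1, but no faster than the inverse of the
    distance. In the application the factor [|r|] comes from a Lipschitz velocity difference, so
    this is a domination uniform in [q]. *)
Lemma saw1_bound q r : 1 / 2 <= q < 1 -> `|r| <= pi -> `|r| * `|saw1 q r| <= 5.
Proof.
move=> /andP[q2 q1] rpi; have q01 : 0 <= q < 1 by apply/andP; split; lra.
have w0 := saw_den_gt0 r q01.
(* [saw_den q r] is [(1 - q) ^+ 2 + 2 * q * (1 - cos r)], and [2 * q >= 1]. *)
have w1 : (1 - q) ^+ 2 + `|r| ^+ 2 / 18 <= saw_den q r.
  have := one_minus_cos_ge rpi; rewrite -(real_normK (num_real r)) /saw_den.
  by have := sqr_ge0 `|r|; have := cos_le1 r; nra.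
(* From the square of [1 - q - |r| / 5], since 1/25 is below 1/18. *)
have w2 : `|r| * (1 - q) * (2 / 5) <= saw_den q r.
  apply: le_trans w1; have := sqr_ge0 (1 - q - `|r| / 5); have := sqr_ge0 `|r|.
  by move: (`|r|) => z; nra.
have h : `|r| * ((1 - q ^+ 2) / saw_den q r) <= 5.
  rewrite mulrA ler_pdivrMr//.
  have -> : `|r| * (1 - q ^+ 2) = (`|r| * (1 - q) * (2 / 5)) * ((1 + q) * (5 / 2)) by field.
  rewrite mulrC ler_pM//; [|by rewrite mulr_ge0// mulr_ge0// subr_ge0 ltW|]; lra.
have q2' : 0 <= (1 - q ^+ 2) / saw_den q r by apply: divr_ge0; [rewrite subr_ge0; nra|exact: ltW].
rewrite saw1E// normrM [`|2^-1|]ger0_norm// mulrA.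
have : `|(1 - q ^+ 2) / saw_den q r - 1| <= (1 - q ^+ 2) / saw_den q r + 1.
  by apply: (le_trans (ler_normB _ _)); rewrite normr1 ger0_norm.
have p4 : `|r| <= 4 by apply: (le_trans rpi); have := @pihalf_lt2 R; lra.
have := normr_ge0 r; move: h; set Q := _ / saw_den q r; move: (`|Q - 1|) (`|r|) p4 => a b p4 h1 h2 h3.
have : b * a <= b * (Q + 1) by rewrite ler_wpM2l.
by rewrite mulrDr mulr1; lra.
Qed.

(** The offset keeps every term at least 1/2, as [saw1_bound] asks. *)
Definition qn (n : nat) : R := 1 - n.+2%:R^-1.

Lemma qn_itv n : 1 / 2 <= qn n < 1.
Proof.
have h : 0 < n.+2%:R^-1 :> R by rewrite invr_gt0.
have h2 : n.+2%:R^-1 <= 2^-1 :> R by rewrite lef_pV2 ?posrE// ler_nat.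
by rewrite /qn; move: (n.+2%:R^-1) h h2 => z h h2; apply/andP; split; lra.
Qed.

Lemma cvg_qn : qn @ \oo --> (1 : R).
Proof.
rewrite -[X in _ --> X]subr0; apply: cvgB; first exact: cvg_cst.
have := @cvg_harmonic R; rewrite -(cvg_shiftS (@harmonic R)); exact.
Qed.

Lemma sin_half_gt0 r : 0 < r < 2 * pi -> 0 < sin (r / 2).
Proof. by move=> /andP[r0 r1]; apply: sin_gt0_pi; apply/andP; split; lra. Qed.

Lemma cos_lt1 r : 0 < r < 2 * pi -> cos r < 1.
Proof. by move=> h; rewrite cos_half; have := sin_half_gt0 h; nra. Qed.

(** The argument is the cotangent of [r / 2], that is, the tangent of [(pi - r) / 2], which lies in
    the range where [atan] inverts [tan]. *)
Lemma atan_half r : 0 < r < 2 * pi -> atan (sin r / (1 - cos r)) = (pi - r) / 2.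
Proof.
move=> h; have s0 := sin_half_gt0 h.
rewrite -[RHS]tanK; last by rewrite in_itv/=; apply/andP; split; move: h; lra.
congr atan; rewrite /tan (_ : (pi - r) / 2 = - (r / 2 - pi / 2)); last by field.
rewrite sinN cosN sinBpihalf cosBpihalf opprK cos_half.
rewrite [in LHS](_ : r = (r / 2) *+ 2); last by rewrite mulr2n; field.
rewrite sin_mulr2n; move: s0; rewrite (_ : r / 2 *+ 2 / 2 = r / 2); last by rewrite mulr2n; field.
move=> /lt0r_neq0; rewrite -[X in X / _ = _]mulr_natr.
move: (sin _) (cos _) => x y x0.
rewrite (_ : 1 - (1 - 2 * x ^+ 2) = 2 * x ^+ 2); last by ring.
by field.
Qed.

Lemma cvg_saw r : wrap r != 0 -> (fun n => saw (qn n) r) @ \oo --> (pi - wrap r) / 2.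
Proof.
move=> r0; have := wrap_circle r; rewrite /circle/= in_itv/= => /andP[w0 w1].
have h : 0 < wrap r < 2 * pi by rewrite w1 lt_neqAle eq_sym r0 w0.
rewrite -atan_half// (periodic_wrap _ sin_periodic2pi) (periodic_wrap _ cos_periodic2pi).
have c1 := cos_lt1 h; rewrite (periodic_wrap _ cos_periodic2pi) in c1.
apply: continuous_cvg; first exact: continuous_atan.
rewrite -[sin r in X in _ --> X]mul1r -[cos r in X in _ --> X]mul1r.
apply: cvgM; first by apply: cvgM; [exact: cvg_qn|exact: cvg_cst].
apply: cvgV; first by rewrite mul1r gt_eqF// subr_gt0.
by apply: cvgB; [exact: cvg_cst|apply: cvgM; [exact: cvg_qn|exact: cvg_cst]].
Qed.

Lemma cvg_saw1 r : wrap r != 0 -> (fun n => saw1 (qn n) r) @ \oo --> (- (1 / 2) : R).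
Proof.
move=> r0; have := wrap_circle r; rewrite /circle/= in_itv/= => /andP[w0 w1].
have h : 0 < wrap r < 2 * pi by rewrite w1 lt_neqAle eq_sym r0 w0.
have c1 := cos_lt1 h; rewrite (periodic_wrap _ cos_periodic2pi) in c1.
have -> : - (1 / 2) = (1 * cos r - 1 ^+ 2) / (1 - 2 * 1 * cos r + 1 ^+ 2).
  by field; rewrite gt_eqF//; lra.
have cq2 : (fun n => qn n ^+ 2) @ \oo --> (1 ^+ 2 : R).
  by under eq_fun do rewrite expr2; rewrite expr2; apply: cvgM; exact: cvg_qn.
apply: cvgM.
  by apply: cvgB => //; apply: cvgM; [exact: cvg_qn|exact: cvg_cst].
apply: cvgV; first by rewrite gt_eqF// mulr1 expr1n; lra.
apply: cvgD => //; apply: cvgB; first exact: cvg_cst.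
apply: cvgM; last exact: cvg_cst.
by apply: cvgM; [exact: cvg_cst|exact: cvg_qn].
Qed.
End sawtooth.

(** * The weak formulation in a moving frame *)

Section moving_frame.
Context {R : realType}.
Local Notation leb := (@lebesgue_measure R).
Local Notation mR := (measurableTypeR R).

Definition transport_eq (T : R) (rho V : R -> R -> R) :=
  forall f f' : R -> R, periodic2pi f -> periodic2pi f' ->
  (forall x : R, is_derive x (1 : R) f (f' x)) -> continuous f' ->
  forall s t, 0 <= s -> s <= t -> t <= T ->
    \int[leb]_u (rho t u * f u) - \int[leb]_u (rho s u * f u) =
    \int[leb]_(r in `[s, t]) \int[leb]_u (rho r u * (V r u * f' u)).

Lemma is_derive_shiftl (f f' : R -> R) c : (forall x : R, is_derive x (1 : R) f (f' x)) ->
  forall x : R, is_derive x (1 : R) (fun x => f (x - c)) (f' (x - c)).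
Proof.
move=> df x; have := @dR_comp R f (fun x => x - c) x _ _ (df _) (dR_sub (dR_id x) (dR_cst c x)).
by rewrite subr0 mulr1.
Qed.

Lemma is_derive_shiftr (f f' : R -> R) c : (forall x : R, is_derive x (1 : R) f (f' x)) ->
  forall x : R, is_derive x (1 : R) (fun x => f (c - x)) (- f' (c - x)).
Proof.
move=> df x; have := @dR_comp R f (fun x => c - x) x _ _ (df _) (dR_sub (dR_cst c x) (dR_id x)).
by rewrite sub0r mulrN1.
Qed.

Lemma RintegrableMl (D : set R) (f g : R -> R) (k : R) : measurable (D : set mR) ->
  leb.-integrable D (EFin \o f) -> measurable_fun D (g : mR -> R) ->
  (forall x, D x -> `|g x| <= k) -> leb.-integrable D (EFin \o (fun x => g x * f x)).
Proof.
move=> mD fi mg gk; rewrite (_ : (fun x => _) = (fun x => f x * g x)).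
  exact: (RintegrableMr mD fi mg gk).
by apply/funext => x; rewrite mulrC.
Qed.

Lemma periodic_shift (f : R -> R) c : periodic2pi f -> periodic2pi (fun x => f (x - c)).
Proof. by move=> pf u; rewrite addrAC pf. Qed.

Lemma continuous_shiftl (f : R -> R) c : continuous f -> continuous (fun x => f (x - c)).
Proof.
move=> cf x; apply: (@continuous_comp _ _ _ (fun x => x - c) f); last exact: cf.
by apply: cvgB; [exact: cvg_id|exact: cvg_cst].
Qed.

Section transport.
Variables (T : R) (rho V : R -> R -> R) (l : R -> R).
Hypothesis tr : transport T rho V l.
Hypothesis treq : transport_eq T rho V.
Notation tmass := (@tmass R rho).

(* The weak formulation is applied to the test function frozen at its position at
   time [t]; the chain rule along [gam] and Fubini on the triangle
   [s <= x <= r <= t] account for its motion. *)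
Lemma transport_moving (f f1 f2 g gam : R -> R) (s t : R) :
  0 <= s -> s <= t -> t <= T ->
  periodic2pi f -> periodic2pi f1 -> periodic2pi f2 ->
  (forall x : R, is_derive x (1 : R) f (f1 x)) ->
  (forall x : R, is_derive x (1 : R) f1 (f2 x)) -> continuous f2 ->
  measurable_fun setT (gam : mR -> mR) -> measurable_fun setT (g : mR -> R) ->
  leb.-integrable `[s, t] (EFin \o g) ->
  (forall r, s <= r <= t -> gam r = gam s + \int[leb]_(x in `[s, r]) g x) ->
  \int[leb]_u (rho t u * f (u - gam t)) - \int[leb]_u (rho s u * f (u - gam s)) =
  \int[leb]_(r in `[s, t]) \int[leb]_u (rho r u * ((V r u - g r) * f1 (u - gam r))).
Proof.
move=> s0 st tT pf pf1 pf2 df df1 cf2 mgam mg ig hgam.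
have cf1 : continuous f1 by move=> x; apply/differentiable_continuous/derivable1_diffP; have := df1 x.
have cf : continuous f by move=> x; apply/differentiable_continuous/derivable1_diffP; have := df x.
have [B B0 hB] := periodic_bounded cf pf.
have [B1 B10 hB1] := periodic_bounded cf1 pf1.
have [B2 B20 hB2] := periodic_bounded cf2 pf2.
have inT r : s <= r <= t -> 0 <= r <= T.
  by move=> /andP[sr rt]; rewrite (le_trans s0 sr) (le_trans rt tT).
have sT : 0 <= s <= T by apply: inT; rewrite lexx st.
have tT' : 0 <= t <= T by apply: inT; rewrite st lexx.
have subT : `[s, t]%classic `<=` `[0, T]%classic by apply: subset_itv; rewrite bnd_simp.
have mh (h : R -> R) : continuous h -> measurable_fun setT (fun p : mR * mR => h (p.2 - gam p.1)).
  move=> ch; apply: (measurableT_comp (f := h : mR -> R)); first exact: continuous_measurable_fun.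
  by apply: measurable_funB => //; exact: measurableT_comp mgam _.
have mhc (h : R -> R) c : continuous h -> measurable_fun setT ((fun u => h (u - c)) : mR -> R).
  by move=> ch; apply: continuous_measurable_fun; exact: continuous_shiftl.
have mhr (h : R -> R) u : continuous h -> measurable_fun setT ((fun r => h (u - gam r)) : mR -> R).
  move=> ch; apply: (measurableT_comp (f := h : mR -> R)); first exact: continuous_measurable_fun.
  exact: measurable_funB.
have ins a : s <= a <= t -> leb.-integrable `[a, t] (EFin \o g).
  move=> /andP[sa _]; apply: integrableS ig => //.
  by apply: subset_itvr; rewrite bnd_simp.
have chain (h h' : R -> R) Bh a u : (forall x : R, is_derive x (1 : R) h (h' x)) -> continuous h' ->
    (forall x, `|h' x| <= Bh) -> s <= a <= t ->
    h (u - gam t) - h (u - gam a) = - \int[leb]_(r in `[a, t]) (h' (u - gam r) * g r).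
  move=> dh ch' bh sat; have /andP[sa at_] := sat.
  have hga r : a <= r <= t -> gam r = gam a + \int[leb]_(x in `[a, r]) g x.
    move=> /andP[ar rt].
    rewrite (hgam r) ?(le_trans sa ar)// (hgam a)// -addrA; congr (_ + _).
    apply: Rintegral_split => //; apply: integrableS ig => //.
    by apply: subset_itvl; rewrite bnd_simp.
  transitivity (\int[leb]_(r in `[a, t]) (- h' (u - gam r) * g r)); last first.
    have ih : leb.-integrable `[a, t] (EFin \o (fun r => h' (u - gam r) * g r)).
      apply: (RintegrableMl (mitv _) (ins a sat) (k := Bh)); last by move=> r _; exact: bh.
      by apply: measurable_funTS; exact: mhr.
    rewrite -mulN1r -(RintegralZl _ (mitv _) ih); apply: eq_RintegralL => r _.
    by rewrite mulN1r mulNr.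
  apply: (@chain_AC R (fun x => h (u - x)) (fun x => - h' (u - x)) g gam a t Bh at_ _ _ _ (ins a sat) hga).
  - exact: is_derive_shiftr.
  - move=> x; apply: cvgN; apply: (@continuous_comp _ _ _ (fun x => u - x) h'); last exact: ch'.
    by apply: cvgB; [exact: cvg_cst|exact: cvg_id].
  - by move=> x; rewrite normrN.
(* The time of the density and the time of the frame are decoupled: in [P a r] and [q r x] the first
   argument dates [rho], the second [gam]. By the weak formulation [q] integrates to increments of
   [P] in the first argument. *)
pose Al r := \int[leb]_u (rho r u * (V r u * f1 (u - gam r))).
pose P a r := \int[leb]_u (rho a u * f1 (u - gam r)).
pose q r x := \int[leb]_u (rho r u * (V r u * f2 (u - gam x))).
have irho1 a r : 0 <= a <= T -> leb.-integrable setT (EFin \o (fun u => rho a u * f1 (u - gam r))).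
  by move=> aT; apply: (tr_imul tr aT (mhc _ _ cf1)) => u; exact: hB1.
(* Here the frame moves while the density stays frozen at time [s]. *)
have S3 : \int[leb]_u (rho s u * f (u - gam t)) - \int[leb]_u (rho s u * f (u - gam s)) =
    - \int[leb]_(r in `[s, t]) (g r * P s r).
  have mF : measurable_fun setT (fun p : mR * mR => rho s p.1 * (f1 (p.1 - gam p.2) * g p.2)).
    apply: measurable_funM; first exact: measurableT_comp (tr_mrho1 tr s) _.
    apply: measurable_funM; last exact: measurableT_comp mg _.
    have h := measurableT_comp (mh _ cf1) (@measurable_swap _ _ mR mR); exact: h.
  have Fi : (\int[leb]_(u in setT) \int[leb]_(r in `[s, t]) `|rho s u * (f1 (u - gam r) * g r)|%:E < +oo)%E.
    apply: (iterated_lty measurableT (mitv _) mF (integrable_norm (tr_irho tr sT))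
       (RintegrableZl B1 (mitv _) (integrable_norm ig))) => u r _ _.
    by rewrite !normrM ler_wpM2l// ler_wpM2r.
  have E := RFubini measurableT (mitv _) mF Fi.
  have i1 : leb.-integrable setT (EFin \o (fun u => rho s u * f (u - gam t))).
    by apply: (tr_imul tr sT (mhc _ _ cf)) => u; exact: hB.
  have i2 : leb.-integrable setT (EFin \o (fun u => rho s u * f (u - gam s))).
    by apply: (tr_imul tr sT (mhc _ _ cf)) => u; exact: hB.
  have EA u : \int[leb]_(r in `[s, t]) (rho s u * (f1 (u - gam r) * g r)) =
      - (rho s u * f (u - gam t) - rho s u * f (u - gam s)).
    have ih : leb.-integrable `[s, t] (EFin \o (fun r => f1 (u - gam r) * g r)).
      apply: (RintegrableMl (mitv _) ig (k := B1)) => //.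
      by apply: measurable_funTS; exact: mhr.
    rewrite (RintegralZl _ (mitv _) ih) -mulrBr (chain f f1 B1 s u)//; last by rewrite lexx st.
    by rewrite mulrN opprK.
  rewrite -(RintegralB measurableT i1 i2).
  have i12 := RintegrableB measurableT i1 i2.
  transitivity (- \int[leb]_u (\int[leb]_(r in `[s, t]) (rho s u * (f1 (u - gam r) * g r)))).
    under [in RHS]eq_RintegralL => u _ do rewrite EA -mulN1r.
    by rewrite (RintegralZl _ measurableT i12) mulN1r opprK.
  rewrite E; congr (- _); apply: eq_RintegralL => r _.
  rewrite -(RintegralZl _ measurableT (irho1 s r sT)); apply: eq_RintegralL => u _.
  by ring.
have mF3 (h : R -> R) : continuous h -> measurable_fun setT (fun p : (mR * mR) * mR => h (p.2 - gam p.1.2)).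
  move=> ch; apply: (measurableT_comp (f := h : mR -> R)); first exact: continuous_measurable_fun.
  by apply: measurable_funB => //; apply: (measurableT_comp mgam); exact: measurableT_comp.
have mq : measurable_fun setT (fun p : mR * mR => q p.1 p.2).
  apply: (@measurable_Rintegral _ _ _ _ R leb setT (fun (p : mR * mR) (u : mR) => rho p.1 u * (V p.1 u * f2 (u - gam p.2)))) => //.
  have mpr : measurable_fun setT (fun p : (mR * mR) * mR => (p.1.1, p.2)).
    by apply: measurable_fun_pair => //; exact: measurableT_comp.
  apply: measurable_funM; first exact: measurableT_comp (tr_mrho tr) mpr.
  apply: measurable_funM; first exact: measurableT_comp (tr_mV tr) mpr.
  exact: mF3.
have S4 r : s <= r <= t -> \int[leb]_u (rho r u * (V r u * f1 (u - gam t))) =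
    Al r - \int[leb]_(x in `[r, t]) (g x * q r x).
  move=> srt; have rT := inT r srt.
  have mF : measurable_fun setT (fun p : mR * mR => rho r p.1 * (V r p.1 * (f2 (p.1 - gam p.2) * g p.2))).
    apply: measurable_funM; first exact: measurableT_comp (tr_mrho1 tr r) _.
    apply: measurable_funM; first exact: measurableT_comp (tr_mV1 tr r) _.
    apply: measurable_funM; last exact: measurableT_comp mg _.
    have h := measurableT_comp (mh _ cf2) (@measurable_swap _ _ mR mR); exact: h.
  have Fi : (\int[leb]_(u in setT) \int[leb]_(x in `[r, t]) `|rho r u * (V r u * (f2 (u - gam x) * g x))|%:E < +oo)%E.
    apply: (iterated_lty measurableT (mitv _) mF (integrable_norm (tr_irho tr rT))
       (RintegrableZl (l r * B2) (mitv _) (integrable_norm (ins r srt)))) => u x _ _.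
    by rewrite !normrM ler_wpM2l// mulrA ler_wpM2r// ler_pM// (tr_V tr).
  have E := RFubini measurableT (mitv _) mF Fi.
  have i1 : leb.-integrable setT (EFin \o (fun u => rho r u * (V r u * f1 (u - gam t)))).
    by apply: (tr_imulV tr rT (mhc _ _ cf1)) => u; exact: hB1.
  have i2 : leb.-integrable setT (EFin \o (fun u => rho r u * (V r u * f1 (u - gam r)))).
    by apply: (tr_imulV tr rT (mhc _ _ cf1)) => u; exact: hB1.
  have EA u : \int[leb]_(x in `[r, t]) (rho r u * (V r u * (f2 (u - gam x) * g x))) =
      - (rho r u * (V r u * f1 (u - gam t)) - rho r u * (V r u * f1 (u - gam r))).
    have ih : leb.-integrable `[r, t] (EFin \o (fun x => f2 (u - gam x) * g x)).
      apply: (RintegrableMl (mitv _) (ins r srt) (k := B2)) => //.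
      by apply: measurable_funTS; exact: mhr.
    rewrite (RintegralZl _ (mitv _) (RintegrableZl _ (mitv _) ih)) (RintegralZl _ (mitv _) ih).
    by rewrite -!mulrBr (chain f1 f2 B2 r u)// !mulrN opprK.
  have i12 := RintegrableB measurableT i1 i2.
  have L : \int[leb]_u (\int[leb]_(x in `[r, t]) (rho r u * (V r u * (f2 (u - gam x) * g x)))) =
      - (\int[leb]_u (rho r u * (V r u * f1 (u - gam t))) - Al r).
    rewrite -(RintegralB measurableT i1 i2) -mulN1r -(RintegralZl _ measurableT i12).
    by apply: eq_RintegralL => u _; rewrite EA mulN1r.
  have Rr : \int[leb]_(x in `[r, t]) \int[leb]_u (rho r u * (V r u * (f2 (u - gam x) * g x))) =
      \int[leb]_(x in `[r, t]) (g x * q r x).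
    apply: eq_RintegralL => x _.
    have i3 : leb.-integrable setT (EFin \o (fun u => rho r u * (V r u * f2 (u - gam x)))).
      by apply: (tr_imulV tr rT (mhc _ _ cf2)) => u; exact: hB2.
    by rewrite -(RintegralZl _ measurableT i3); apply: eq_RintegralL => u _; ring.
  by rewrite -Rr -E L opprK addrC subrK.
have mP : measurable_fun setT (fun p : mR * mR => P p.1 p.2).
  apply: (@measurable_Rintegral _ _ _ _ R leb setT (fun (p : mR * mR) (u : mR) => rho p.1 u * f1 (u - gam p.2))) => //.
  have mpr : measurable_fun setT (fun p : (mR * mR) * mR => (p.1.1, p.2)).
    by apply: measurable_fun_pair => //; exact: measurableT_comp.
  by apply: measurable_funM; [exact: measurableT_comp (tr_mrho tr) mpr|exact: mF3].
have mPd : measurable_fun setT ((fun x => P x x) : mR -> R).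
  have := measurableT_comp mP (measurable_fun_pair (@measurable_id _ mR setT) (@measurable_id _ mR setT)); exact.
(* Here the density evolves while the frame stays at its final position. *)
have S1 := treq (periodic_shift (gam t) pf) (periodic_shift (gam t) pf1) (is_derive_shiftl (gam t) df)
  (continuous_shiftl cf1) s0 st tT.
have S6 x : s <= x <= t -> \int[leb]_(r in `[s, x]) q r x = P x x - P s x.
  move=> /andP[sx xt]; have := treq (periodic_shift (gam x) pf1) (periodic_shift (gam x) pf2) (is_derive_shiftl (gam x) df1)
    (continuous_shiftl cf2) s0 sx (le_trans xt tT).
  by move=> ->.
have iAl : leb.-integrable `[s, t] (EFin \o Al).
  by apply: (tr_iV tr s0 tT (mh _ cf1)) => r u; exact: hB1.
pose I1 r := \int[leb]_u (rho r u * (V r u * f1 (u - gam t))).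
have iI1 : leb.-integrable `[s, t] (EFin \o I1).
  apply: (tr_iV tr s0 tT (F := fun r u => f1 (u - gam t))) => [|r u]; last exact: hB1.
  exact: measurableT_comp (mhc _ (gam t) cf1) _.
pose J r := \int[leb]_(x in `[r, t]) (g x * q r x).
have JE r : s <= r <= t -> J r = Al r - I1 r by move=> srt; rewrite /I1 S4// opprB addrC subrK.
have iJ : leb.-integrable `[s, t] (EFin \o J).
  apply: (eq_Rintegrable (mitv _) _ (RintegrableB (mitv _) iAl iI1)) => r.
  by rewrite /= in_itv/= => srt; rewrite JE.
have iml : leb.-integrable `[s, t] (EFin \o (fun r => tmass r * l r)).
  by apply: integrableS (tr_Nl tr).
have imlB := RintegrableZr B2 (mitv _) iml.
have qb r x : s <= r <= t -> `|q r x| <= tmass r * l r * B2.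
  by move=> srt; apply: (tr_boundV tr (inT r srt) (mhc _ _ cf2)) => u; exact: hB2.
(* After the exchange [x] is the outer variable, and the inner integral over [r <= x] is the
   increment of [P] given by [S6]. *)
have tri : \int[leb]_(r in `[s, t]) J r = \int[leb]_(x in `[s, t]) (g x * (P x x - P s x)).
  have mF : measurable_fun setT (fun p : mR * mR => g p.2 * q p.1 p.2).
    by apply: measurable_funM => //; exact: measurableT_comp mg _.
  rewrite (@Rintegral_triangle R (fun r x => g x * q r x) s t mF); last first.
    apply: (iterated_lty (mitv _) (mitv _) mF imlB (integrable_norm ig)) => r x.
    rewrite /= !in_itv/= => srt _; rewrite normrM mulrC ler_wpM2r//; exact: qb.
  apply: eq_RintegralL => x; rewrite /= in_itv/= => sxt; rewrite -S6//.
  have /andP[sx xt] := sxt.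
  have iq : leb.-integrable `[s, x] (EFin \o (fun r => q r x)).
    apply: (tr_iV tr s0 (le_trans xt tT) (F := fun r u => f2 (u - gam x))) => [|r u]; last exact: hB2.
    exact: measurableT_comp (mhc _ (gam x) cf2) _.
  by rewrite (RintegralZl _ (mitv _) iq).
pose Q := \int[leb]_(r in `[s, t]) (tmass r * l r * B2).
have Psb x : `|P s x| <= tmass s * B1.
  by apply: (tr_bound tr sT (mhc _ _ cf1)) => u; exact: hB1.
have Pxb x : s <= x <= t -> `|P x x - P s x| <= Q.
  move=> sxt; rewrite -S6//; have /andP[sx xt] := sxt.
  have sub : `[s, x]%classic `<=` `[s, t]%classic by apply: subset_itvl; rewrite bnd_simp.
  apply: (@le_trans _ _ (\int[leb]_(r in `[s, x]) (tmass r * l r * B2))).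
    apply: normr_Rintegral_le => //.
    - by apply: measurable_funTS; exact: measurable_pair2 mq.
    - by move=> r; rewrite /= in_itv/= => /andP[sr rx]; apply: qb; rewrite sr (le_trans rx).
    - by apply: integrableS imlB.
  rewrite /Q (Rintegral_split sx xt imlB) lerDl; apply: Rintegral_ge0 => r _.
  apply: mulr_ge0; last exact: ltW.
  by apply: mulr_ge0; [exact: tmass_ge0|exact: (tr_l0 tr)].
have igPs : leb.-integrable `[s, t] (EFin \o (fun x => g x * P s x)).
  by apply: (RintegrableMr (mitv _) ig (k := tmass s * B1)) => //; apply: measurable_funTS; exact: measurable_pair1 mP.
have igD : leb.-integrable `[s, t] (EFin \o (fun x => g x * (P x x - P s x))).
  apply: (RintegrableMr (mitv _) ig (k := Q)).
    by apply: measurable_funTS; apply: measurable_funB => //; exact: measurable_pair1 mP.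
  by move=> x; rewrite /= in_itv/=; exact: Pxb.
have igP : leb.-integrable `[s, t] (EFin \o (fun x => g x * P x x)).
  apply: (eq_Rintegrable (mitv _) _ (RintegrableD (mitv _) igD igPs)) => x _.
  by rewrite -mulrDr subrK.
have S1' : \int[leb]_(r in `[s, t]) I1 r = \int[leb]_(r in `[s, t]) Al r - \int[leb]_(r in `[s, t]) J r.
  rewrite -(RintegralB (mitv _) iAl iJ); apply: eq_RintegralL => r; rewrite /= in_itv/= => srt.
  by rewrite JE// opprB addrC subrK.
have -> : \int[leb]_(r in `[s, t]) \int[leb]_u (rho r u * ((V r u - g r) * f1 (u - gam r))) =
    \int[leb]_(r in `[s, t]) Al r - \int[leb]_(r in `[s, t]) (g r * P r r).
  rewrite -(RintegralB (mitv _) iAl igP); apply: eq_RintegralL => r; rewrite /= in_itv/= => srt.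
  have i1 : leb.-integrable setT (EFin \o (fun u => rho r u * (V r u * f1 (u - gam r)))).
    by apply: (tr_imulV tr (inT r srt) (mhc _ _ cf1)) => u; exact: hB1.
  have i2 := irho1 r r (inT r srt).
  rewrite /Al /P -(RintegralZl _ measurableT i2) -(RintegralB measurableT i1 (RintegrableZl _ measurableT i2)).
  by apply: eq_RintegralL => u _; ring.
(* The correction [J] and the motion of the frame in [S3] add up: the terms in [P s] cancel and the
   diagonal [P r r] remains. *)
have EP : \int[leb]_(r in `[s, t]) (g r * P r r) =
    \int[leb]_(r in `[s, t]) J r + \int[leb]_(r in `[s, t]) (g r * P s r).
  by rewrite tri -(RintegralD (mitv _) igD igPs); apply: eq_RintegralL => r _; rewrite -mulrDr subrK.
rewrite EP; move: S1 S3; rewrite -/I1 S1' => E1 E2.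
have telescope (a c d A j G : R) : a - c = A - j -> c - d = - G -> a - d = A - (j + G).
  by move=> h1 h2; rewrite -(subrKA c) h1 h2; ring.
exact: telescope E1 E2.
Qed.
End transport.
End moving_frame.

(** * Characteristics and the distribution function *)

Section characteristics.
Context {R : realType}.
Local Notation leb := (@lebesgue_measure R).
Local Notation mR := (measurableTypeR R).

Lemma wrap_shift_ae (c : R) : {ae leb, forall u : mR, wrap (u - c) != 0}.
Proof.
pose N : set mR := range (fun k : int => c + 2 * pi * k%:~R).
have cN : countable N by apply: card_le_trans (card_image_le _ _) _; exact: countableP.
exists N; split.
- by apply: countable_measurable.
- exact: countable_lebesgue_measure0.
- move=> u /= /negP; rewrite negbK => /eqP; rewrite /wrap => /eqP; rewrite subr_eq0 => /eqP h.
  by exists (Num.floor ((u - c) / (2 * pi))) => //; rewrite -h addrC subrK.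
Qed.

(** In integral form, as the velocity is only measurable in time; [gam] is measurable on the whole
    line so that its composition with the velocity is. *)
Definition characteristic (V : R -> R -> R) (s t : R) (gam : R -> R) :=
  measurable_fun setT (gam : mR -> mR) /\
  forall r, s <= r <= t -> gam r = gam s + \int[leb]_(x in `[s, r]) V x (gam x).

Definition winding (z u : R) : R := (Num.floor ((u - z) / (2 * pi)))%:~R.

Lemma measurable_winding z : measurable_fun setT (winding z : mR -> R).
Proof.
apply: nondecreasing_measurable => // x y xy; rewrite ler_int le_floor//.
by rewrite ler_wpM2r ?invr_ge0 ?mulr_ge0 ?pi_ge0// lerD2r.
Qed.

Lemma winding_wrap z u : wrap (u - z) = u - z - 2 * pi * winding z u.
Proof. by []. Qed.

Lemma winding_bound z : exists B : R, forall u, circle u -> `|winding z u| <= B.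
Proof.
have p0 : 0 < 2 * pi :> R by rewrite mulr_gt0// pi_gt0.
exists ((2 * (2 * pi) + `|z|) / (2 * pi)) => u cu; rewrite ler_pdivlMr//.
have cw := wrap_circle (u - z); have := winding_wrap z u.
move: cu cw; rewrite /circle/= !in_itv/= => /andP[u0 u1] /andP[w0 w1] E.
rewrite -[X in _ * X](gtr0_norm p0) -normrM.
have -> : winding z u * (2 * pi) = u - z - wrap (u - z) by rewrite E; ring.
rewrite ler_norml; have := ler_norm z; have := ler_norm (- z); rewrite normrN => h1 h2.
by apply/andP; split; lra.
Qed.

Section transport.
Variables (T : R) (rho V : R -> R -> R) (l : R -> R).
Hypothesis tr : transport T rho V l.
Hypothesis treq : transport_eq T rho V.
Notation tmass := (@tmass R rho).

(* For [0 <= z <= 2 pi] this is the integral of [rho t] over [[0, z[]: on the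
   circle [winding z] is [-1] below [z] and [0] from [z] on. *)
Definition cdf t z := - \int[leb]_u (rho t u * winding z u).

(** A bound on the circle suffices because [rho] vanishes off it. This admits weights such as [u]
    and [winding], which are unbounded on the line. *)
Lemma tr_icirc t (f : R -> R) B : 0 <= t <= T -> measurable_fun setT (f : mR -> R) ->
  (forall u, circle u -> `|f u| <= B) -> leb.-integrable setT (EFin \o (fun u => rho t u * f u)).
Proof.
move=> tT mf fB.
have mf' : measurable_fun setT (f \_ circle : mR -> R).
  by apply/(measurable_restrictT _ mcircle); exact: measurable_funTS.
have B0 : 0 <= B.
  have h : circle (0 : R) by rewrite /circle/= in_itv/= lexx mulr_gt0// pi_gt0.
  exact: le_trans (fB 0 h).
apply: (@eq_Rintegrable _ mR R leb setT (fun u => rho t u * (f \_ circle) u)) => //.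
  move=> u _; rewrite patchE; case: ifPn => // /negP uc.
  by rewrite (tr_circle tr) ?mul0r// => cu; apply: uc; rewrite inE.
apply: (tr_imul tr (B := B) tT mf') => u; rewrite patchE.
by case: ifPn => [/set_mem /fB //|_]; rewrite normr0.
Qed.

Lemma cvg_Rintegral_saw a z : 0 <= a <= T -> (fun n => \int[leb]_u (rho a u * saw (qn n) (u - z))) @ \oo -->
    \int[leb]_u (rho a u * ((pi - wrap (u - z)) / 2)).
Proof.
have q01 n : 0 <= (qn n : R) < 1 by have /andP[h1 h2] := @qn_itv R n; apply/andP; split; [lra|].
move=> aT; apply: (@Rdominated_cvg _ mR R leb setT (fun n u => rho a u * saw (qn n) (u - z)) _ (fun u => `|rho a u| * 2)) => //.
- move=> n; apply: measurable_funM; first exact: (tr_mrho1 tr).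
  apply: continuous_measurable_fun; apply: continuous_shiftl.
  exact: (dR_continuous (fun x => is_derive_saw x (q01 n))).
- apply: measurable_funM => //; first exact: (tr_mrho1 tr).
  apply: measurable_funM => //; apply: measurable_funB => //.
  by apply: (measurableT_comp measurable_wrap); exact: measurable_funB.
- apply: filterS (wrap_shift_ae z) => u hu _.
  by apply: cvgM; [exact: cvg_cst|exact: cvg_saw].
- by move=> n u _; rewrite normrM ler_wpM2l// saw_bound.
- exact: (RintegrableZr 2 measurableT (integrable_norm (tr_irho tr aT))).
Qed.

(** The sawtooth with its jump at [z] is affine in [u] plus [pi * winding z u]; the affine part
    integrates to the mass and the first moment. *)
Lemma Rintegral_wrap_cdf a z : 0 <= a <= T -> \int[leb]_u (rho a u * ((pi - wrap (u - z)) / 2)) =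
  (pi + z) / 2 * \int[leb]_u rho a u - 2^-1 * \int[leb]_u (rho a u * u) - pi * cdf a z.
Proof.
move=> aT.
have [B hB] := winding_bound z.
have i1 := tr_irho tr aT.
have i2 : leb.-integrable setT (EFin \o (fun u => rho a u * u)).
  apply: (tr_icirc (B := 2 * pi) aT) => // u; rewrite /circle/= in_itv/= => /andP[u0 u1].
  by rewrite ger0_norm// ltW.
have i3 := tr_icirc aT (measurable_winding z) hB.
have h1 := RintegrableZl ((pi + z) / 2) measurableT i1.
have h2 := RintegrableZl (2^-1) measurableT i2.
have h3 := RintegrableZl pi measurableT i3.
rewrite /cdf mulrN opprK.
rewrite -(RintegralZl _ measurableT i1) -(RintegralZl _ measurableT i2) -(RintegralZl _ measurableT i3).
rewrite -(RintegralB measurableT h1 h2) -(RintegralD measurableT (RintegrableB measurableT h1 h2) h3).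
by apply: eq_RintegralL => u _; rewrite winding_wrap; field.
Qed.

Lemma mass_conserved s t : 0 <= s -> s <= t -> t <= T -> \int[leb]_u rho t u = \int[leb]_u rho s u.
Proof.
move=> s0 sa aT.
have := treq (f := cst 1) (f' := cst 0) (fun _ => erefl) (fun _ => erefl) (fun x => dR_cst 1 x) (@cst_continuous _ _ _) s0 sa aT.
rewrite [X in _ = X -> _](_ : _ = 0); last first.
  rewrite (@eq_RintegralL _ _ _ (cst 0)) ?Rintegral_cst ?mul0r// => r _.
  by rewrite (@eq_RintegralL _ _ _ (cst 0)) ?Rintegral_cst ?mul0r// => u _; rewrite mulr0 mulr0.
move=> /eqP; rewrite subr_eq0 => /eqP h.
by rewrite (@eq_RintegralL _ _ _ (fun u => rho t u * 1)) ?h => [|u _]; [apply: eq_RintegralL => u _|]; rewrite mulr1.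
Qed.

(** The limit of [transport_moving] for [saw q] as [q] tends to 1. The slope tends to [- (1 / 2)]
    off the characteristic, and its product with the velocity difference stays dominated near it. *)
Lemma saw_moving s t gam : 0 <= s -> s <= t -> t <= T ->
  leb.-integrable `[s, t] (EFin \o l) -> characteristic V s t gam ->
  \int[leb]_u (rho t u * ((pi - wrap (u - gam t)) / 2)) -
  \int[leb]_u (rho s u * ((pi - wrap (u - gam s)) / 2)) =
  - (1 / 2) * \int[leb]_(r in `[s, t]) \int[leb]_u (rho r u * (V r u - V r (gam r))).
Proof.
move=> s0 st tT il [mgam hgam].
have inT r : s <= r <= t -> 0 <= r <= T.
  by move=> /andP[sr rt]; rewrite (le_trans s0 sr) (le_trans rt tT).
pose g r := V r (gam r).
have mg : measurable_fun setT (g : mR -> R).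
  have := measurableT_comp (tr_mV tr) (measurable_fun_pair (@measurable_id _ mR setT) mgam); exact.
have ig : leb.-integrable `[s, t] (EFin \o g).
  apply: (Rintegrable_le (mitv _) _ _ il); first exact: measurable_funTS.
  by move=> r _; exact: (tr_V tr).
have q01 n : 0 <= (qn n : R) < 1 by have /andP[h1 h2] := @qn_itv R n; apply/andP; split; [lra|].
have E n := transport_moving tr treq s0 st tT (saw_periodic (qn n)) (saw1_periodic (qn n)) (saw2_periodic (qn n))
   (fun x => is_derive_saw x (q01 n)) (fun x => is_derive_saw1 x (q01 n)) (continuous_saw2 (q01 n)) mgam mg ig hgam.
have csaw n : continuous (saw (qn n : R)) := dR_continuous (fun x => is_derive_saw x (q01 n)).
have csaw1 n : continuous (saw1 (qn n : R)) := dR_continuous (fun x => is_derive_saw1 x (q01 n)).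
have mc (h : R -> R) c : continuous h -> measurable_fun setT ((fun u => h (u - c)) : mR -> R).
  by move=> ch; apply: continuous_measurable_fun; exact: continuous_shiftl.
have mw c : measurable_fun setT ((fun u => (pi - wrap (u - c)) / 2) : mR -> R).
  apply: measurable_funM => //; apply: measurable_funB => //.
  by apply: (measurableT_comp measurable_wrap); exact: measurable_funB.
have C1 (a : R) (aT : 0 <= a <= T) := @cvg_Rintegral_saw a (gam a) aT.
(* With [d] the representative of [u - gam r] in [-pi, pi[, periodicity lets the Lipschitz bound
   supply the factor [|d|] for [saw1_bound]. *)
have dom n r u : `|(V r u - g r) * saw1 (qn n) (u - gam r)| <= l r * 5.
  pose d := wrap (u - gam r + pi) - pi.
  have cd := wrap_circle (u - gam r + pi).
  have dpi : `|d| <= pi.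
    by move: cd; rewrite /circle/= in_itv/= => /andP[h1 h2]; rewrite ler_norml /d; apply/andP; split; lra.
  pose k := Num.floor ((u - gam r + pi) / (2 * pi)).
  have uE : u - gam r = d + 2 * pi * k%:~R by rewrite /d /wrap -/k; ring.
  have -> : V r u = V r (gam r + d).
    by rewrite -[in RHS](periodic_int k _ (tr_pV tr r)) -addrA -uE addrC subrK.
  rewrite uE (periodic_int k _ (saw1_periodic _)) normrM.
  have h1 := tr_VL tr r (gam r + d) (gam r); rewrite addrAC subrr add0r in h1.
  have h2 := saw1_bound (@qn_itv R n) dpi.
  apply: (@le_trans _ _ (l r * `|d| * `|saw1 (qn n) d|)); first by rewrite ler_wpM2r.
  by rewrite -mulrA ler_wpM2l// (tr_l0 tr).
have mVg r : measurable_fun setT ((fun u => V r u - g r) : mR -> R).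
  by apply: measurable_funB => //; exact: (tr_mV1 tr).
have C2 r : s <= r <= t -> (fun n => \int[leb]_u (rho r u * ((V r u - g r) * saw1 (qn n) (u - gam r)))) @ \oo -->
    - (1 / 2) * \int[leb]_u (rho r u * (V r u - g r)).
  move=> srt; have rT := inT r srt.
  have i1 : leb.-integrable setT (EFin \o (fun u => rho r u * (V r u - g r))).
    apply: (tr_imul tr (B := l r + l r) rT (mVg r)) => u.
    by rewrite (le_trans (ler_normB _ _))// lerD// (tr_V tr).
  rewrite -(RintegralZl _ measurableT i1).
  apply: (@Rdominated_cvg _ mR R leb setT (fun n u => rho r u * ((V r u - g r) * saw1 (qn n) (u - gam r))) _ (fun u => `|rho r u| * (l r * 5))) => //.
  - move=> n; apply: measurable_funM; first exact: (tr_mrho1 tr).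
    by apply: measurable_funM => //; exact: mc.
  - apply: measurable_funM => //; apply: measurable_funM => //; exact: (tr_mrho1 tr).
  - apply: filterS (wrap_shift_ae (gam r)) => u hu _.
    rewrite (_ : - (1 / 2) * (rho r u * (V r u - g r)) = rho r u * ((V r u - g r) * - (1 / 2))); last by ring.
    apply: cvgM; first exact: cvg_cst.
    by apply: cvgM; [exact: cvg_cst|exact: cvg_saw1].
  - by move=> n u _; rewrite normrM ler_wpM2l// dom.
  - exact: (RintegrableZr _ measurableT (integrable_norm (tr_irho tr rT))).
have mpr (n : nat) : measurable_fun setT (fun p : mR * mR => (V p.1 p.2 - g p.1) * saw1 (qn n) (p.2 - gam p.1)).
  apply: measurable_funM.
    by apply: measurable_funB; [exact: (tr_mV tr)|exact: measurableT_comp mg _].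
  apply: (measurableT_comp (f := saw1 (qn n) : mR -> R)); first exact: continuous_measurable_fun.
  by apply: measurable_funB => //; exact: measurableT_comp mgam _.
have mlim : measurable_fun setT ((fun r => - (1 / 2) * \int[leb]_u (rho r u * (V r u - g r))) : mR -> R).
  apply: measurable_funM => //; apply: (tr_mint tr (F := fun r u => V r u - g r)).
  by apply: measurable_funB; [exact: (tr_mV tr)|exact: measurableT_comp mg _].
have iml : leb.-integrable `[s, t] (EFin \o (fun r => tmass r * l r * 5)).
  have subT : `[s, t]%classic `<=` `[0, T]%classic by apply: subset_itv; rewrite bnd_simp.
  have h := RintegrableZr 5 (mitv _) (tr_Nl tr).
  exact: (integrableS (mitv _) (mitv _) subT h).
have iVg : leb.-integrable `[s, t] (EFin \o (fun r => \int[leb]_u (rho r u * (V r u - g r)))).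
  apply: (@Rintegrable_le _ _ _ leb _ _ (fun r => 2 * (tmass r * l r * 5))) => //.
  - apply: measurable_funTS; apply: (tr_mint tr (F := fun r u => V r u - g r)).
    by apply: measurable_funB; [exact: (tr_mV tr)|exact: measurableT_comp mg _].
  - move=> r; rewrite /= in_itv/= => srt.
    have h := tr_bound tr (B := l r + l r) (inT r srt) (mVg r).
    apply: le_trans (h _) _.
      by move=> u; rewrite (le_trans (ler_normB _ _))// lerD// (tr_V tr).
    have k0 (z : R) : 0 <= z -> z + z <= 2 * (z * 5) by move=> z0; lra.
    by rewrite mulrDr; apply: k0; apply: mulr_ge0; [exact: tmass_ge0|exact: (tr_l0 tr)].
  - exact: RintegrableZl.
have C3 : (fun n => \int[leb]_(r in `[s, t]) \int[leb]_u (rho r u * ((V r u - g r) * saw1 (qn n) (u - gam r)))) @ \oo -->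
    - (1 / 2) * \int[leb]_(r in `[s, t]) \int[leb]_u (rho r u * (V r u - g r)).
  rewrite -(RintegralZl _ (mitv _) iVg).
  apply: (@Rdominated_cvg _ mR R leb `[s, t]%classic (fun n r => \int[leb]_u (rho r u * ((V r u - g r) * saw1 (qn n) (u - gam r)))) _ (fun r => tmass r * l r * 5)) => //.
  - by move=> n; apply: measurable_funTS; apply: (tr_mint tr (mpr n)).
  - exact: measurable_funTS.
  - by apply: aeW => r; rewrite /= in_itv/=; exact: C2.
  - move=> n r; rewrite /= in_itv/= => srt; rewrite -mulrA.
    apply: (tr_bound tr (inT r srt)) => [|u]; last exact: dom.
    by apply: measurable_funM => //; exact: mc.
have sT : 0 <= s <= T by apply: inT; rewrite lexx st.
have tT' : 0 <= t <= T by apply: inT; rewrite st lexx.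
apply: (cvg_unique (@Rhausdorff R) (cvgB (C1 t tT') (C1 s sT))).
by move: C3; under eq_fun do rewrite -E.
Qed.

(* The sawtooth jumps at the characteristic only, where the test function of
   [saw_moving] sees the velocity difference [V r u - V r (gam r)] vanish. *)
Lemma cdf_characteristic s t : 0 <= s -> s <= t -> t <= T ->
  leb.-integrable `[s, t] (EFin \o l) ->
  exists K : R, forall gam, characteristic V s t gam -> cdf t (gam t) = cdf s (gam s) + K.
Proof.
move=> s0 st tT il.
have inT r : s <= r <= t -> 0 <= r <= T.
  by move=> /andP[sr rt]; rewrite (le_trans s0 sr) (le_trans rt tT).
have sT : 0 <= s <= T by apply: inT; rewrite lexx st.
have tT' : 0 <= t <= T by apply: inT; rewrite st lexx.
pose m a := \int[leb]_u rho a u.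
pose c a := \int[leb]_u (rho a u * u).
pose J := \int[leb]_(r in `[s, t]) \int[leb]_u (rho r u * V r u).
have mconst a : s <= a <= t -> m a = m s.
  by move=> /andP[sa at_]; apply: mass_conserved => //; exact: le_trans tT.
have wE (a z : R) (aT : 0 <= a <= T) := @Rintegral_wrap_cdf a z aT.
(* What remains of [saw_moving] after division by [pi]: first moments and mean velocity. The terms
   in [gam t - gam s] occur on both sides with the same mass and cancel. *)
exists (- (c t - c s - J) / (2 * pi)) => gam chg.
have [mgam hgam] := chg.
have := saw_moving s0 st tT il chg; rewrite !wE// -!/(m _) -!/(c _) (mconst t) ?st ?lexx//.
pose g r := V r (gam r).
have mg : measurable_fun setT (g : mR -> R).
  have := measurableT_comp (tr_mV tr) (measurable_fun_pair (@measurable_id _ mR setT) mgam); exact.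
have ig : leb.-integrable `[s, t] (EFin \o g).
  apply: (Rintegrable_le (mitv _) _ _ il); first exact: measurable_funTS.
  by move=> r _; exact: (tr_V tr).
have iJ : leb.-integrable `[s, t] (EFin \o (fun r => \int[leb]_u (rho r u * V r u))).
  have := tr_iV tr (F := fun _ _ => 1) (B := 1) s0 tT => h.
  apply: (eq_Rintegrable (mitv _) _ (h _ _)) => //.
  - by move=> r _; apply: eq_RintegralL => u _; rewrite mulr1.
  - by move=> r u; rewrite normr1.
have -> : \int[leb]_(r in `[s, t]) \int[leb]_u (rho r u * (V r u - V r (gam r))) = J - m s * (gam t - gam s).
  rewrite (hgam t) ?st ?lexx// [X in m s * X]addrAC subrr add0r.
  rewrite -(RintegralZl _ (mitv _) ig) -(RintegralB (mitv _) iJ (RintegrableZl _ (mitv _) ig)).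
  apply: eq_RintegralL => r; rewrite /= in_itv/= => srt; rewrite -(mconst r srt) mulrC.
  have rT := inT r srt.
  have i1 : leb.-integrable setT (EFin \o (fun u => rho r u * V r u)).
    by apply: (tr_imul tr (B := l r) rT (tr_mV1 tr r)) => u; exact: (tr_V tr).
  have i2 := tr_irho tr rT.
  rewrite -(RintegralZl _ measurableT i2) -(RintegralB measurableT i1 (RintegrableZl _ measurableT i2)).
  by apply: eq_RintegralL => u _; rewrite /g; ring.
have key (a b x y m' ct cs J' p : R) : 0 < p ->
    (p + x) / 2 * m' - 2^-1 * ct - p * a - ((p + y) / 2 * m' - 2^-1 * cs - p * b) =
    - (1 / 2) * (J' - m' * (x - y)) -> a = b + - (ct - cs - J') / (2 * p).
  move=> p0 h; have p0' : p != 0 by rewrite gt_eqF.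
  apply: (mulfI p0'); rewrite mulrDr (_ : p * (- (ct - cs - J') / (2 * p)) = - (ct - cs - J') / 2); last by field.
  by move: h; lra.
exact: key (@pi_gt0 R).
Qed.
End transport.
End characteristics.

(** * Flows of velocities with a time-integrable Lipschitz constant *)

Section flows.
Context {R : realType}.
Local Notation leb := (@lebesgue_measure R).
Local Notation mR := (measurableTypeR R).

(** The improvement from [K] to [d0 + K / 2] is iterated from the crude bound [B], and the constants
    tend to the fixed point [2 * d0]. The index set is arbitrary, so that the bound may be uniform
    over nodes as well as times. *)
Lemma gronwall_iteration (I : Type) (D : I -> Prop) (del E : I -> R) (B d0 : R) :
  (forall i, D i -> 1 <= E i) -> 0 <= B -> (forall i, D i -> del i <= B) -> 0 <= d0 ->
  (forall K, 0 <= K -> (forall i, D i -> del i <= K * E i) -> forall i, D i -> del i <= (d0 + K / 2) * E i) ->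
  forall i, D i -> del i <= 2 * d0 * E i.
Proof.
move=> E1 B0 dB d00 step i Di.
pose c n := 2 * d0 + B * 2^-1 ^+ n.
have c0 n : 0 <= c n by rewrite addr_ge0 ?mulr_ge0 ?exprn_ge0.
have P n : forall i, D i -> del i <= c n * E i.
  elim: n => [j Dj|n ih j Dj].
    rewrite /c expr0 mulr1; apply: le_trans (dB j Dj) _.
    have := E1 j Dj; nra.
  have -> : c n.+1 = d0 + c n / 2 by rewrite /c exprS; field.
  exact: step.
have cc : (fun n => c n * E i) @ \oo --> 2 * d0 * E i.
  apply: cvgM; last exact: cvg_cst.
  rewrite -[X in _ --> X]addr0; apply: cvgD; first exact: cvg_cst.
  rewrite -[X in _ --> X](mulr0 B); apply: cvgM; first exact: cvg_cst.
  by apply: cvg_expr; rewrite gtr0_norm ?invr_gt0// invf_lt1// ltr1n.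
rewrite -(cvg_lim (@Rhausdorff R) cc); apply: limr_ge.
  by apply/cvg_ex; exists (2 * d0 * E i); exact: cc.
by near=> n; exact: P.
Unshelve. all: by end_near. Qed.

Section velocity.
Variables (V : R -> R -> R) (l : R -> R).
Hypothesis mV : measurable_fun setT (fun p : mR * mR => V p.1 p.2).
Hypothesis Vl : forall t u, `|V t u| <= l t.
Hypothesis VL : forall t u v, `|V t u - V t v| <= l t * `|u - v|.

Lemma vel_l0 t : 0 <= l t.
Proof. exact: le_trans (Vl t 0). Qed.

Lemma mV_comp (gam : R -> R) : measurable_fun setT (gam : mR -> mR) ->
  measurable_fun setT ((fun x => V x (gam x)) : mR -> R).
Proof.
by move=> mgam; have := measurableT_comp mV (measurable_fun_pair (@measurable_id _ mR setT) mgam); exact.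
Qed.

Lemma iV_comp s t (gam : R -> R) : measurable_fun setT (gam : mR -> mR) ->
  leb.-integrable `[s, t] (EFin \o l) ->
  leb.-integrable `[s, t] (EFin \o (fun x => V x (gam x))).
Proof.
move=> mgam il; apply: (Rintegrable_le (mitv _) _ _ il); first by apply: measurable_funTS; exact: mV_comp.
by move=> r _; exact: Vl.
Qed.

(** Picard iteration in the supremum norm weighted by [expR (M * r)], with [M] from [exp_weight]. *)
Lemma flow_exists s t : s <= t -> leb.-integrable `[s, t] (EFin \o l) ->
  exists Phi : R -> R -> R, forall q, characteristic V s t (Phi q) /\ Phi q s = q.
Proof.
move=> st il; have [M [M0 hM]] := exp_weight vel_l0 il.
have ml : measurable_fun `[s, t] l by have /measurable_int/measurable_EFinP := il.
(* Stopping the integral at [t] defines [F] for all times, although [l] is integrable on [s, t]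
   only. *)
pose F (X : R * R -> R) (j : R * R) : R :=
  j.1 + \int[leb]_(x in `[s, Num.min j.2 t]) V x (X (j.1, x)).
pose P (X : R * R -> R) := forall q, measurable_fun setT ((fun r => X (q, r)) : mR -> mR).
have sub r : `[s, Num.min r t]%classic `<=` `[s, t]%classic.
  by apply: subset_itvl; rewrite bnd_simp ge_min lexx orbT.
have isub (f : R -> R) r : leb.-integrable `[s, t] (EFin \o f) -> leb.-integrable `[s, Num.min r t] (EFin \o f).
  by move=> ih; apply: integrableS ih.
have cexp : continuous (fun x => expR (M * x)).
  move=> r; apply: continuous_comp; last exact: continuous_expR.
  by apply: cvgM; [exact: cvg_cst|exact: cvg_id].
have [||||||X [PX FX]] := @contraction_fixpoint R (R * R)%type (fun j => expR (M * j.2)) P F (fun j => j.1).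
- by move=> j; exact: expR_ge0.
- by move=> q; exact: measurable_cst.
- move=> X PX q; apply: measurable_funD => //.
  (* With a fixed domain and an indicator this becomes a parameter integral, hence measurable in its
     upper limit. *)
  rewrite [X in measurable_fun _ X](_ : _ = (fun r => \int[leb]_(x in `[s, t]) (V x (X (q, x)) * (x <= r)%R%:R))).
    apply: (@measurable_Rintegral _ _ mR mR R leb `[s, t]%classic (fun r x => V x (X (q, x)) * (x <= r)%R%:R)) => //.
    apply: measurable_funM; first exact: measurableT_comp (mV_comp (PX q)) _.
    by apply: Rmeasurable_bool; exact: measurable_fun_ler.
  apply/funext => r; rewrite [LHS]Rintegral_mkcond [RHS]Rintegral_mkcond; congr Rintegral; apply/funext => x.
  rewrite !patchE !mem_setE !in_itv/= le_min.
  by case: (s <= x) => //=; case: (x <= r) => /=; case: (x <= t); rewrite ?mulr1 ?mulr0.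
- move=> Xn X PXn cX q; apply: (measurable_fun_cvg (fun n => PXn n q)) => r _; exact: cX.
- move=> X Y K K0 PX PY XY [q r]; rewrite /F/=.
  have [sr|rs] := leP s (Num.min r t); last first.
    rewrite !set_itv_ge ?bnd_simp -?ltNge// !Rintegral_set0 subrr normr0.
    by rewrite mulr_ge0 ?expR_ge0// divr_ge0.
  rewrite opprD addrACA subrr add0r.
  have i1 := isub _ r (iV_comp (PX q) il); have i2 := isub _ r (iV_comp (PY q) il).
  rewrite -(RintegralB (mitv _) i1 i2).
  have cle : leb.-integrable `[s, t] (EFin \o (fun x => l x * expR (M * x))).
    apply: (RintegrableMr (mitv _) il (k := expR (M * t))).
      by apply: measurable_funTS; exact: continuous_measurable_fun.
    by move=> x; rewrite /= in_itv/= => /andP[_ xt]; rewrite ger0_norm ?expR_ge0// ler_expR ler_pM2l.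
  have cleK := RintegrableZl K (mitv _) (isub _ r cle).
  apply: (@le_trans _ _ (\int[leb]_(x in `[s, Num.min r t]) (K * (l x * expR (M * x))))).
    apply: (normr_Rintegral_le (mitv _)) cleK.
      by apply: measurable_funTS; apply: measurable_funB; exact: mV_comp.
    move=> x _; apply: le_trans (VL _ _ _) _; rewrite mulrCA.
    by rewrite ler_wpM2l ?vel_l0//; exact: (XY (q, x)).
  rewrite (RintegralZl _ (mitv _) (isub _ r cle)) -mulrA ler_wpM2l//.
  have := hM s (Num.min r t) (lexx s) sr; rewrite ge_min lexx orbT => /(_ isT) h.
  apply: le_trans h _; rewrite mulrC ler_wpM2l// ler_expR ler_pM2l//.
  by rewrite ge_min lexx.
- exists (\int[leb]_(x in `[s, t]) l x / expR (M * s)); split.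
    by rewrite divr_ge0 ?expR_ge0//; apply: Rintegral_ge0 => x _; exact: vel_l0.
  move=> [q r]; rewrite /F/= addrAC subrr add0r.
  have Il0 : 0 <= \int[leb]_(x in `[s, t]) l x by apply: Rintegral_ge0 => x _; exact: vel_l0.
  have [sr|rs] := leP s (Num.min r t); last first.
    rewrite set_itv_ge ?bnd_simp -?ltNge// Rintegral_set0 normr0.
    by rewrite mulr_ge0 ?expR_ge0// divr_ge0 ?expR_ge0.
  apply: (@le_trans _ _ (\int[leb]_(x in `[s, t]) l x)).
    apply: (@le_trans _ _ (\int[leb]_(x in `[s, Num.min r t]) l x)).
      apply: (normr_Rintegral_le (mitv _)) (isub _ r il) => [|x _]; last exact: Vl.
      by apply: measurable_funTS; apply: mV_comp; exact: measurable_cst.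
    have mt : Num.min r t <= t by rewrite ge_min lexx orbT.
    rewrite (Rintegral_split sr mt il) lerDl; apply: Rintegral_ge0 => x _; exact: vel_l0.
  rewrite -mulrA ler_peMr// mulrC -expRN -expRD -expR0 ler_expR.
  rewrite subr_ge0 ler_pM2l//.
  by move: sr; rewrite le_min => /andP[].
exists (fun q r => X (q, r)) => q.
have Xs : X (q, s) = q.
  by rewrite -FX /F/= (min_idPl st) set_itv1 Rintegral_set1 addr0.
split => //; split; first exact: PX.
move=> r /andP[sr rt]; rewrite Xs -[LHS]FX /F/= (min_idPl rt); exact: erefl.
Qed.

Lemma char_subl s t r gam : s <= r -> r <= t -> leb.-integrable `[s, t] (EFin \o l) ->
  characteristic V s t gam -> characteristic V r t gam.
Proof.
move=> sr rt il [mgam hgam]; split=> // x /andP[rx xt].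
have ix := iV_comp mgam il.
rewrite (hgam x) ?(le_trans sr rx)// (hgam r) ?sr// -addrA; congr (_ + _).
apply: Rintegral_split => //; apply: integrableS ix => //.
by apply: subset_itvl; rewrite bnd_simp.
Qed.

Lemma char_subr s t r gam : r <= t -> characteristic V s t gam -> characteristic V s r gam.
Proof.
move=> rt [mgam hgam]; split=> // x /andP[sx xr]; apply: hgam.
by rewrite sx (le_trans xr).
Qed.

Lemma char_continuous s t gam : s <= t -> leb.-integrable `[s, t] (EFin \o l) ->
  characteristic V s t gam -> {within `[s, t], continuous gam}.
Proof.
move=> st il [mgam hgam]; have ix := iV_comp mgam il.
apply: (@subspace_eq_continuous _ _ _ (fun r => gam s + \int[leb]_(x in `[s, r]) V x (gam x))).
  by move=> r; rewrite inE/= in_itv/= => srt; rewrite -hgam.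
move=> x; apply: cvgD; first exact: cvg_cst.
exact: parameterized_integral_continuous.
Qed.

Lemma char_dist s t r gam gam' : s <= r -> r <= t -> leb.-integrable `[s, t] (EFin \o l) ->
  characteristic V s t gam -> characteristic V s t gam' ->
  `|(gam r - gam' r) - (gam s - gam' s)| <= \int[leb]_(x in `[s, r]) (l x * `|gam x - gam' x|).
Proof.
move=> sr rt il [mgam hgam] [mgam' hgam'].
have sub : `[s, r]%classic `<=` `[s, t]%classic by apply: subset_itvl; rewrite bnd_simp.
have i1 : leb.-integrable `[s, r] (EFin \o (fun x => V x (gam x))).
  by apply: integrableS (iV_comp mgam il).
have i2 : leb.-integrable `[s, r] (EFin \o (fun x => V x (gam' x))).
  by apply: integrableS (iV_comp mgam' il).
rewrite (hgam r) ?sr// (hgam' r) ?sr//.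
rewrite (_ : _ - _ - _ = \int[leb]_(x in `[s, r]) V x (gam x) - \int[leb]_(x in `[s, r]) V x (gam' x)); last by ring.
rewrite -(RintegralB (mitv _) i1 i2).
have [B hB] : exists B : R, forall x, s <= x <= r -> `|gam x - gam' x| <= B.
  have c1 := char_continuous (le_trans sr rt) il (conj mgam hgam).
  have c2 := char_continuous (le_trans sr rt) il (conj mgam' hgam').
  have cd : {within `[s, t], continuous (fun x => gam x - gam' x)}.
    by move=> x; apply: cvgB; [exact: c1|exact: c2].
  have cn : {within `[s, t], continuous (fun x => `|gam x - gam' x|)}.
    by move=> x; apply: cvg_norm; exact: cd.
  have [c _ hc] := EVT_max (le_trans sr rt) cn.
  by exists `|gam c - gam' c| => x /andP[sx xr]; apply: hc; rewrite in_itv/= sx (le_trans xr).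
have il' : leb.-integrable `[s, r] (EFin \o l) by apply: integrableS il.
apply: (normr_Rintegral_le (mitv _)).
- by apply: measurable_funTS; apply: measurable_funB; exact: mV_comp.
- by move=> x _; exact: VL.
- apply: (RintegrableMr (mitv _) il' (k := B)).
    by apply: measurable_funTS; apply: measurableT_comp => //; exact: measurable_funB.
  by move=> x; rewrite /= in_itv/= => /hB; rewrite normr_id.
Qed.

Lemma char_bounded s t gam gam' : s <= t -> leb.-integrable `[s, t] (EFin \o l) ->
  characteristic V s t gam -> characteristic V s t gam' ->
  exists2 B : R, 0 <= B & forall x, s <= x <= t -> `|gam x - gam' x| <= B.
Proof.
move=> st il ch ch'.
have c1 := char_continuous st il ch; have c2 := char_continuous st il ch'.
have cd : {within `[s, t], continuous (fun x => gam x - gam' x)}.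
  by move=> x; apply: cvgB; [exact: c1|exact: c2].
have cn : {within `[s, t], continuous (fun x => `|gam x - gam' x|)}.
  by move=> x; apply: cvg_norm; exact: cd.
have [c _ hc] := EVT_max st cn.
by exists `|gam c - gam' c| => // x xst; apply: hc; rewrite in_itv/=.
Qed.

(** Gronwall's inequality with the weight of [exp_weight], as [l] may be unbounded. *)
Lemma char_stable s t : s <= t -> leb.-integrable `[s, t] (EFin \o l) ->
  exists2 C : R, 0 <= C & forall gam gam', characteristic V s t gam -> characteristic V s t gam' ->
    `|gam t - gam' t| <= C * `|gam s - gam' s|.
Proof.
move=> st il; have [M [M0 hM]] := exp_weight vel_l0 il.
exists (2 * expR (M * (t - s))); first by rewrite mulr_ge0// expR_ge0.
move=> gam gam' ch ch'.
have [B B0 hB] := char_bounded st il ch ch'.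
have -> : 2 * expR (M * (t - s)) * `|gam s - gam' s| = 2 * `|gam s - gam' s| * expR (M * (t - s)) by ring.
apply: (@gronwall_iteration R (fun r => s <= r <= t) (fun r => `|gam r - gam' r|) (fun r => expR (M * (r - s))) B) => //.
- by move=> r /andP[sr _]; rewrite -expR0 ler_expR pmulr_rge0// subr_ge0.
- move=> K K0 hK r /andP[sr rt].
  have sub : `[s, r]%classic `<=` `[s, t]%classic by apply: subset_itvl; rewrite bnd_simp.
  have ilr : leb.-integrable `[s, r] (EFin \o l) by apply: integrableS il.
  have mexp : measurable_fun setT ((fun x => expR (M * x)) : mR -> R).
    apply: continuous_measurable_fun => x; apply: continuous_comp; last exact: continuous_expR.
    by apply: cvgM; [exact: cvg_cst|exact: cvg_id].
  have ile : leb.-integrable `[s, r] (EFin \o (fun x => l x * expR (M * x))).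
    apply: (RintegrableMr (mitv _) ilr (k := expR (M * r))); first exact: measurable_funTS.
    by move=> x; rewrite /= in_itv/= => /andP[_ xt]; rewrite ger0_norm ?expR_ge0// ler_expR ler_pM2l.
  have h1 := char_dist sr rt il ch ch'.
  have [mgam _] := ch; have [mgam' _] := ch'.
  have ild : leb.-integrable `[s, r] (EFin \o (fun x => l x * `|gam x - gam' x|)).
    apply: (RintegrableMr (mitv _) ilr (k := B)).
      by apply: measurable_funTS; apply: measurableT_comp => //; exact: measurable_funB.
    by move=> x; rewrite /= in_itv/= => /andP[sx xr]; rewrite normr_id; apply: hB; rewrite sx (le_trans xr).
  have h2 : \int[leb]_(x in `[s, r]) (l x * `|gam x - gam' x|) <= K * expR (M * (r - s)) / 2.
    apply: (@le_trans _ _ (\int[leb]_(x in `[s, r]) (K * expR (- (M * s)) * (l x * expR (M * x))))).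
      apply: (le_Rintegral (mitv _) ild (RintegrableZl _ (mitv _) ile)) => x.
      rewrite /= in_itv/= => /andP[sx xr].
      have sxt : s <= x <= t by rewrite sx (le_trans xr).
      rewrite mulrCA ler_wpM2l ?vel_l0//; apply: le_trans (hK x sxt) _.
      by rewrite -mulrA -expRD mulrBr addrC.
    rewrite (RintegralZl _ (mitv _) ile).
    apply: (@le_trans _ _ (K * expR (- (M * s)) * (expR (M * r) / 2))).
      by rewrite ler_wpM2l ?mulr_ge0 ?expR_ge0//; exact: hM.
    by rewrite !mulrA -(mulrA K) -expRD mulrBr [- _ + _]addrC.
  have E1 : 1 <= expR (M * (r - s)) by rewrite -expR0 ler_expR pmulr_rge0// subr_ge0.
  have h3 : `|gam r - gam' r| <= `|gam s - gam' s| + `|gam r - gam' r - (gam s - gam' s)|.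
    by rewrite -{1}(subrK (gam s - gam' s) (gam r - gam' r)) addrC; exact: ler_normD.
  apply: le_trans h3 _.
  have h4 := le_trans h1 h2; have h5 : `|gam s - gam' s| <= `|gam s - gam' s| * expR (M * (r - s)) by rewrite ler_peMr.
  by move: h4 h5; rewrite mulrDl [K / 2 * _]mulrAC; move=> h4 h5; rewrite lerD.
- by rewrite st lexx.
Qed.

(** If the order were reversed at [t], the curves would meet by continuity, and from the meeting
    time on they would coincide by stability. *)
Lemma char_mono s t gam gam' : s <= t -> leb.-integrable `[s, t] (EFin \o l) ->
  characteristic V s t gam -> characteristic V s t gam' ->
  gam s <= gam' s -> gam t <= gam' t.
Proof.
move=> st il ch ch' hs; rewrite leNgt; apply/negP => ht.
have c1 := char_continuous st il ch; have c2 := char_continuous st il ch'.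
have cd : {within `[s, t], continuous (fun x => gam x - gam' x)}.
  by move=> x; apply: cvgB; [exact: c1|exact: c2].
have := @IVT R (fun x => gam x - gam' x) s t 0 st cd; case.
  by rewrite ge_min subr_le0 hs/= le_max !subr_ge0 (ltW ht) orbT.
move=> r; rewrite in_itv/= => /andP[sr rt] /eqP; rewrite subr_eq0 => /eqP hr.
have ilr : leb.-integrable `[r, t] (EFin \o l).
  by apply: integrableS il => //; apply: subset_itvr; rewrite bnd_simp.
have [C _ hC] := char_stable rt ilr.
have := hC _ _ (char_subl sr rt il ch) (char_subl sr rt il ch').
rewrite hr subrr normr0 mulr0 normr_le0 subr_eq0 => /eqP e.
by move: ht; rewrite e ltxx.
Qed.

Lemma char_shift s t gam : (forall t, periodic2pi (V t)) -> characteristic V s t gam ->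
  forall k : int, characteristic V s t (fun x => gam x + 2 * pi * k%:~R).
Proof.
move=> pV [mgam hgam] k; split; first exact: measurable_funD.
move=> r srt; rewrite (hgam r srt) addrAC; congr (_ + _).
by apply: eq_RintegralL => x _; rewrite (periodic_int k _ (pV x)).
Qed.

Lemma char_unique s t gam gam' : s <= t -> leb.-integrable `[s, t] (EFin \o l) ->
  characteristic V s t gam -> characteristic V s t gam' -> gam s = gam' s -> gam t = gam' t.
Proof.
move=> st il ch ch' h; have [C _ hC] := char_stable st il.
have := hC _ _ ch ch'; rewrite h subrr normr0 mulr0 normr_le0 subr_eq0 => /eqP; exact.
Qed.

(** The time-[t] map is continuous and differs from the identity by at most the integral of [l], so
    the intermediate value theorem applies. *)
Lemma char_surj s t z : s <= t -> leb.-integrable `[s, t] (EFin \o l) ->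
  exists2 gam, characteristic V s t gam & gam t = z.
Proof.
move=> st il; have [Phi hPhi] := flow_exists st il; have [C C0 hC] := char_stable st il.
pose L := \int[leb]_(x in `[s, t]) l x.
have L0 : 0 <= L by apply: Rintegral_ge0 => x _; exact: vel_l0.
have near q : `|Phi q t - q| <= L.
  have [[mP hP] Ps] := hPhi q; rewrite (hP t) ?st ?lexx// Ps addrAC subrr add0r.
  apply: (normr_Rintegral_le (mitv _) _ _ il) => [|x _]; last exact: Vl.
  by apply: measurable_funTS; exact: mV_comp.
have cP : continuous (fun q => Phi q t).
  move=> q; apply/cvgrPdist_le => eps eps0.
  have C1 : 0 < C + 1 by rewrite ltr_wpDl.
  near=> p.
  have [ch Ps] := hPhi q; have [ch' Ps'] := hPhi p.
  have := hC _ _ ch ch'; rewrite Ps Ps' => h; apply: le_trans h _.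
  apply: (@le_trans _ _ ((C + 1) * `|q - p|)); first by rewrite ler_wpM2r// lerDl.
  rewrite mulrC -ler_pdivlMr//.
  near: p; apply: cvgr_dist_le; [exact: cvg_id|exact: divr_gt0].
have zL : z - L <= z + L by rewrite lerD2l; lra.
have := @IVT R (fun q => Phi q t) (z - L) (z + L) z zL (continuous_subspaceT cP); case.
  have := near (z - L); have := near (z + L); rewrite !ler_norml => /andP[h1 _] /andP[_ h2].
  rewrite ge_min le_max; apply/andP; split; apply/orP; [left|right]; lra.
move=> q _ hq; exists (Phi q) => //; by have [] := hPhi q.
Unshelve. all: by end_near. Qed.

(** Gronwall backwards in time: this is the Lipschitz bound for the inverse of the flow map. The
    constant bound [L] makes the factor explicit. *)
Lemma char_lower s t (L : R) : s <= t -> 0 < L -> leb.-integrable `[s, t] (EFin \o l) -> (forall x, s <= x <= t -> l x <= L) ->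
  forall gam gam', characteristic V s t gam -> characteristic V s t gam' ->
    `|gam s - gam' s| <= 2 * expR (2 * L * (t - s)) * `|gam t - gam' t|.
Proof.
move=> st L0 il lL gam gam' ch ch'.
have [B B0 hB] := char_bounded st il ch ch'.
have -> : 2 * expR (2 * L * (t - s)) * `|gam t - gam' t| = 2 * `|gam t - gam' t| * expR (2 * L * (t - s)) by ring.
have L2 : 0 < 2 * L by rewrite mulr_gt0.
(* The rate [2 * L] yields the factor 1/2 of the iteration: the integral of
   [L * expR (2 * L * (t - x))] over [r, t] is at most half of [expR (2 * L * (t - r))]. *)
apply: (@gronwall_iteration R (fun r => s <= r <= t) (fun r => `|gam r - gam' r|) (fun r => expR (2 * L * (t - r))) B) => //.
- by move=> r /andP[_ rt]; rewrite -[X in X <= _]expR0 ler_expR; apply: mulr_ge0; [exact: ltW|rewrite subr_ge0].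
- move=> K K0 hK r /andP[sr rt].
  have ilr : leb.-integrable `[r, t] (EFin \o l).
    by apply: integrableS il => //; apply: subset_itvr; rewrite bnd_simp.
  have h1 := char_dist rt (lexx t) ilr (char_subl sr rt il ch) (char_subl sr rt il ch').
  have [mgam _] := ch; have [mgam' _] := ch'.
  have ild : leb.-integrable `[r, t] (EFin \o (fun x => l x * `|gam x - gam' x|)).
    apply: (RintegrableMr (mitv _) ilr (k := B)).
      by apply: measurable_funTS; apply: measurableT_comp => //; exact: measurable_funB.
    by move=> x; rewrite /= in_itv/= => /andP[rx xt]; rewrite normr_id; apply: hB; rewrite (le_trans sr).
  have cexp : continuous (fun x => expR (- (2 * L) * x)).
    move=> x; apply: continuous_comp; last exact: continuous_expR.
    by apply: cvgM; [exact: cvg_cst|exact: cvg_id].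
  have iexp := continuous_Rintegrable r t cexp.
  have h2 : \int[leb]_(x in `[r, t]) (l x * `|gam x - gam' x|) <= K * expR (2 * L * (t - r)) / 2.
    apply: (@le_trans _ _ (\int[leb]_(x in `[r, t]) (L * K * expR (2 * L * t) * expR (- (2 * L) * x)))).
      apply: (le_Rintegral (mitv _) ild (RintegrableZl _ (mitv _) iexp)) => x.
      rewrite /= in_itv/= => /andP[rx xt].
      have sxt : s <= x <= t by rewrite xt (le_trans sr).
      rewrite -!mulrA ler_pM ?vel_l0//; first exact: lL.
      apply: le_trans (hK x sxt) _; rewrite ler_wpM2l// -expRD ler_expR.
      by rewrite le_eqVlt; apply/orP; left; apply/eqP; ring.
    rewrite (RintegralZl _ (mitv _) iexp) Rintegral_expRM ?oppr_eq0 ?gt_eqF//.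
    have e1 : expR (2 * L * (t - r)) = expR (2 * L * t) * expR (- (2 * L) * r) by rewrite -expRD; congr expR; ring.
    have e2 : expR (2 * L * t) * expR (- (2 * L) * t) = 1 by rewrite -expRD mulNr subrr expR0.
    have -> : L * K * expR (2 * L * t) * ((expR (- (2 * L) * t) - expR (- (2 * L) * r)) / - (2 * L)) =
       K / 2 * (expR (2 * L * t) * expR (- (2 * L) * r) - expR (2 * L * t) * expR (- (2 * L) * t)).
      by field; rewrite gt_eqF.
    rewrite e2 -e1 mulrBr mulr1; have : 0 <= K / 2 by rewrite divr_ge0.
    rewrite [K * _ / 2]mulrAC; lra.
  have E1 : 1 <= expR (2 * L * (t - r)) by rewrite -[X in X <= _]expR0 ler_expR; apply: mulr_ge0; [exact: ltW|rewrite subr_ge0].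
  have h3 : `|gam r - gam' r| <= `|gam t - gam' t| + `|gam t - gam' t - (gam r - gam' r)|.
    rewrite -{1}(subKr (gam t - gam' t) (gam r - gam' r)); exact: ler_normB.
  apply: le_trans h3 _.
  have h4 := le_trans h1 h2; have h5 : `|gam t - gam' t| <= `|gam t - gam' t| * expR (2 * L * (t - r)) by rewrite ler_peMr.
  by rewrite mulrDl lerD// (mulrAC K 2^-1).
- by rewrite st lexx.
Qed.
End velocity.
End flows.

(** * Nonnegativity of transported densities *)

Section nonnegativity.
Context {R : realType}.
Local Notation leb := (@lebesgue_measure R).
Local Notation mR := (measurableTypeR R).

(** Lebesgue differentiation along right increments. A sequence is enough to pass from primitives to
    densities, for signs as for equality, and its upper limit stays measurable in parameters. *)
Lemma ftc_seq (f : R -> R) : leb.-integrable setT (EFin \o f) ->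
  {ae leb, forall x : mR, (fun n : nat => n.+1%:R * (\int[leb]_(u in `]-oo, x + n.+1%:R^-1]) f u - \int[leb]_(u in `]-oo, x]) f u)) @ \oo --> f x}.
Proof.
move=> fi.
have ifN y : leb.-integrable `]-oo, y] (EFin \o f).
  by apply: integrableS fi => //; exact: (mitv _).
have lf := open_integrable_locally openT fi.
have := FTC1Ny ifN lf; apply: filterS; first exact: (ae_filter_ringOfSetsType leb).
move=> x [dF Fx].
set F := (fun y => \int[leb]_(u in `]-oo, y]) f u) in dF Fx *.
have /cvg_ex [a ha] := dF.
have E : a = f x.
  rewrite -Fx derive1E /derive; apply/esym/cvg_lim => //; exact: Rhausdorff.
rewrite E in ha.
have cn : (fun n : nat => (n.+1%:R^-1 : R)) @ \oo --> (0 : R)^'.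
  move=> P /= hP; have := @cvg_harmonic R _ hP; apply: (@filterS _ \oo) => n /=; apply.
  by rewrite /harmonic/= invr_eq0 pnatr_eq0.
have := cvg_comp _ _ cn ha; rewrite /comp/=.
under eq_fun do rewrite invrK /GRing.scale/= mulr1 [_ + x]addrC.
exact.
Qed.

Lemma integrable_closed_left (f : R -> R) (a b : R) : leb.-integrable `]a, b] (EFin \o f) ->
  leb.-integrable `[a, b] (EFin \o f).
Proof.
move=> /integrableP [mf fi]; apply/integrableP; split.
  by apply/emeasurable_fun_itv_obnd_cbndP; exact: mf.
by rewrite -integral_itv_obnd_cbnd//; apply: measurableT_comp.
Qed.

Lemma winding_lt (z u : R) : circle u -> 0 <= z <= 2 * pi -> winding z u = - (u < z)%R%:R.
Proof.
have p0 : 0 < 2 * pi :> R by rewrite mulr_gt0// pi_gt0.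
rewrite /circle/= in_itv/= /winding => /andP[u0 u1] /andP[z0 z1].
case: ltP => uz.
  rewrite (_ : Num.floor _ = -1) ?mulrN1z//; apply: floor_def.
  by rewrite addNr ler_pdivlMr// ltr_pdivrMr//; apply/andP; split; lra.
rewrite (_ : Num.floor _ = 0) ?oppr0//; apply: floor_def.
by rewrite add0r ler_pdivlMr// ltr_pdivrMr//; apply/andP; split; lra.
Qed.

Lemma winding_addi (z u : R) (k : int) : winding (z + 2 * pi * k%:~R) u = winding z u - k%:~R.
Proof.
have p0 : 2 * pi != 0 :> R by rewrite gt_eqF// mulr_gt0// pi_gt0.
rewrite /winding (_ : (u - _) / _ = (u - z) / (2 * pi) + (- k)%:~R); last first.
  by rewrite mulrNz opprD addrA mulrBl (mulrAC (2 * pi)) mulfV// mul1r.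
by rewrite Num.Theory.floorDrz ?intr_int// intrKfloor rmorphD/= mulrNz.
Qed.

Lemma winding_diff (z z' u : R) : z' <= z -> z <= z' + 2 * pi -> 0 <= winding z' u - winding z u <= 1.
Proof.
have p0 : 0 < 2 * pi :> R by rewrite mulr_gt0// pi_gt0.
have mono (a b : R) : a <= b -> winding b u <= winding a u.
  by move=> ab; rewrite ler_int le_floor// ler_wpM2r ?invr_ge0 ?(ltW p0)// lerD2l lerN2.
move=> zz zz'; rewrite subr_ge0 mono//= lerBlDr -lerBlDl.
have := mono _ _ zz'; have := winding_addi z' u 1; rewrite mulr1 => -> h.
by rewrite lerBlDl addrC -lerBlDr.
Qed.

Lemma integral_nondecreasing_ae (f : R -> R) : leb.-integrable setT (EFin \o f) ->
  (forall x y, x <= y -> \int[leb]_(u in `]-oo, x]) f u <= \int[leb]_(u in `]-oo, y]) f u) ->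
  {ae leb, forall x : mR, 0 <= f x}.
Proof.
move=> fi mono; have := ftc_seq fi; apply: filterS => x hx.
rewrite -(cvg_lim (@Rhausdorff R) hx); apply: limr_ge.
  by apply/cvg_ex; exists (f x); exact: hx.
by near=> n; rewrite mulr_ge0// subr_ge0 mono// lerDl invr_ge0.
Unshelve. all: by end_near. Qed.

Lemma integral_inj_ae (f g : R -> R) : leb.-integrable setT (EFin \o f) -> leb.-integrable setT (EFin \o g) ->
  (forall x, \int[leb]_(u in `]-oo, x]) f u = \int[leb]_(u in `]-oo, x]) g u) ->
  {ae leb, forall x : mR, f x = g x}.
Proof.
move=> fi gi E; have := ftc_seq gi; have := ftc_seq fi; apply: filterS2 => x hf hg.
rewrite -(cvg_lim (@Rhausdorff R) hf) -(cvg_lim (@Rhausdorff R) hg).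
by under eq_fun do rewrite !E.
Qed.

Section transport.
Variables (T : R) (rho V : R -> R -> R) (l : R -> R).
Hypothesis tr : transport T rho V l.
Hypothesis treq : transport_eq T rho V.
Notation tmass := (@tmass R rho).
Notation cdf := (@cdf R rho).

Lemma cdf_lt t z : 0 <= t <= T -> 0 <= z <= 2 * pi -> cdf t z = \int[leb]_u (rho t u * (u < z)%R%:R).
Proof.
move=> tT zp; have [B hB] := winding_bound z.
rewrite /cdf -mulN1r -(RintegralZl _ measurableT (tr_icirc tr tT (measurable_winding z) hB)).
apply: eq_RintegralL => u _; have [cu|cu] := pselect (circle u).
  by rewrite (winding_lt cu zp) mulrN mulN1r opprK.
by rewrite (tr_circle tr) ?mul0r ?mulr0.
Qed.

Lemma cdf0 t : 0 <= t <= T -> cdf t 0 = 0.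
Proof.
move=> tT; rewrite cdf_lt//; last by rewrite lexx mulr_ge0// pi_ge0.
rewrite (@eq_RintegralL _ _ _ (cst 0)) ?Rintegral_cst ?mul0r// => u _.
have [cu|cu] := pselect (circle u); last by rewrite (tr_circle tr) ?mul0r.
by move: cu; rewrite /circle/= in_itv/= => /andP[u0 _]; rewrite ltNge u0 mulr0.
Qed.

Lemma iwinding t z : 0 <= t <= T -> leb.-integrable setT (EFin \o (fun u => rho t u * winding z u)).
Proof.
by move=> tT; have [B hB] := winding_bound z; exact: (tr_icirc tr tT (measurable_winding z) hB).
Qed.

Lemma cdf_addi t z (k : int) : 0 <= t <= T ->
  cdf t (z + 2 * pi * k%:~R) = cdf t z + k%:~R * \int[leb]_u rho t u.
Proof.
move=> tT; rewrite /cdf -(RintegralZl _ measurableT (tr_irho tr tT)).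
apply/eqP; rewrite eqr_oppLR opprD opprK; apply/eqP.
rewrite -(RintegralB measurableT (iwinding z tT) (RintegrableZl _ measurableT (tr_irho tr tT))).
by apply: eq_RintegralL => u _; rewrite winding_addi; ring.
Qed.

Lemma cdf_osc t z z' : 0 <= t <= T -> z' <= z -> z <= z' + 2 * pi -> `|cdf t z - cdf t z'| <= tmass t.
Proof.
move=> tT zz zz'; rewrite /cdf opprK addrC.
rewrite -(RintegralB measurableT (iwinding z' tT) (iwinding z tT)).
apply: normr_Rintegral_le => //.
- by apply: measurable_funB; apply: measurable_funM; (exact: (tr_mrho1 tr) || exact: measurable_winding).
- move=> u _; rewrite -mulrBr normrM ler_piMr//.
  by have /andP[h1 h2] := winding_diff u zz zz'; rewrite ger0_norm.
- exact: (integrable_norm (tr_irho tr tT)).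
Qed.

(** If all smooth tests gave zero, so would their limits, the sawtooth integrals at [a] and [b], and
    so would the total mass; [Rintegral_wrap_cdf] then equates the two values of [cdf]. *)
Lemma cdf_neq_test t a b : 0 <= t <= T -> cdf t a != cdf t b ->
  exists f f' : R -> R, [/\ forall x : R, is_derive x (1 : R) f (f' x), continuous f', periodic2pi f, periodic2pi f' &
    \int[leb]_u (rho t u * f u) != 0].
Proof.
move=> tT; apply: contraNP => hn.
have E (f f' : R -> R) : (forall x : R, is_derive x (1 : R) f (f' x)) -> continuous f' ->
    periodic2pi f -> periodic2pi f' -> \int[leb]_u (rho t u * f u) = 0.
  by move=> df cf' pf pf'; apply/eqP; apply: contrapT => /negP h; apply: hn; exists f, f'.
have q01 n : 0 <= (qn n : R) < 1 by have /andP[h1 h2] := @qn_itv R n; apply/andP; split; [lra|].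
have S z : \int[leb]_u (rho t u * ((pi - wrap (u - z)) / 2)) = 0.
  rewrite -(cvg_lim (@Rhausdorff R) (@cvg_Rintegral_saw _ _ _ _ _ tr t z tT)); apply/cvg_lim; first exact: Rhausdorff.
  rewrite [X in X @ _](_ : _ = cst 0); first exact: cvg_cst.
  apply/funext => n; apply: (E (fun u : R => saw (qn n) (u - z)) (fun u : R => saw1 (qn n) (u - z))).
  - exact: (is_derive_shiftl z (fun x => is_derive_saw x (q01 n))).
  - exact: (continuous_shiftl (dR_continuous (fun x => is_derive_saw1 x (q01 n)))).
  - exact: (@periodic_shift _ _ z (saw_periodic (qn n))).
  - exact: (@periodic_shift _ _ z (saw1_periodic (qn n))).
have := S b; have := S a; rewrite !(@Rintegral_wrap_cdf _ _ _ _ _ tr _ _ tT).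
have -> : \int[leb]_u rho t u = 0.
  rewrite -(E (cst 1) (cst 0)) //; first by apply: eq_RintegralL => u _; rewrite mulr1.
  exact: cst_continuous.
rewrite !mulr0 => h1 h2; have : pi * cdf t a = pi * cdf t b by lra.
by move=> /mulfI -> //; rewrite gt_eqF// pi_gt0.
Qed.

Lemma tmass_lower s (f : R -> R) : 0 <= s <= T -> continuous f -> periodic2pi f ->
  \int[leb]_u (rho s u * f u) != 0 ->
  exists2 d : R, 0 < d & \forall e \near 0^'+, forall r, 0 <= r <= T -> `|r - s| <= e -> d <= tmass r.
Proof.
move=> sT cf pf fn0.
have [B B0 hB] := periodic_bounded cf pf.
pose c := `|\int[leb]_u (rho s u * f u)|.
have c0 : 0 < c by rewrite normr_gt0.
exists (c / 2 / B); first by rewrite !divr_gt0.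
have T0 : 0 <= T by case/andP: sT; exact: le_trans.
have := clamp_comp_continuous T0 (tr_cont tr cf pf) => /(_ s).
move=> /cvgrPdist_le /(_ (c / 2)); rewrite divr_gt0// => /(_ isT).
move=> /nbhs_ballP[e /= e0 he].
near=> e'.
move=> r rT re; have /he : ball s e r.
  by rewrite /ball/= distrC (le_lt_trans re).
rewrite /= !clamp_id// => h.
have mf : measurable_fun setT (f : mR -> R) by exact: continuous_measurable_fun.
have := tr_bound tr rT mf hB; rewrite ler_pdivrMr// => h'; apply: le_trans h'.
have := ler_normD (\int[leb]_u (rho s u * f u) - \int[leb]_u (rho r u * f u)) (\int[leb]_u (rho r u * f u)).
rewrite subrK -/c => h1; have := le_trans h1 (lerD h (lexx _)).
rewrite -lerBlDl; apply: le_trans.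
by rewrite (_ : c - c / 2 = c / 2)//; field.
Unshelve. all: by end_near. Qed.

(** Where the mass is at least [d], mass times [l] controls [l]. The left end point is left out
    because at an infimum of times the bound is known only to its right. *)
Lemma integrable_speed_near a b d : 0 <= a -> b <= T -> 0 < d ->
  (forall r, a < r <= b -> d <= tmass r) -> leb.-integrable `[a, b] (EFin \o l).
Proof.
move=> a0 bT d0 hd; apply: integrable_closed_left.
apply: (@Rintegrable_le _ _ _ leb _ _ (fun r => tmass r * l r * d^-1)); first exact: mitv.
- by apply: measurable_funTS; exact: (tr_ml tr).
- move=> r; rewrite /= in_itv/= => rab; rewrite ger0_norm ?(tr_l0 tr)//.
  by rewrite ler_pdivlMr// mulrC ler_wpM2r ?(tr_l0 tr)// hd.
- apply: RintegrableZr; first exact: mitv.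
  by apply: integrableS (tr_Nl tr); [exact: mitv|exact: mitv|apply: subset_itv; rewrite bnd_simp].
Qed.

(** Traced back to time [s], the characteristics are still at most one turn apart, and over one turn
    [cdf s] oscillates by no more than the mass. The difference of [cdf] between them is the same at
    both times. *)
Lemma tmass_char s t gam gam' : 0 <= s -> s <= t -> t <= T -> leb.-integrable `[s, t] (EFin \o l) ->
  characteristic V s t gam -> characteristic V s t gam' ->
  gam' t <= gam t -> gam t < gam' t + 2 * pi -> `|cdf t (gam t) - cdf t (gam' t)| <= tmass s.
Proof.
move=> s0 st tT il ch ch' h1 h2.
have sT : 0 <= s <= T by rewrite s0 (le_trans st).
have [K hK] := cdf_characteristic tr treq s0 st tT il.
rewrite (hK _ ch) (hK _ ch') opprD addrACA subrr addr0.
have mono := char_mono (tr_mV tr) (tr_V tr) (tr_VL tr) st il.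
have rev x y : characteristic V s t x -> characteristic V s t y -> x t < y t -> x s <= y s.
  by move=> cx cy xy; rewrite leNgt; apply/negP => /ltW /(mono _ _ cy cx); rewrite leNgt xy.
have shift1 := char_shift (tr_pV tr) ch' 1.
have h3 : gam s <= gam' s + 2 * pi by have := rev _ _ ch shift1; rewrite mulr1; exact.
(* [rev] traces back a strict order only; equal end points give equal values of [cdf]. *)
move: h1; rewrite le_eqVlt => /predU1P[e|h1]; last by apply: cdf_osc => //; exact: rev.
have : cdf t (gam t) = cdf t (gam' t) by rewrite e.
by rewrite (hK _ ch) (hK _ ch') => /addIr ->; rewrite subrr normr0; exact: tmass_ge0.
Qed.

(* As long as [l] is integrable on [[s, t]], the characteristics through [0] and
   [z] bound the mass at time [s] from below by [`|cdf t z|]; since mass times [l]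
   is integrable, so is [l], and the interval can be extended down to [0]. *)
Lemma integrable_speed t z : 0 <= t <= T -> 0 <= z <= 2 * pi -> cdf t z != 0 ->
  leb.-integrable `[0, t] (EFin \o l).
Proof.
move=> tT; have /andP[t0 tT'] := tT; move=> /andP[z0 z1] cz.
pose d := `|cdf t z|; have d0 : 0 < d by rewrite normr_gt0.
pose E := [set s : R | 0 <= s <= t /\ leb.-integrable `[s, t] (EFin \o l)].
have mono (s s' : R) : s <= s' -> 0 <= s -> s' <= t -> leb.-integrable `[s, t] (EFin \o l) -> E s'.
  move=> ss' s0 s't il; split; first by rewrite (le_trans s0 ss').
  by apply: integrableS il; [exact: mitv|exact: mitv|apply: subset_itvr; rewrite bnd_simp].
have Em s : E s -> d <= tmass s.
  move=> [/andP[s0 st] il].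
  have sT : 0 <= s <= T by rewrite s0 (le_trans st).
  (* At [z = 2 * pi] the end points are a full turn apart, which [tmass_char] excludes; there
     [cdf t z] is the conserved total mass. *)
  move: z1; rewrite /d le_eqVlt => /predU1P[->|z1].
    have := cdf_addi 0 1 tT; rewrite add0r mulr1 cdf0// add0r mul1r => ->.
    rewrite (mass_conserved treq s0 st tT').
    by apply: le_normr_Rintegral => //; exact: (tr_irho tr).
  have [gam ch gt] := char_surj (tr_mV tr) (tr_V tr) (tr_VL tr) z st il.
  have [gam' ch' gt'] := char_surj (tr_mV tr) (tr_V tr) (tr_VL tr) 0 st il.
  have := tmass_char s0 st tT' il ch ch'; rewrite gt gt' cdf0// subr0 add0r.
  exact.
have Et : E t.
  split; first by rewrite t0 lexx.
  (* The interval open on the left is empty here, so any positive bound will do. *)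
  apply: (integrable_speed_near t0 tT' ltr01) => r /andP[r1 r2].
  by have := lt_le_trans r1 r2; rewrite ltxx.
have hE : has_inf E by split; [exists t|exists 0 => s [/andP[]]].
pose s1 := inf E.
have s10 : 0 <= s1 by apply: lb_le_inf; [exists t|move=> s [/andP[]]].
have s1t : s1 <= t by apply: ge_inf => //; case: hE.
have Eup s : s1 < s <= t -> E s.
  move=> /andP[s1s st].
  have e0 : 0 < s - s1 by rewrite subr_gt0.
  have [s' [/andP[s'0 s't] is']] := inf_adherent e0 hE.
  by rewrite addrC subrK => s's; exact: mono (ltW s's) s'0 st is'.
have Es1 : E s1.
  split; first by rewrite s10.
  by apply: (integrable_speed_near s10 tT' d0) => r /Eup /Em.
suff : s1 = 0 by move=> <-; case: Es1.
apply/eqP; rewrite eq_le s10 andbT leNgt; apply/negP => s1p.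
have s1T : 0 <= s1 <= T by rewrite s10 (le_trans s1t).
(* At the infimum [s1] the density does not vanish, as [cdf s1] is not constant. A smooth test then
   bounds the mass from below also to the left of [s1], which contradicts the choice of the
   infimum. *)
have [a [b hab]] : exists a b, cdf s1 a != cdf s1 b.
  have [_ il] := Es1.
  move: z1; rewrite le_eqVlt => /predU1P[z2|z1].
    exists (2 * pi), 0; have := cdf_addi 0 1 s1T; rewrite add0r mulr1 cdf0// add0r mul1r => ->.
    rewrite -(mass_conserved treq s10 s1t tT'); move: cz; rewrite z2.
    by have := cdf_addi 0 1 tT; rewrite add0r mulr1 cdf0// add0r mul1r => ->.
  have [gam ch gt] := char_surj (tr_mV tr) (tr_V tr) (tr_VL tr) z s1t il.
  have [gam' ch' gt'] := char_surj (tr_mV tr) (tr_V tr) (tr_VL tr) 0 s1t il.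
  have [K hK] := cdf_characteristic tr treq s10 s1t tT' il.
  exists (gam s1), (gam' s1); apply: contra cz => /eqP h.
  by rewrite -(cdf0 tT) -gt -gt' (hK _ ch) (hK _ ch') h.
have [f [f' [df _ pf _ fn0]]] := cdf_neq_test s1T hab.
have cf := dR_continuous df.
have [d' d'0 hd'] := tmass_lower s1T cf pf fn0.
have [e [e0 es1 he]] : exists e, [/\ 0 < e, e <= s1 & forall r, 0 <= r <= T -> `|r - s1| <= e -> d' <= tmass r].
  near (0 : R)^'+ => e; exists e; split; near: e => //; [exact: nbhs_right_gt|exact: nbhs_right_le].
have s2s1 : s1 - e <= s1 by rewrite lerBlDr lerDl ltW.
have s20 : 0 <= s1 - e by rewrite subr_ge0.
have : E (s1 - e).
  split; first by rewrite s20 (le_trans s2s1).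
  apply: (@integrable_speed_near _ _ (Num.min d d')) => //; first by rewrite lt_min d0.
  move=> r /andP[s2r rt]; have [s1r|rs1] := ltP s1 r.
    by rewrite ge_min Em//; apply: Eup; rewrite s1r.
  rewrite ge_min he ?orbT//; first by rewrite (le_trans s20 (ltW s2r)) (le_trans rt).
  by rewrite ler0_norm ?subr_le0// opprB lerBlDl -lerBlDr ltW.
move=> /(ge_inf (proj2 hE)); rewrite -/s1 lerBrDr gerDl leNgt.
by rewrite e0.
Unshelve. all: by end_near. Qed.

(** Each further turn adds the total mass to [cdf], and this is nonnegative, being the increment
    over the first period. *)
Lemma cdf_mono s : 0 <= s <= T ->
  (forall x y, 0 <= x -> x <= y -> y <= 2 * pi -> cdf s x <= cdf s y) ->
  forall x y, x <= y -> cdf s x <= cdf s y.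
Proof.
move=> sT mono.
have p0 : 0 < 2 * pi :> R by rewrite mulr_gt0// pi_gt0.
pose m := \int[leb]_u rho s u.
have mE : cdf s (2 * pi) = m.
  by have := cdf_addi 0 1 sT; rewrite add0r mulr1 cdf0// add0r mul1r.
have m0 : 0 <= m by rewrite -mE -(cdf0 sT); apply: mono => //; exact: ltW.
pose k (x : R) := Num.floor (x / (2 * pi)).
have E x : cdf s x = cdf s (wrap x) + (k x)%:~R * m.
  by rewrite -cdf_addi// /wrap subrK.
have W (x : R) : 0 <= wrap x < 2 * pi by have := wrap_circle x; rewrite /circle/= in_itv.
move=> x y xy; rewrite (E x) (E y).
have : (k x <= k y)%R by rewrite le_floor// ler_wpM2r// invr_ge0 ltW.
rewrite le_eqVlt => /predU1P[kxy|].
  have wxy : wrap x <= wrap y by rewrite /wrap -!/(k _) kxy lerD2r.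
  rewrite kxy lerD2r mono//; first by have /andP[] := W x.
  by have /andP[_ /ltW] := W y.
rewrite -lezD1 => kxy.
have h1 : cdf s (wrap x) <= m.
  by rewrite -mE; have /andP[w0 /ltW w1] := W x; exact: mono.
have h2 : 0 <= cdf s (wrap y).
  by rewrite -(cdf0 sT); have /andP[w0 /ltW w1] := W y; exact: mono.
have h3 : ((k x)%:~R + 1) * m <= (k y)%:~R * m.
  by rewrite ler_wpM2r//; move: kxy; rewrite -(ler_int R) intrD.
by move: h3; rewrite mulrDl mul1r => h3; lra.
Qed.

Lemma transport_cdf_mono t : 0 <= t <= T ->
  (forall x y, 0 <= x -> x <= y -> y <= 2 * pi -> cdf 0 x <= cdf 0 y) ->
  forall x y, 0 <= x -> x <= y -> y <= 2 * pi -> cdf t x <= cdf t y.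
Proof.
move=> tT mono0 x y x0 xy yp; have /andP[t0 tT'] := tT.
have yI : 0 <= y <= 2 * pi by rewrite yp (le_trans x0).
have xI : 0 <= x <= 2 * pi by rewrite x0 (le_trans xy).
have key : leb.-integrable `[0, t] (EFin \o l) -> cdf t x <= cdf t y.
  move=> il; move: (xy); rewrite le_eqVlt => /predU1P[->//|ltxy].
  have [gam ch gt] := char_surj (tr_mV tr) (tr_V tr) (tr_VL tr) x t0 il.
  have [gam' ch' gt'] := char_surj (tr_mV tr) (tr_V tr) (tr_VL tr) y t0 il.
  have [K hK] := cdf_characteristic tr treq (lexx 0) t0 tT' il.
  rewrite -gt -gt' (hK _ ch) (hK _ ch') lerD2r.
  apply: (cdf_mono _ mono0); first by rewrite lexx (le_trans t0).
  rewrite leNgt; apply/negP => /ltW /(char_mono (tr_mV tr) (tr_V tr) (tr_VL tr) t0 il ch' ch).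
  by rewrite gt gt' leNgt ltxy.
(* A nonzero value at either point makes the speed integrable back to time 0, which [key] needs; if
   both vanish they are equal. *)
have [cx|cx] := eqVneq (cdf t x) 0; last exact: key (integrable_speed tT xI cx).
have [cy|cy] := eqVneq (cdf t y) 0; last exact: key (integrable_speed tT yI cy).
by rewrite cx cy.
Qed.

Lemma primitive_cdf t x : 0 <= t <= T -> \int[leb]_(u in `]-oo, x]) rho t u = cdf t (clamp (2 * pi) x).
Proof.
have p0 : 0 <= 2 * pi :> R by rewrite mulr_ge0// pi_ge0.
move=> tT; rewrite cdf_lt ?clamp_itv// [LHS]Rintegral_mkcond.
have mrho := tr_mrho1 tr t.
apply: ae_eq_Rintegral => //.
- apply/(measurable_restrictT _ (mitv _)); exact: measurable_funTS.
- apply: measurable_funM => //; apply: Rmeasurable_bool; exact: measurable_fun_ltr.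
(* The primitive includes the point [x], the strict inequality in [cdf_lt] does not. *)
exists [set x : mR]; split; [exact: measurable_set1|exact: lebesgue_measure_set1|].
move=> u /= h; apply: contrapT => /eqP ux; apply: h => _.
rewrite patchE mem_setE in_itv/=.
have [cu|cu] := pselect (circle u); last by rewrite (tr_circle tr) ?mul0r//; case: ifP.
move: cu; rewrite /circle/= in_itv/= => /andP[u0 u1].
rewrite /clamp lt_max lt_min u1 andbT [u < 0]ltNge u0/= lt_neqAle ux/=.
by case: ifP; rewrite ?mulr1 ?mulr0.
Qed.

Lemma transport_nonneg t : 0 <= t <= T ->
  (forall x y, 0 <= x -> x <= y -> y <= 2 * pi -> cdf 0 x <= cdf 0 y) ->
  {ae leb, forall u : mR, 0 <= rho t u}.
Proof.
move=> tT mono0; apply: (integral_nondecreasing_ae (tr_irho tr tT)) => x y xy.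
have p0 : 0 <= 2 * pi :> R by rewrite mulr_ge0// pi_ge0.
rewrite !primitive_cdf//; apply: transport_cdf_mono => //.
- by have /andP[] := clamp_itv x p0.
- by rewrite /clamp ge_max !le_max lexx/= le_min !ge_min xy lexx orbT/= orbT.
- by have /andP[] := clamp_itv y p0.
Qed.
End transport.
End nonnegativity.

(** * Densities pushed forward by a flow *)

Section pushforward_finite.
Local Open Scope ereal_scope.
Context d1 d2 (T1 : measurableType d1) (T2 : measurableType d2) (R : realType).
Variables (mu : {finite_measure set T1 -> \bar R}) (X : {mfun T1 >-> T2}).

(** A name for the pushforward on which a finite-measure structure is declared, for use with
    Radon-Nikodym. *)
Definition push : set T2 -> \bar R := pushforward mu X.

Let push0 : push set0 = 0. Proof. exact: measure0. Qed.

Let push_ge0 A : 0 <= push A. Proof. exact: measure_ge0. Qed.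

Let push_sigma_additive : semi_sigma_additive push.
Proof. exact: measure_semi_sigma_additive. Qed.

HB.instance Definition _ := isMeasure.Build _ _ _ push push0 push_ge0 push_sigma_additive.

Let push_finite : fin_num_fun push.
Proof.
move=> A mA; apply: fin_num_measure.
by rewrite -[X in measurable X]setTI; apply: (@measurable_funPT _ _ _ _ X).
Qed.

HB.instance Definition _ := Measure_isFinite.Build _ _ _ push push_finite.
End pushforward_finite.

Section densities.
Context {R : realType}.
Local Notation leb := (@lebesgue_measure R).
Local Notation mR := (measurableTypeR R).

(** The lower bound on [h] puts the preimage of a short interval into an interval at most [2 * c]
    times as long, so a cover of [N] of small total length pulls back to one of its preimage. *)
Lemma null_preimage (h : R -> R) (c : R) (N : set mR) : measurable_fun setT (h : mR -> mR) -> 0 <= c ->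
  (forall u v, `|u - v| <= c * `|h u - h v|) -> measurable N -> leb N = 0%E -> leb (h @^-1` N : set mR) = 0%E.
Proof.
move=> mh c0 hc mN N0.
have mpre (A : set mR) : measurable A -> measurable (h @^-1` A : set mR).
  by move=> mA; rewrite -[X in measurable X]setTI; exact: mh.
have itv (a b : R) : a < b -> (leb (h @^-1` `]a, b] : set mR) <= (2 * c * (b - a))%:E)%E.
  move=> ab; have [/eqP ->|/set0P[u0 hu0]] := boolP (h @^-1` `]a, b] == set0 :> set R).
    by rewrite measure0 lee_fin !mulr_ge0// subr_ge0 ltW.
  pose L := c * (b - a); have L0 : 0 <= L by rewrite mulr_ge0// subr_ge0 ltW.
  apply: (@le_trans _ _ (leb (`[u0 - L, u0 + L]%classic : set mR))).
    apply: le_measure; rewrite ?inE; [by apply: mpre; exact: mitv|exact: mitv|].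
    move=> u hu /=; have : `|u - u0| <= L.
      apply: le_trans (hc _ _) _; rewrite ler_wpM2l//.
      move: hu hu0; rewrite /= !in_itv/= => /andP[h1 h2] /andP[h3 h4].
      by rewrite ler_norml; apply/andP; split; lra.
    by rewrite in_itv/= ler_distl.
  rewrite lebesgue_measure_itv/=; case: ifPn => _; rewrite ?lee_fin.
    by rewrite /L; lra.
  by rewrite !mulr_ge0// subr_ge0 ltW.
have bound (e : R) : 0 < e -> (leb (h @^-1` N : set mR) <= (2 * c * e)%:E)%E.
  move=> e0.
  (* Lebesgue measure unfolds to an infimum over countable covers by half-open intervals. *)
  have /ereal_inf_lt[z [/= M [mM NM] Mz ze]] : (leb N < e%:E)%E by rewrite N0 lte_fin.
  have mM' n : measurable (M n : set mR) by apply: sub_sigma_algebra; exact: mM.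
  apply: (@le_trans _ _ (\sum_(n <oo) leb (h @^-1` M n : set mR))%E).
    apply: measure_sigma_subadditive => [n||].
    - exact: mpre.
    - exact: mpre.
    - by rewrite -preimage_bigcup; exact: preimage_subset.
  apply: (@le_trans _ _ (\sum_(n <oo) ((2 * c)%:E * wlength idfun (M n)))%E).
    apply: lee_nneseries => [n _ _|n _]; first exact: measure_ge0.
    have /ocitvP[->|[[a b] /= ab ->]] : ocitv (M n) by exact: mM.
      by rewrite preimage_set0 measure0 wlength0 mule0.
    by rewrite wlength_itv_bnd ?(ltW ab)//= -EFinM; exact: itv.
  rewrite nneseriesZl => [|n _]; last exact: measure_ge0.
  rewrite (EFinM (2 * c) e); apply: lee_wpmul2l; first by rewrite lee_fin mulr_ge0.
  by rewrite Mz ltW.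
apply/eqP; rewrite eq_le measure_ge0 andbT; apply/lee_addgt0Pr => e e0.
rewrite add0e.
(* Adding 1 avoids a division by 0 when [c = 0]. *)
have c1 : 0 < 2 * c + 1 by rewrite ltr_wpDl// mulr_ge0.
apply: le_trans (bound (e / (2 * c + 1)) _) _; first by rewrite divr_gt0.
by rewrite lee_fin mulrA ler_pdivrMr// mulrC ler_pM2l// lerDl.
Qed.

(** [wrap] translates by one of countably many multiples of [2 * pi], and each translate of [h]
    satisfies the same lower bound. *)
Lemma wrap_null_preimage (h : R -> R) (c : R) (N : set mR) : measurable_fun setT (h : mR -> mR) -> 0 <= c ->
  (forall u v, `|u - v| <= c * `|h u - h v|) -> measurable N -> leb N = 0%E ->
  leb ((wrap \o h) @^-1` N : set mR) = 0%E.
Proof.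
move=> mh c0 hc mN N0.
pose G (k : int) : set mR := (fun u => h u - 2 * pi * k%:~R) @^-1` N.
have mG k : measurable (G k).
  rewrite /G -[X in measurable X]setTI; apply: (_ : measurable_fun setT _) => //.
  exact: measurable_funB.
have G0 k : leb (G k) = 0%E.
  apply: (null_preimage (c := c)) => //; first exact: measurable_funB.
  by move=> u v; rewrite opprD addrACA subrr addr0.
pose F n : set mR := if @unpickle int n is Some k then G k else set0.
have mF n : measurable (F n) by rewrite /F; case: unpickle.
have : leb.-negligible (\bigcup_n F n).
  apply: negligible_bigcup => n; apply/negligibleP => //.
  by rewrite /F; case: unpickle => [k|]; [exact: G0|exact: measure0].
have sub : (wrap \o h) @^-1` N `<=` \bigcup_n F n.
  move=> u hu; have [k hk] : exists k : int, G k u by exists (Num.floor (h u / (2 * pi))).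
  by exists (pickle k); [exact: I|rewrite /F pickleK].
have mpre : measurable ((wrap \o h) @^-1` N : set mR).
  by rewrite -[X in measurable X]setTI; apply: (measurableT_comp measurable_wrap mh).
move=> h0; apply: (subset_measure0 mpre _ sub); last first.
  by apply/negligibleP => //; exact: bigcup_measurable.
exact: bigcup_measurable.
Qed.

Lemma exists_density (K : {finite_measure set mR -> \bar R}) : K `<< leb ->
  exists k : R -> R, [/\ forall u, 0 <= k u, leb.-integrable setT (EFin \o k),
    forall A : set mR, measurable A -> K A = (\int[leb]_(u in A) (k u)%:E)%E &
    forall (f : R -> R) (B : R), measurable_fun setT (f : mR -> R) -> (forall u, `|f u| <= B) ->
      \int[K]_u f u = \int[leb]_u (k u * f u)].
Proof.
move=> Kl; pose g := Radon_Nikodym_SigmaFinite.f K leb.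
have gfin u : (fine (g u))%:E = g u by rewrite fineK//; exact: Radon_Nikodym_SigmaFinite.f_fin_num.
have gE : EFin \o (fine \o g) = g by apply/funext => u /=.
have ig := Radon_Nikodym_SigmaFinite.f_integrable Kl.
exists (fine \o g); split.
- by move=> u; apply: fine_ge0; exact: Radon_Nikodym_SigmaFinite.f_ge0.
- by rewrite gE.
- by move=> A mA; rewrite (Radon_Nikodym_SigmaFinite.f_integral Kl mA); apply: eq_integral => u _ /=; rewrite gfin.
move=> f B mf fB.
have B0 : 0 <= B by apply: le_trans (fB 0).
have mg := RintegrableP measurableT (_ : leb.-integrable setT (EFin \o (fine \o g))); rewrite gE in mg; have {}mg := mg ig.
have iK (c : R) : K.-integrable setT (EFin \o (fun=> c)) by exact: finite_measure_integrable_cst.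
have ifK : K.-integrable setT (EFin \o f) by apply: (@Rintegrable_le _ mR R K setT f (fun=> B)).
(* The change of variables is for nonnegative functions; [f + B] is one, and the contribution of [B]
   is removed in the end. *)
have F0 (u : mR) : (0 <= (f u + B)%:E)%E.
  by rewrite lee_fin -lerBlDr sub0r; have := fB u; rewrite ler_norml => /andP[].
have mF : measurable_fun setT (fun u : mR => (f u + B)%:E).
  by apply/measurable_EFinP; exact: measurable_funD.
have := Radon_Nikodym_SigmaFinite.change_of_variables Kl F0 measurableT mF.
have ig' : leb.-integrable setT (EFin \o (fine \o g)) by rewrite gE.
have ikf := RintegrableMr measurableT ig' mf (fun u _ => fB u).
have ikB := RintegrableZr B measurableT ig'.
move=> /(congr1 fine); rewrite -[RHS]/(\int[K]_u (f u + B)).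
rewrite (RintegralD measurableT ifK (iK B)).
rewrite (_ : fine _ = \int[leb]_u ((fine \o g) u * f u + (fine \o g) u * B)); last first.
  congr fine; apply: eq_integral => u _.
  by rewrite -mulrDr mulrC EFinM /= gfin.
rewrite (RintegralD measurableT ikf ikB).
have -> : \int[leb]_u ((fine \o g) u * B) = \int[K]_u (cst B u).
  rewrite (RintegralZr B measurableT ig') Rintegral_cst// mulrC; congr (B * fine _).
  transitivity (\int[leb]_u g u)%E; first by apply: eq_integral => u _ /=; rewrite gfin.
  by apply/esym; exact: (Radon_Nikodym_SigmaFinite.f_integral Kl measurableT).
by move=> /addIr ->.
Qed.

(** A density at rest is a transport with zero velocity, so that the results on [cdf] apply to
    single densities. *)
Lemma static_transport T (f : R -> R) : leb.-integrable setT (EFin \o f) -> (forall u, ~ circle u -> f u = 0) ->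
  transport T (fun _ => f) (fun _ _ => 0) (fun=> 0).
Proof.
move=> fi fc; have mf := RintegrableP measurableT fi; split => //.
- exact: measurableT_comp mf _.
- by move=> t u; rewrite normr0.
- by move=> t u v; rewrite subrr normr0 mul0r.
- rewrite (_ : EFin \o _ = cst 0%E); first exact: integrable0.
  by apply/funext => t /=; rewrite mulr0.
- by move=> g _ _; apply: continuous_subspaceT; exact: cst_continuous.
Qed.

End densities.

(** * Densities determined by their distribution functions *)

Section density_identification.
Context {R : realType}.
Local Notation leb := (@lebesgue_measure R).
Local Notation mR := (measurableTypeR R).

Lemma exists_circle_density (K : {finite_measure set mR -> \bar R}) : K `<< leb -> K (~` circle) = 0%E ->
  exists k : R -> R, [/\ forall u, 0 <= k u, forall u, ~ circle u -> k u = 0, leb.-integrable setT (EFin \o k),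
    forall A : set mR, measurable A -> K A = (\int[leb]_(u in A) (k u)%:E)%E &
    forall (f : R -> R) (B : R), measurable_fun setT (f : mR -> R) -> (forall u, `|f u| <= B) ->
      \int[K]_u f u = \int[leb]_u (k u * f u)].
Proof.
move=> Kl Kc; have [k [k0 ik kA kf]] := exists_density Kl.
have mk := RintegrableP measurableT ik.
have mkc : measurable_fun setT (k \_ circle : mR -> R).
  by apply/(measurable_restrictT _ mcircle); exact: measurable_funTS.
exists (k \_ circle); split.
- by move=> u; rewrite patchE; case: ifP.
- by move=> u uc; rewrite patchE; case: ifPn => // /set_mem.
- apply: (@Rintegrable_le _ mR R leb setT _ k) => //.
  by move=> u _; rewrite patchE; case: ifP => _; rewrite ?normr0 ?ger0_norm.
- move=> A mA; transitivity (K (A `&` circle)).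
    apply: (etrans (measureDI K mA mcircle)); rewrite [X in (X + _)%E](_ : _ = 0%E) ?add0e//.
    apply: (subset_measure0 (measurableD mA mcircle) (measurableC mcircle) _ Kc).
    by move=> x [].
  rewrite kA; last by apply: measurableI => //; exact: mcircle.
  rewrite integral_mkcondr; apply: eq_integral => u _.
  by rewrite !patchE; case: ifP.
- move=> f B mf fB.
  have mfc : measurable_fun setT (f \_ circle : mR -> R).
    by apply/(measurable_restrictT _ mcircle); exact: measurable_funTS.
  transitivity (\int[K]_u (f \_ circle) u).
    apply: (@ae_eq_Rintegral _ mR R K setT) => //.
    exists (~` circle); split => //; first by apply: measurableC; exact: mcircle.
    move=> u /= h uc; apply: h => _; rewrite patchE mem_set//.
  rewrite (kf _ B mfc); last first.
    move=> u; rewrite patchE; case: ifP => // _; rewrite normr0; exact: le_trans (fB 0).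
  apply: eq_RintegralL => u _; rewrite !patchE; case: ifP => // _; by rewrite mulr0 mul0r.
Qed.

Section static.
Variables (f g : R -> R).
Hypothesis fi : leb.-integrable setT (EFin \o f).
Hypothesis gi : leb.-integrable setT (EFin \o g).
Hypothesis fc : forall u, ~ circle u -> f u = 0.
Hypothesis gc : forall u, ~ circle u -> g u = 0.

Lemma cdf_ae_eq : (forall z, 0 <= z <= 2 * pi -> cdf (fun=> f) 0 z = cdf (fun=> g) 0 z) ->
  {ae leb, forall u : mR, f u = g u}.
Proof.
move=> E; have T0 : 0 <= (0 : R) <= 0 by rewrite lexx.
apply: integral_inj_ae => // x.
rewrite (primitive_cdf (static_transport 0 fi fc) x T0) (primitive_cdf (static_transport 0 gi gc) x T0).
by apply: E; rewrite clamp_itv// mulr_ge0// pi_ge0.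
Qed.

(** [cdf_neq_test] is applied to the difference of the two densities at the points [z] and 0, at the
    second of which its [cdf] vanishes. *)
Lemma cdf_test_eq : (forall h h' : R -> R, (forall x : R, is_derive x (1 : R) h (h' x)) -> continuous h' ->
    periodic2pi h -> periodic2pi h' -> \int[leb]_u (f u * h u) = \int[leb]_u (g u * h u)) ->
  forall z, cdf (fun=> f) 0 z = cdf (fun=> g) 0 z.
Proof.
move=> E z; have T0 : 0 <= (0 : R) <= 0 by rewrite lexx.
pose D u := f u - g u.
have iD : leb.-integrable setT (EFin \o D) by exact: RintegrableB.
have Dc u : ~ circle u -> D u = 0 by move=> uc; rewrite /D fc// gc// subrr.
have tD := static_transport 0 iD Dc.
have tf := static_transport 0 fi fc; have tg := static_transport 0 gi gc.
have cD y : cdf (fun=> D) 0 y = cdf (fun=> f) 0 y - cdf (fun=> g) 0 y.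
  rewrite /cdf opprK addrC -(RintegralB measurableT (iwinding tg y T0) (iwinding tf y T0)).
  rewrite -[LHS]mulN1r -(RintegralZl _ measurableT (iwinding tD y T0)).
  by apply: eq_RintegralL => u _; rewrite /D; ring.
apply/eqP; rewrite -subr_eq0 -cD -(cdf0 tD T0); apply/negPn/negP => /(cdf_neq_test tD T0).
move=> [h [h' [dh ch' ph ph' /negP]]]; apply.
have [B B0 hB] := periodic_bounded (dR_continuous dh) ph.
have mh : measurable_fun setT (h : mR -> R) by apply: continuous_measurable_fun; exact: (dR_continuous dh).
have i1 := RintegrableMr measurableT fi mh (fun u _ => hB u).
have i2 := RintegrableMr measurableT gi mh (fun u _ => hB u).
rewrite (@eq_RintegralL _ _ _ (fun u => f u * h u - g u * h u)) => [|u _]; last by rewrite mulrBl.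
by rewrite (RintegralB measurableT i1 i2) (E _ _ dh ch' ph ph') subrr.
Qed.
End static.

(** A strictly increasing map that commutes with full turns preserves the number of turns between
    two points. *)
Lemma lift_winding (h : R -> R) q u : {homo h : x y / x <= y} -> injective h ->
  (forall x (k : int), h (x + 2 * pi * k%:~R) = h x + 2 * pi * k%:~R) ->
  winding (h q) (h u) = winding q u.
Proof.
have p0 : 0 < 2 * pi :> R by rewrite mulr_gt0// pi_gt0.
move=> hm hi hk; congr (_%:~R); apply: floor_def.
have lt_iff x y : x < y -> h x < h y.
  by move=> xy; rewrite lt_neqAle hm ?(ltW xy)// andbT; apply: contraTneq xy => /hi ->; rewrite ltxx.
set k := Num.floor _.
have := floor_le ((u - q) / (2 * pi)); have := floorD1_gt ((u - q) / (2 * pi)).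
rewrite -/k !(ltr_pdivrMr, ler_pdivlMr, ltr_pdivrMr)// ltrBlDr lerBrDr => h1 h2.
apply/andP; split.
  by rewrite lerBrDr addrC (mulrC k%:~R) -hk; apply: hm; rewrite addrC mulrC.
by rewrite ltrBlDr addrC (mulrC (k + 1)%:~R) -hk; apply: lt_iff; rewrite addrC mulrC.
Qed.

(** Winding numbers live on the line, so in this form the indicator of an arc can be carried through
    a lift. *)
Lemma wrap_lt_winding z w : 0 <= z <= 2 * pi -> (wrap w < z)%R%:R = winding 0 w - winding z w :> R.
Proof.
move=> zp; have := winding_lt (wrap_circle w) zp.
have -> : winding z (wrap w) = winding z w - winding 0 w.
  rewrite /winding /wrap subr0; set K := Num.floor (w / _).
  have := winding_addi z w K; rewrite /winding => <-; congr ((Num.floor (_ / _))%:~R); ring.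
by move=> h; rewrite -[LHS]opprK -h opprB.
Qed.
End density_identification.

Section flow_densities.
Context {R : realType}.
Local Notation leb := (@lebesgue_measure R).
Local Notation mR := (measurableTypeR R).

(* The properties of the time-[t] map of a flow on the circle, lifted to the line. *)
Record circle_lift (h : R -> R) (c : R) : Prop := CircleLift {
  lift_homo : {homo h : x y / x <= y} ;
  lift_shift : forall x (k : int), h (x + 2 * pi * k%:~R) = h x + 2 * pi * k%:~R ;
  lift_c0 : 0 <= c ;
  lift_lower : forall u v, `|u - v| <= c * `|h u - h v| }.

Lemma lift_inj h c : circle_lift h c -> injective h.
Proof.
move=> H x y E; have := lift_lower H x y.
by rewrite E subrr normr0 mulr0 normr_le0 subr_eq0 => /eqP.
Qed.

Lemma lift_measurable h c : circle_lift h c -> measurable_fun setT (h : mR -> mR).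
Proof. by move=> H; apply: nondecreasing_measurable => //; exact: lift_homo H. Qed.

Lemma flow_lift (V : R -> R -> R) (l : R -> R) s t (L : R) (Phi : R -> R -> R) :
  measurable_fun setT (fun p : mR * mR => V p.1 p.2) -> (forall t, periodic2pi (V t)) ->
  (forall t u, `|V t u| <= l t) -> (forall t u v, `|V t u - V t v| <= l t * `|u - v|) ->
  s <= t -> 0 < L -> leb.-integrable `[s, t] (EFin \o l) -> (forall x, s <= x <= t -> l x <= L) ->
  (forall q, characteristic V s t (Phi q) /\ Phi q s = q) ->
  circle_lift (Phi ^~ t) (2 * expR (2 * L * (t - s))) /\ forall z, exists q, Phi q t = z.
Proof.
move=> mV pV Vl VL st L0 il lL flow; split; first split.
- move=> x y xy; have [cx ex] := flow x; have [cy ey] := flow y.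
  by apply: (char_mono mV Vl VL st il cx cy); rewrite ex ey.
- move=> x k; have [cx ex] := flow x; have [cy ey] := flow (x + 2 * pi * k%:~R).
  apply: (char_unique mV Vl VL st il cy (char_shift pV cx k)).
  by rewrite ex ey.
- by rewrite mulr_ge0// expR_ge0.
- move=> u v; have [cu eu] := flow u; have [cv ev] := flow v.
  by have := char_lower mV Vl VL st L0 il lL cu cv; rewrite eu ev.
- move=> z; have [gam ch gz] := char_surj mV Vl VL z st il.
  exists (gam s); have [cu eu] := flow (gam s).
  by rewrite -gz; exact: (char_unique mV Vl VL st il cu ch).
Qed.

Section density.
Variables (mu : circle_measure R) (r0 : R -> R).
Hypothesis mr0 : measurable_fun circle r0.
Hypothesis mur0 : forall U : set mR, measurable U -> circle_mu mu U = (\int[leb]_(u in U `&` circle) (r0 u)%:E)%E.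

Lemma circle_mu_dominated : circle_mu mu `<< leb.
Proof.
apply/null_content_dominatesP => N mN N0.
have mNc : measurable (N `&` circle) by apply: measurableI => //; exact: mcircle.
have h0 : leb (N `&` circle) = 0%E by apply: (subset_measure0 mNc mN _ N0).
rewrite (mur0 mN); apply: (null_set_integral mNc _ h0).
by apply/measurable_EFinP; apply: measurable_funS mr0; [exact: mcircle|].
Qed.

Lemma circle_density : exists k : R -> R, [/\ forall u, 0 <= k u, forall u, ~ circle u -> k u = 0,
    leb.-integrable setT (EFin \o k),
    forall A : set mR, measurable A -> circle_mu mu A = (\int[leb]_(u in A) (k u)%:E)%E &
    (forall (f : R -> R) (B : R), measurable_fun setT (f : mR -> R) -> (forall u, `|f u| <= B) ->
      \int[circle_mu mu]_u f u = \int[leb]_u (k u * f u)) /\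
    {ae leb, forall u : mR, circle u -> r0 u = k u}].
Proof.
have [k [k0 kc ik kA kf]] := exists_circle_density circle_mu_dominated (circle_muC mu).
exists k; split => //; split => //.
have ikc : leb.-integrable circle (EFin \o k) by apply: integrableS ik => //; exact: mcircle.
have mr : measurable_fun circle (EFin \o r0) by apply/measurable_EFinP.
have := integral_ae_eq mcircle ikc mr; move=> H.
apply: filterS (H _) => [u h cu|E Ec mE]; last by rewrite -kA// mur0// (setIidl Ec).
by have [->] := h cu.
Qed.

Lemma Rintegral_density (k f : R -> R) B : measurable_fun setT (f : mR -> R) -> (forall u, `|f u| <= B) ->
  measurable_fun setT (k : mR -> R) -> (forall u, ~ circle u -> k u = 0) ->
  {ae leb, forall u : mR, circle u -> r0 u = k u} ->
  \int[leb]_(u in circle) (f u * r0 u) = \int[leb]_u (k u * f u).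
Proof.
move=> mf fB mk kc rk.
rewrite [RHS](_ : _ = \int[leb]_(u in circle) (k u * f u)); last first.
  rewrite [RHS]Rintegral_mkcond; apply: eq_RintegralL => u _; rewrite patchE.
  by case: ifPn => // /negP uc; rewrite kc ?mul0r// => cu; apply: uc; rewrite inE.
apply: (@ae_eq_Rintegral _ mR R leb) => //; first exact: mcircle.
- by apply: measurable_funM => //; exact: measurable_funTS.
- by apply: measurable_funTS; exact: measurable_funM.
- by apply: filterS rk => u h cu; rewrite h// mulrC.
Qed.

Section lift.
Variables (h : R -> R) (c : R) (X : {mfun mR >-> mR}).
Hypothesis hc : circle_lift h c.
Hypothesis XE : forall u, X u = wrap (h u).

Lemma push_dominated : push (circle_mu mu) X `<< leb.
Proof.
apply/null_content_dominatesP => N mN N0.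
have := wrap_null_preimage (lift_measurable hc) (lift_c0 hc) (lift_lower hc) mN N0.
rewrite (_ : (wrap \o h) @^-1` N = X @^-1` N); last by apply/seteqP; split => u /=; rewrite XE.
move=> h0; apply: (null_content_dominatesP _ _).1 h0; first exact: circle_mu_dominated.
by rewrite -[X in measurable X]setTI; exact: (@measurable_funPT _ _ _ _ X).
Qed.

Lemma push_circle : push (circle_mu mu) X (~` circle) = 0%E.
Proof.
rewrite /push /pushforward (_ : _ @^-1` _ = set0) ?measure0//.
by apply/seteqP; split => u //=; rewrite XE; have := wrap_circle (h u).
Qed.

Lemma Rintegral_push (f : R -> R) B : measurable_fun setT (f : mR -> R) -> (forall u, `|f u| <= B) ->
  \int[push (circle_mu mu) X]_u f u = \int[circle_mu mu]_u f (wrap (h u)).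
Proof.
move=> mf fB; rewrite /push /Rintegral integral_pushforward//.
- by rewrite preimage_setT; congr fine; apply: eq_integral => u _ /=; rewrite XE.
- exact/measurable_EFinP.
- rewrite preimage_setT; apply: (@Rintegrable_le _ mR R (circle_mu mu) setT (f \o X) (fun=> B)) => //; last exact: finite_measure_integrable_cst.
    exact: (measurableT_comp mf (@measurable_funPT _ _ _ _ X)).
  by move=> x _; exact: fB.
Qed.

(** The pushforward is absolutely continuous because the inverse of [h] is Lipschitz. Its
    distribution function at [h q] is the mass on the lifted arc from [q0] to [q], as [h] preserves
    winding numbers. *)
Lemma lift_density q0 : h q0 = 0 -> (forall z, exists q, h q = z) ->
  exists kk : R -> R, [/\ forall u, 0 <= kk u, forall u, ~ circle u -> kk u = 0,
    leb.-integrable setT (EFin \o kk),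
    (forall A : set mR, measurable A -> circle_mu mu (X @^-1` A) = (\int[leb]_(u in A) (kk u)%:E)%E) /\
    (forall (f : R -> R) (B : R), measurable_fun setT (f : mR -> R) -> (forall u, `|f u| <= B) ->
      \int[leb]_u (kk u * f u) = \int[circle_mu mu]_u f (wrap (h u))) &
    forall k : R -> R, leb.-integrable setT (EFin \o k) -> (forall u, ~ circle u -> k u = 0) ->
     (forall (f : R -> R) (B : R), measurable_fun setT (f : mR -> R) -> (forall u, `|f u| <= B) ->
      \int[circle_mu mu]_u f u = \int[leb]_u (k u * f u)) ->
     forall q, 0 <= h q <= 2 * pi -> cdf (fun=> kk) 0 (h q) = cdf (fun=> k) 0 q - cdf (fun=> k) 0 q0].
Proof.
move=> hq0 hs.
have [kk [kk0 kkc ikk kkA kkf]] := exists_circle_density push_dominated push_circle.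
exists kk; split => //.
  by split=> [//|f B mf fB]; rewrite -(kkf f B mf fB) (Rintegral_push mf fB).
move=> k ik kc kf q hqp; have T0 : 0 <= (0 : R) <= 0 by rewrite lexx.
have mlt z : measurable_fun setT ((fun u => (u < z)%R%:R) : mR -> R).
  by apply: Rmeasurable_bool; exact: measurable_fun_ltr.
have b1 (b : bool) : `|b%:R| <= 1 :> R by case: b; rewrite ?normr1 ?normr0.
rewrite (cdf_lt (static_transport 0 ikk kkc) T0 hqp) -(kkf _ 1 (mlt _) (fun u => b1 _)).
rewrite (Rintegral_push (mlt _) (fun u => b1 _)).
have mw : measurable_fun setT ((fun u => (wrap (h u) < h q)%R%:R) : mR -> R).
  by apply: (measurableT_comp (mlt (h q))); apply: (measurableT_comp measurable_wrap); exact: lift_measurable hc.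
rewrite (kf _ 1 mw (fun u => b1 _)).
have tk := static_transport 0 ik kc.
rewrite /cdf opprK addrC -(RintegralB measurableT (iwinding tk q0 T0) (iwinding tk q T0)).
apply: eq_RintegralL => u _; rewrite wrap_lt_winding// -mulrBr -{1}hq0.
by rewrite !(lift_winding _ _ (lift_homo hc) (lift_inj hc) (lift_shift hc)).
Qed.
End lift.

(** [rho t] and the pushforward density have the same distribution function: along characteristics
    each equals that of the initial density up to a constant, and the constant is fixed by the value
    0 at the point [q0] that is carried to 0. *)
Lemma transport_pushforward T (rho V : R -> R -> R) (l : R -> R) (L : R) (Phi : R -> R -> R) :
  transport T rho V l -> transport_eq T rho V -> 0 < L -> leb.-integrable `[0, T] (EFin \o l) ->
  (forall t, 0 <= t <= T -> l t <= L) ->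
  (forall f f' : R -> R, (forall x : R, is_derive x (1 : R) f (f' x)) -> continuous f' ->
     periodic2pi f -> periodic2pi f' ->
     \int[leb]_u (rho 0 u * f u) = \int[leb]_(u in circle) (f u * r0 u)) ->
  (forall q, characteristic V 0 T (Phi q) /\ Phi q 0 = q) ->
  forall t (f : R -> R) B, 0 <= t <= T -> measurable_fun setT (f : mR -> R) -> (forall u, `|f u| <= B) ->
    \int[leb]_u (rho t u * f u) = \int[circle_mu mu]_u f (wrap (Phi u t)).
Proof.
move=> tr treq L0 il lL init flow t f B tT mf fB; have /andP[t0 tT'] := tT.
have T00 : 0 <= (0 : R) <= T by rewrite lexx (le_trans t0).
have flow' q : characteristic V 0 t (Phi q) /\ Phi q 0 = q.
  by have [cq eq] := flow q; split=> //; exact: (char_subr tT' cq).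
have ilt : leb.-integrable `[0, t] (EFin \o l).
  by apply: integrableS il; [exact: mitv|exact: mitv|apply: subset_itvl; rewrite bnd_simp].
have lLt x : 0 <= x <= t -> l x <= L by move=> /andP[x0 xt]; apply: lL; rewrite x0 (le_trans xt).
have [hc hs] := flow_lift (tr_mV tr) (tr_pV tr) (tr_V tr) (tr_VL tr) t0 L0 ilt lLt flow'.
set h := Phi ^~ t in hc hs *.
have mX : measurable_fun setT (wrap \o h : mR -> mR).
  exact: (measurableT_comp measurable_wrap (lift_measurable hc)).
pose X : {mfun mR >-> mR} := HB.pack (wrap \o h) (isMeasurableFun.Build _ _ _ _ _ mX).
have [q0 hq0] := hs 0.
have [kk [kk0 kkc ikk [_ kkf] kkq]] := @lift_density h _ X hc (fun=> erefl) q0 hq0 hs.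
rewrite -(kkf f B mf fB).
have [k [k0 kc ik kA [kf rk]]] := circle_density.
have T0 : 0 <= (0 : R) <= 0 by rewrite lexx.
(* The initial condition is known through smooth tests only, which is enough to determine the
   distribution function. *)
have c0 z : cdf rho 0 z = cdf (fun=> k) 0 z.
  apply: (@cdf_test_eq _ (rho 0) k (tr_irho tr T00) ik (fun u => @tr_circle _ _ _ _ _ tr 0 u) kc) => g g' dg cg' pg pg'.
  have [B' _ gB] := periodic_bounded (dR_continuous dg) pg.
  have mg : measurable_fun setT (g : mR -> R) by apply: continuous_measurable_fun; exact: (dR_continuous dg).
  by rewrite (init _ _ dg cg' pg pg') (Rintegral_density mg gB (RintegrableP measurableT ik) kc rk).
have [K hK] := cdf_characteristic tr treq (lexx 0) t0 tT' ilt.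
have cE z : 0 <= z <= 2 * pi -> cdf (fun=> rho t) 0 z = cdf (fun=> kk) 0 z.
  move=> zp; have [q hq] := hs z; rewrite -hq in zp *.
  rewrite (kkq k ik kc kf q zp) -!c0.
  have [cq eq] := flow' q; have [cq0 eq0] := flow' q0.
  have := hK _ cq; have := hK _ cq0; rewrite eq eq0.
  have hq0' : Phi q0 t = 0 := hq0.
  rewrite hq0' (cdf0 tr tT) => h1 h2.
  rewrite (_ : cdf (fun=> rho t) 0 (Phi q t) = cdf rho t (Phi q t))// h2.
  by congr (_ + _); apply/eqP; rewrite -subr_eq0 opprK addrC -h1.
have := cdf_ae_eq (tr_irho tr tT) ikk (fun u => @tr_circle _ _ _ _ _ tr t u) kkc cE.
move=> ae; apply: ae_eq_Rintegral => //.
- by apply: measurable_funM => //; exact: (tr_mrho1 tr).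
- by apply: measurable_funM => //; exact: (RintegrableP measurableT ikk).
- by apply: filterS ae => u E _; rewrite E.
Qed.
End density.

(** An explicit version of the density in terms of the measure of rays, free of any choice that
    would depend on parameters. *)
Lemma density_limsup (K : set mR -> \bar R) (k : R -> R) :
  (forall A : set mR, measurable A -> K A = (\int[leb]_(u in A) (k u)%:E)%E) ->
  leb.-integrable setT (EFin \o k) ->
  {ae leb, forall u : mR, fine (limn_esup (fun n : nat =>
     (n.+1%:R * (fine (K `]-oo, u + n.+1%:R^-1]%classic) - fine (K `]-oo, u]%classic)))%:E)) = k u}.
Proof.
move=> kA ik; have := ftc_seq ik; apply: filterS => u hu.
have E z : fine (K `]-oo, z]%classic) = \int[leb]_(v in `]-oo, z]) k v by rewrite kA//; exact: mitv.
under eq_fun do rewrite !E.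
pose w n : \bar R := ((n.+1%:R * (\int[leb]_(v in `]-oo, u + n.+1%:R^-1]) k v - \int[leb]_(v in `]-oo, u]) k v))%:E).
have {}hu : w @ \oo --> (k u)%:E by apply: cvg_EFin; [exact: nearW|exact: hu].
rewrite -/w is_cvg_limn_esupE; last by apply/cvg_ex; exists (k u)%:E; exact: hu.
by rewrite (cvg_lim _ hu).
Qed.
End flow_densities.

(** * The mean-field flow *)

Section kernels.
Context {d1 d2 d3 : measure_display} {X : measurableType d1} {Y : measurableType d2} {Z : measurableType d3} {R : realType}.

Section kpull.
Variables (k : R.-fker X ~> Y) (g : {mfun Z >-> X}).

Definition kpull (z : Z) : {measure set Y -> \bar R} := k (g z).

Let kpull_measurable U : measurable U -> measurable_fun setT (kpull ^~ U).
Proof. by move=> mU; apply: (measurableT_comp (measurable_kernel k U mU)). Qed.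

HB.instance Definition _ := isKernel.Build _ _ Z Y R kpull kpull_measurable.

Let kpull_uub : measure_fam_uub kpull.
Proof. by have [r hr] := measure_uub k; exists r => z; exact: hr. Qed.

HB.instance Definition _ := Kernel_isFinite.Build _ _ Z Y R kpull kpull_uub.
End kpull.

(** The integrand depends on all of [z], the measure on [g z] only; pulled back along [g], the
    kernel has the same source as the integrand. *)
Lemma measurable_pull_Rintegral (k : R.-fker X ~> Y) (g : Z -> X) (H : Z -> Y -> R) :
  measurable_fun setT g -> measurable_fun setT (fun p : Z * Y => H p.1 p.2) ->
  measurable_fun setT (fun z => \int[k (g z)]_y H z y)%R.
Proof.
move=> mg mH; pose g' : {mfun Z >-> X} := HB.pack g (isMeasurableFun.Build _ _ _ _ _ mg).
exact: (measurable_kRintegral (kpull k g') mH).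
Qed.

Section fkernel.
Variables (k : X -> {measure set Y -> \bar R}).

Definition fkernel (mk : forall U, measurable U -> measurable_fun setT (fun x => k x U))
  (kb : measure_fam_uub k) (x : X) : {measure set Y -> \bar R} := k x.

HB.instance Definition _ mk kb := isKernel.Build _ _ X Y R (fkernel mk kb) mk.

HB.instance Definition _ mk kb := Kernel_isFinite.Build _ _ X Y R (fkernel mk kb) kb.
End fkernel.

Lemma fkernel_of (k : X -> {measure set Y -> \bar R}) (b : R) :
  (forall U, measurable U -> measurable_fun setT (fun x => k x U)) ->
  (forall x, (k x setT <= b%:E)%E) -> exists k' : R.-fker X ~> Y, forall x, k' x = k x.
Proof.
move=> mk kb.
have uub : measure_fam_uub k by exists (b + 1) => x; rewrite (le_lt_trans (kb x))// lte_fin ltrDl.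
by exists (fkernel mk uub).
Qed.
End kernels.

(** * The initial data as a kernel *)

Section mu_kernel.
Context {d : measure_display} {Omega : measurableType d} {R : realType}.
Local Notation leb := (@lebesgue_measure R).
Local Notation mR := (measurableTypeR R).
Variables (mu : Omega -> circle_measure R) (rho0 : R -> Omega -> R).
Hypothesis mmu : forall U, <<s BL_open >> U -> measurable (mu @^-1` U).
Hypothesis dens : has_density mu rho0.

(** Integration against a test function is 1-Lipschitz for [d_BL], so its strict sublevel sets are
    open. *)
Lemma measurable_BL (f : R -> R) : BL_test f ->
  measurable_fun setT (fun x => \int[circle_mu (mu x)]_(u in circle) f u).
Proof.
move=> bf; apply: (@measurability _ _ _ mR _ _ _ (RGenInftyO.measurableE R)) => //.
move=> _ [_ [a ->] <-]; rewrite setTI.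
rewrite (_ : _ @^-1` _ = mu @^-1` [set nu | \int[circle_mu nu]_(u in circle) f u < a]); last first.
  by apply/seteqP; split => x /=; rewrite in_itv.
apply: mmu; apply: sub_sigma_algebra => /= nu h.
exists (a - \int[circle_mu nu]_(u in circle) f u); first by rewrite subr_gt0.
move=> nu' hd /=; have : (`|\int[circle_mu nu]_(u in circle) f u - \int[circle_mu nu']_(u in circle) f u|%:E <= d_BL nu nu')%E.
  by apply: ereal_sup_ubound; exists f.
move=> /le_lt_trans /(_ hd); rewrite lte_fin distrC.
by move=> /(le_lt_trans (ler_norm _)); rewrite ltrBlDr subrK.
Qed.

(* A test function for [d_BL] that tends to the indicator of []0, z[] after
   division by [e]. *)
Definition tent (e z u : R) : R := Num.max 0 (Num.min e (Num.min u (z - u))).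

Lemma tent_bound e z u : 0 <= u -> 0 <= e ->
  [/\ 0 <= tent e z u, tent e z u <= u, tent e z u <= e & tent e z u <= Num.max 0 (z - u)].
Proof.
move=> u0 e0; split.
- by rewrite le_max lexx.
- by rewrite ge_max u0 !ge_min lexx orbT.
- by rewrite ge_max e0 ge_min lexx.
- by rewrite ge_max !le_max lexx/= !ge_min lexx !orbT.
Qed.

Lemma tent_lip e z u v : 0 <= u -> 0 <= v -> 0 <= e -> tent e z u <= tent e z v + `|v - u|.
Proof.
move=> u0 v0 e0; have [h1 h2 h3 h4] := tent_bound z u0 e0.
have key (t a c : R) : t <= u -> t <= e -> t <= a -> (a = 0 \/ a = z - u) -> 0 <= c -> v - u <= c -> u - v <= c ->
    t <= tent e z v + c.
  move=> t1 t2 t3 ta c0 c1 c2; rewrite /tent.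
  case: (leP v (z - v)) => H3; [case: (leP e v) => H2|case: (leP e (z - v)) => H2];
    [case: (leP 0 e)|case: (leP 0 v)|case: (leP 0 e)|case: (leP 0 (z - v))] => H1; case: ta => ta; lra.
apply: (key _ (Num.max 0 (z - u))) => //.
- by rewrite /Num.max; case: ifP; [right|left].
- exact: ler_norm.
- by rewrite distrC ler_norm.
Qed.

Lemma tent_BL e z : 0 <= e <= 1 -> z <= 2 * pi -> BL_test (tent e z).
Proof.
move=> /andP[e0 e1] zp.
have key u v : circle u -> circle v -> u <= v -> `|tent e z u - tent e z v| <= circle_dist u v.
  rewrite /circle/= !in_itv/= => /andP[u0 u1] /andP[v0 v1] uv.
  have e00 := e0; have h4 := tent_lip z u0 v0 e0; have h5 := tent_lip z v0 u0 e0.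
  have [h1 h2 _ _] := tent_bound z u0 e0.
  have vu : 0 <= v - u by rewrite subr_ge0.
  rewrite distrC (ger0_norm vu) in h5; rewrite (ger0_norm vu) in h4.
  rewrite /circle_dist distrC [`|u - v|]distrC (ger0_norm vu).
  (* [tent] vanishes at 0 and from [z] on. Hence the other arc, of length [u + (2 * pi - v)], bounds
     the difference as well. *)
  have h6 : tent e z v <= 2 * pi - v.
    rewrite /tent ge_max subr_ge0 (ltW v1)/= !ge_min [z - v <= _]lerD2r zp.
    by rewrite !orbT.
  have h7 : 0 <= tent e z v by rewrite le_max lexx.
  by rewrite le_min !ler_norml; apply/andP; split; apply/andP; split; lra.
split=> [u|u v cu cv].
  rewrite /circle/= in_itv/= => /andP[u0 u1].
  by have [-> _ h _] := tent_bound z u0 e0; exact: le_trans h e1.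
have [uv|/ltW vu] := leP u v; first exact: key.
by rewrite distrC /circle_dist [`|u - v|]distrC; exact: key.
Qed.

Lemma tent_cvg (z u : R) : 0 <= u -> (fun n : nat => n.+1%:R * tent n.+1%:R^-1 z u) @ \oo --> (((0 < u) && (u < z))%:R : R).
Proof.
move=> u0.
have zero : u <= 0 \/ z <= u -> forall e : R, 0 <= e -> tent e z u = 0.
  move=> h e e0; have [h1 h2 _ h3] := tent_bound z u0 e0; apply/eqP; rewrite eq_le h1 andbT.
  case: h => h; first exact: le_trans h2 h.
  by rewrite (le_trans h3)// ge_max lexx/= subr_le0.
have [/andP[up uz]|h] := boolP (_ && _); last first.
  rewrite (_ : (fun n : nat => _) = cst 0); first exact: cvg_cst.
  apply/funext => n; rewrite zero ?mulr0//.
  by move: h; rewrite negb_and -!leNgt => /orP[|]; [left|right].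
apply: cvg_near_cst; near=> n.
have n0 : 0 < n.+1%:R^-1 :> R by rewrite invr_gt0.
rewrite /tent (min_idPl _) ?(max_idPr _) ?(ltW n0) ?divff//.
rewrite le_min; apply/andP; split; near: n.
  by apply: filterS (near_infty_natSinv_lt (PosNum up)) => n /ltW.
have zu : 0 < z - u by rewrite subr_gt0.
by apply: filterS (near_infty_natSinv_lt (PosNum zu)) => n /ltW.
Unshelve. all: by end_near. Qed.

Lemma measurable_tent e z : measurable_fun setT (tent e z : mR -> R).
Proof.
by apply: measurable_maxr => //; apply: measurable_minr => //; apply: measurable_minr => //; exact: measurable_funB.
Qed.

Lemma measurable_mu_open z : z <= 2 * pi -> measurable_fun setT (fun x => circle_mu (mu x) `]0, z[%classic).
Proof.
move=> zp.
have icst (c : R) x : (circle_mu (mu x)).-integrable circle (EFin \o cst c).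
  by apply: (@integrableS _ mR R _ setT) => //; [exact: mcircle|exact: finite_measure_integrable_cst].
have tb (n : nat) u : circle u -> `|tent n.+1%:R^-1 z u| <= n.+1%:R^-1.
  rewrite /circle/= in_itv/= => /andP[u0 _].
  have e0 : 0 <= n.+1%:R^-1 :> R by rewrite invr_ge0.
  by have [h1 _ h2 _] := tent_bound z u0 e0; rewrite ger0_norm.
rewrite (_ : (fun x => _) = EFin \o (fun x => \int[circle_mu (mu x)]_(u in circle) ((0 < u) && (u < z))%:R)); last first.
  apply/funext => x /=; rewrite /Rintegral.
  rewrite (eq_integral (fun u => (\1_(`]0%R, z[%classic : set mR) u)%:E)); last by move=> u _; rewrite indicE mem_setE in_itv.
  rewrite (integral_indic _ mcircle (mitv _)).
  rewrite setIidl ?fineK//; first by apply: fin_num_measure; exact: mitv.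
  move=> u; rewrite /circle/= !in_itv/= => /andP[u0 uz].
  by rewrite (ltW u0)/= (lt_le_trans uz).
apply/measurable_EFinP.
apply: (measurable_fun_cvg (h := fun (n : nat) x => n.+1%:R * \int[circle_mu (mu x)]_(u in circle) tent n.+1%:R^-1 z u)).
  move=> n; apply: measurable_funM => //; apply: measurable_BL; apply: tent_BL => //.
  by rewrite invr_ge0 ler0n/= invf_le1// ler1n.
move=> x _.
have it (n : nat) : (circle_mu (mu x)).-integrable circle (EFin \o tent n.+1%:R^-1 z).
  apply: (@Rintegrable_le _ mR R _ circle _ (cst n.+1%:R^-1)).
  - exact: mcircle.
  - by apply: measurable_funTS; exact: measurable_tent.
  - exact: tb.
  - exact: icst.
rewrite (_ : (fun n : nat => _) = fun n : nat => \int[circle_mu (mu x)]_(u in circle) (n.+1%:R * tent n.+1%:R^-1 z u)); last first.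
  by apply/funext => n; rewrite -(RintegralZl _ mcircle (it n)).
apply: (@Rdominated_cvg _ mR R _ circle _ _ (cst 1)).
- exact: mcircle.
- by move=> n; apply: measurable_funTS; apply: measurable_funM => //; exact: measurable_tent.
- apply: measurable_funTS; apply: Rmeasurable_bool; apply: measurable_and; exact: measurable_fun_ltr.
- by apply: aeW => u; rewrite /circle/= in_itv/= => /andP[u0 _]; exact: tent_cvg.
- move=> n u cu; rewrite normrM ger0_norm// -ler_pdivlMl// mulr1; exact: tb.
- exact: icst.
Qed.

(** The tents only reach open arcs that start at 0. The point 0 is null because the measure has a
    density, and the complement of the circle is null by the definition of [circle_measure]. *)
Lemma mu_null x (A B : set mR) : measurable A -> measurable B -> A `\` B `<=` ~` circle `|` [set 0] ->
  circle_mu (mu x) A = circle_mu (mu x) (A `&` B).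
Proof.
move=> mA mB sub; have [mr0 mur0] := dens x.
apply: (etrans (measureDI (circle_mu (mu x)) mA mB)); rewrite [X in (X + _)%E](_ : _ = 0%E) ?add0e//.
have m0 : circle_mu (mu x) [set 0] = 0%E.
  apply: (null_content_dominatesP _ _).1 (circle_mu_dominated mr0 mur0) _ _ _; first exact: measurable_set1.
  exact: lebesgue_measure_set1.
apply: (subset_measure0 (measurableD mA mB) _ sub).
  by apply: measurableU; [apply: measurableC; exact: mcircle|exact: measurable_set1].
have mC : measurable (~` circle : set mR) by apply: measurableC; exact: mcircle.
apply/negligibleP; first by apply: measurableU => //; exact: measurable_set1.
apply: negligibleU; apply/negligibleP => //; exact: circle_muC.
Qed.

Lemma measurable_mu_ray z : measurable_fun setT (fun x => circle_mu (mu x) `]-oo, z[%classic).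
Proof.
rewrite (_ : (fun x => _) = fun x => circle_mu (mu x) `]0, Num.min z (2 * pi)[%classic).
  by apply: measurable_mu_open; rewrite ge_min lexx orbT.
apply/funext => x; rewrite (@mu_null x _ `]0, 2 * pi[%classic); [|exact: mitv|exact: mitv|].
  congr (circle_mu (mu x) _); apply/seteqP; split => u /=; rewrite !in_itv/= lt_min.
    by move=> [-> /andP[-> ->]].
  by move=> /andP[-> /andP[-> ->]].
move=> u [/= _]; rewrite in_itv/= => h.
have [->|u0] := eqVneq u 0; [by right|left => /=].
rewrite /circle/= in_itv/= => /andP[u1 u2]; apply: h.
by rewrite u2 lt_neqAle eq_sym u0 u1.
Qed.

Lemma measurable_mu_setT : measurable_fun setT (fun x => circle_mu (mu x) setT).
Proof.
rewrite (_ : (fun x => _) = fun x => circle_mu (mu x) `]-oo, (2 * pi)[%classic); first exact: measurable_mu_ray.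
apply/funext => x; have := @mu_null x setT `]-oo, (2 * pi)[%classic measurableT (mitv _); rewrite setTI; apply.
by move=> u [_ /=]; rewrite in_itv/= => h; left; rewrite /circle/= in_itv/= => /andP[_] /h.
Qed.

Lemma measurable_mu (U : set mR) : measurable U -> measurable_fun setT (fun x => circle_mu (mu x) U).
Proof.
rewrite (RGenInftyO.measurableE R); move: U.
apply: (dynkin_induction (T := mR) (RGenInftyO.measurableE R)).
- move=> _ _ [a ->] [b ->]; exists (Num.min a b).
  by apply/seteqP; split => u /=; rewrite !in_itv/= lt_min => /andP.
- exact: measurable_mu_setT.
- by move=> _ [z ->]; exact: measurable_mu_ray.
- move=> S mS h; rewrite (_ : (fun x => _) = fun x => (circle_mu (mu x) setT - circle_mu (mu x) S)%E).
    by apply: emeasurable_funB => //; exact: measurable_mu_setT.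
  apply/funext => x; rewrite -setTD measureD ?setTI//.
  by rewrite -ge0_fin_numE ?measure_ge0//; exact: fin_num_measure.
- move=> F mF tF h; rewrite (_ : (fun x => _) = fun x => (\sum_(n <oo) circle_mu (mu x) (F n))%E).
    by apply: ge0_emeasurable_sum => // n x _ _; exact: measure_ge0.
  apply/funext => x; transitivity (\sum_(n <oo | n \in [set: nat]) circle_mu (mu x) (F n))%E.
    exact: measure_bigcup.
  by apply: eq_eseriesl => n; rewrite in_setT.
Qed.
End mu_kernel.

Section interaction.
Context {R : realType} (D : R -> R).
Hypothesis iD : interaction D.

Lemma interaction_periodic : periodic2pi D. Proof. by case: iD. Qed.

Lemma interaction_bound u : `|D u| <= 1.
Proof. by case: iD => pD _ h; rewrite -(periodic_wrap u pD); apply: h; exact: wrap_circle. Qed.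

Lemma interaction_lip u v : `|D u - D v| <= `|u - v|.
Proof.
case: iD => pD h _; rewrite -(periodic_wrap u pD) -(periodic_wrap v pD).
apply: le_trans (h _ _ (wrap_circle u) (wrap_circle v)) _.
have := wrap_circle u; have := wrap_circle v; rewrite /circle/= !in_itv/=.
set a := wrap u; set c := wrap v => /andP[c0 c1] /andP[a0 a1].
pose k := Num.floor (u / (2 * pi)) - Num.floor (v / (2 * pi)).
have E : u - v = a - c + 2 * pi * k%:~R by rewrite /a /c /wrap /k rmorphB/=; ring.
rewrite /circle_dist ge_min E.
(* If the two points lie in different turns, their distance is at least a full turn minus [|a - c|],
   the length of the other arc. *)
have [->|k0] := eqVneq k 0; first by rewrite mulr0 addr0 lexx.
apply/orP; right; rewrite lerBlDr.
have p0 : 0 <= 2 * pi :> R by rewrite mulr_ge0// pi_ge0.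
apply: (@le_trans _ _ `|2 * pi * k%:~R|).
  rewrite normrM (ger0_norm p0) ler_peMr// -intr_norm ler1z.
  by rewrite -gtz0_ge1 normr_gt0.
rewrite -[X in `|X|](addKr (a - c)) addrC; apply: le_trans (ler_normB _ _) _.
by [].
Qed.

Lemma interaction_continuous : continuous D.
Proof.
move=> x; apply/cvgrPdist_le => e e0; near=> y.
apply: le_trans (interaction_lip _ _) _; near: y.
by apply: cvgr_dist_le => //; exact: cvg_id.
Unshelve. all: by end_near. Qed.
End interaction.

Lemma normB_subB (R : realType) (a z c z' : R) : `|a - z - (c - z')| <= `|a - c| + `|z - z'|.
Proof. by rewrite (_ : _ - _ = (a - c) - (z - z')); [exact: ler_normB|ring]. Qed.

Lemma Rintegral_cst_itv (R : realType) (k s t : R) : s <= t ->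
  \int[@lebesgue_measure R]_(x in `[s, t]) (cst k x) = k * (t - s).
Proof.
move=> st; rewrite Rintegral_cst; last exact: (mitv _).
congr (_ * _); apply: (etrans (congr1 fine (lebesgue_measure_itv `[s, t]))).
rewrite /= lte_fin; case: ltP => //= ts.
by rewrite (le_anti (_ : s <= t <= s)) ?subrr// st ts.
Qed.

Section finite_measure_bounds.
Context d (T : measurableType d) (R : realType) (k : {measure set T -> \bar R}) (c : R).
Hypothesis kc : (k setT <= c%:E)%E.

Lemma cst_integrable (K : R) : k.-integrable setT (EFin \o (fun=> K)).
Proof.
apply/integrableP; split; first by apply/measurable_EFinP.
rewrite (eq_integral (cst `|K|%:E))// integral_cst//.
by apply: lte_mul_pinfty => //; exact: le_lt_trans kc (ltry _).
Qed.

Lemma bounded_integrable (f : T -> R) K : measurable_fun setT f -> (forall u, `|f u| <= K) ->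
  k.-integrable setT (EFin \o f).
Proof.
move=> mf fK; apply: (@Rintegrable_le _ T R k setT f (fun=> K)) => //.
exact: cst_integrable.
Qed.

Lemma Rintegral_bound (f : T -> R) K : measurable_fun setT f -> (forall u, `|f u| <= K) -> 0 <= K ->
  `|\int[k]_u f u| <= c * K.
Proof.
move=> mf fK K0.
apply: (@le_trans _ _ (\int[k]_u (fun=> K) u)).
  apply: normr_Rintegral_le => //; exact: cst_integrable.
rewrite Rintegral_cst// mulrC ler_wpM2r//.
rewrite -lee_fin fineK//; rewrite ge0_fin_numE ?measure_ge0//; exact: le_lt_trans kc (ltry _).
Qed.

Lemma Rintegral_dist (f g : T -> R) K B : measurable_fun setT f -> measurable_fun setT g ->
  (forall u, `|f u| <= B) -> (forall u, `|g u| <= B) -> (forall u, `|f u - g u| <= K) -> 0 <= K ->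
  `|\int[k]_u f u - \int[k]_u g u| <= c * K.
Proof.
move=> mf mg fB gB fg K0.
rewrite -(RintegralB measurableT (bounded_integrable mf fB) (bounded_integrable mg gB)).
by apply: Rintegral_bound => //; exact: measurable_funB.
Qed.
End finite_measure_bounds.

Ltac measurable_proj := repeat first [exact: measurable_id | exact: measurable_cst | exact: measurable_fst | exact: measurable_snd
  | apply: measurable_fun_pair | apply: (measurableT_comp measurable_fst) | apply: (measurableT_comp measurable_snd)].

(** * Picard iteration for the mean-field characteristics *)

Section mean_field.
Context {d : measure_display} {Omega : measurableType d} {R : realType}.
Local Notation leb := (@lebesgue_measure R).
Local Notation mR := (measurableTypeR R).
Variables (C b : R) (D : R -> R) (knu : R.-fker Omega ~> Omega) (kmu : R.-fker Omega ~> mR).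
Hypotheses (C0 : 0 < C) (b0 : 0 < b).
Hypotheses (D1 : forall u, `|D u| <= 1) (DL : forall u v, `|D u - D v| <= `|u - v|) (cD : continuous D).
Hypotheses (nu1 : forall x, (knu x setT <= 1%:E)%E) (mub : forall y, (kmu y setT <= b%:E)%E).
Local Notation J := (mR * mR * Omega)%type.
Implicit Types (X Y : J -> R) (s t z u : R) (x y : Omega).

Definition inner X s z y := \int[kmu y]_v D (X (s, v, y) - z).

Definition mean_velocity X s z x := C * \int[knu x]_y inner X s z y.

Let mD : measurable_fun setT (D : mR -> R). Proof. exact: continuous_measurable_fun. Qed.

Lemma measurable_inner_arg X s z y : measurable_fun setT X -> measurable_fun setT ((fun v => D (X (s, v, y) - z)) : mR -> R).
Proof.
move=> mX; apply: (measurableT_comp mD); apply: measurable_funB => //.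
apply: (measurableT_comp mX); exact: measurable_fun_pair.
Qed.

Lemma measurable_inner X : measurable_fun setT X ->
  measurable_fun setT (fun q : J * Omega => inner X q.1.1.1 q.1.1.2 q.2).
Proof.
move=> mX; apply: (measurable_pull_Rintegral kmu (g := snd) (H := fun (q : J * Omega) v => D (X (q.1.1.1, v, q.2) - q.1.1.2))) => //.
by apply: (measurableT_comp mD); apply: measurable_funB; [apply: (measurableT_comp mX)|]; measurable_proj.
Qed.

Lemma measurable_field X : measurable_fun setT X -> measurable_fun setT (fun p : J => mean_velocity X p.1.1 p.1.2 p.2).
Proof.
move=> mX; apply: measurable_funM => //.
by apply: (measurable_pull_Rintegral knu (g := snd) (H := fun (p : J) y => inner X p.1.1 p.1.2 y)) => //; exact: measurable_inner.
Qed.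

Lemma measurable_inner1 X s z : measurable_fun setT X -> measurable_fun setT (inner X s z).
Proof.
move=> mX; apply: (measurable_kRintegral kmu (H := fun y v => D (X (s, v, y) - z))).
apply: (measurableT_comp mD); apply: measurable_funB => //; apply: (measurableT_comp mX); measurable_proj.
Qed.

Lemma inner_bound X s z y : measurable_fun setT X -> `|inner X s z y| <= b.
Proof.
by move=> mX; rewrite -[leRHS]mulr1; apply: (Rintegral_bound (mub y)) => //; exact: measurable_inner_arg.
Qed.

Lemma field_bound X s z x : measurable_fun setT X -> `|mean_velocity X s z x| <= C * b.
Proof.
move=> mX; rewrite normrM (gtr0_norm C0) ler_wpM2l ?(ltW C0)// -[leRHS]mul1r.
apply: (Rintegral_bound (nu1 x)) => //; first exact: measurable_inner1.
- by move=> y; exact: inner_bound.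
- exact: ltW.
Qed.

Lemma inner_dist X Y s z z' y K : measurable_fun setT X -> measurable_fun setT Y -> 0 <= K ->
  (forall v, `|X (s, v, y) - z - (Y (s, v, y) - z')| <= K) -> `|inner X s z y - inner Y s z' y| <= b * K.
Proof.
move=> mX mY K0 hK; apply: (Rintegral_dist (mub y) (B := 1)) => //; try exact: measurable_inner_arg.
by move=> v; apply: le_trans (DL _ _) (hK v).
Qed.

Lemma field_dist X Y s z z' x K : measurable_fun setT X -> measurable_fun setT Y -> 0 <= K ->
  (forall y v, `|X (s, v, y) - z - (Y (s, v, y) - z')| <= K) -> `|mean_velocity X s z x - mean_velocity Y s z' x| <= C * (b * K).
Proof.
move=> mX mY K0 hK; rewrite -mulrBr normrM (gtr0_norm C0) ler_wpM2l ?(ltW C0)// -[leRHS]mul1r.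
apply: (Rintegral_dist (nu1 x) (B := b)) => //; try exact: measurable_inner1.
- by move=> y; exact: inner_bound.
- by move=> y; exact: inner_bound.
- by move=> y; apply: inner_dist.
- by rewrite mulr_ge0// ltW.
Qed.

Lemma measurable_field_along X u x : measurable_fun setT X ->
  measurable_fun setT ((fun s => mean_velocity X s (X (s, u, x)) x) : mR -> R).
Proof.
move=> mX; have mj : measurable_fun setT (fun s : mR => (s, X (s, u, x), x) : J).
  apply: measurable_fun_pair; last exact: measurable_cst.
  apply: measurable_fun_pair; first exact: measurable_id.
  by apply: (measurableT_comp mX); measurable_proj.
exact: (measurableT_comp (measurable_field mX) mj).
Qed.

Lemma integrable_field_along X u x (a c : R) : measurable_fun setT X ->
  leb.-integrable `[a, c] (EFin \o (fun s => mean_velocity X s (X (s, u, x)) x)).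
Proof.
move=> mX; apply: (@Rintegrable_le _ mR R leb `[a, c]%classic _ (fun=> C * b)).
- exact: mitv.
- by apply: measurable_funTS; exact: measurable_field_along.
- by move=> s _; exact: field_bound.
- by apply: continuous_Rintegrable; exact: cst_continuous.
Qed.

Definition picard X (j : J) := j.1.2 + \int[leb]_(s in `[0, j.1.1]) mean_velocity X s (X (s, j.1.2, j.2)) j.2.

Lemma measurable_picard X : measurable_fun setT X -> measurable_fun setT (picard X).
Proof.
move=> mX; apply: measurable_funD; first by measurable_proj.
rewrite [X in measurable_fun _ X](_ : _ = (fun j => \int[leb]_s (mean_velocity X s (X (s, j.1.2, j.2)) j.2 * ((0 <= s) && (s <= j.1.1))%R%:R))).
  apply: (@measurable_Rintegral _ _ _ mR R leb setT (fun (j : J) s => (mean_velocity X s (X (s, j.1.2, j.2)) j.2 * ((0 <= s) && (s <= j.1.1))%R%:R))) => //.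
  apply: measurable_funM.
    have mj : measurable_fun setT (fun p : J * mR => (p.2, X (p.2, p.1.1.2, p.1.2), p.1.2) : J).
      apply: measurable_fun_pair; last by measurable_proj.
      apply: measurable_fun_pair; first by measurable_proj.
      by apply: (measurableT_comp mX); measurable_proj.
    exact: (measurableT_comp (measurable_field mX) mj).
  apply: Rmeasurable_bool; apply: measurable_and; apply: measurable_fun_ler; measurable_proj.
apply/funext => j; rewrite [LHS]Rintegral_mkcond; apply: eq_RintegralL => s _.
by rewrite patchE mem_setE in_itv/=; case: ifP => _; rewrite ?mulr1 ?mulr0.
Qed.

Lemma mean_field_flow : exists X : J -> R, measurable_fun setT X /\
  forall t u x, X (t, u, x) = u + \int[leb]_(s in `[0, t]) mean_velocity X s (X (s, u, x)) x.
Proof.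
(* The field is Lipschitz with constant [C * b] both in the flow and in the position, so flows at
   weighted distance [K] have velocities at distance [2 * C * b * K]; the rate [4 * C * b] turns the
   time integral of this into [K / 2]. *)
pose M := 4 * C * b; have M0 : 0 < M by rewrite !mulr_gt0.
have cexp : continuous (fun s => expR (M * s)).
  move=> r; apply: continuous_comp; last exact: continuous_expR.
  by apply: cvgM; [exact: cvg_cst|exact: cvg_id].
have [||||||X [mX XE]] := @contraction_fixpoint R J (fun j => expR (M * j.1.1)) (measurable_fun setT) picard (fun j => j.1.2).
- by move=> j; exact: expR_ge0.
- by measurable_proj.
- exact: measurable_picard.
- by move=> Xn X mXn cX; apply: (measurable_fun_cvg mXn) => j _; exact: cX.
- move=> X Y K K0 mX mY XY [[t u] x]; rewrite /picard/= opprD addrACA subrr add0r.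
  have [t0|t0] := leP 0 t; last first.
    rewrite !set_itv_ge ?bnd_simp -?ltNge// !Rintegral_set0 subrr normr0.
    by rewrite mulr_ge0 ?expR_ge0// divr_ge0.
  rewrite -(RintegralB (mitv _) (integrable_field_along u x 0 t mX) (integrable_field_along u x 0 t mY)).
  have ie := RintegrableZl (M * K / 2) (mitv _) (continuous_Rintegrable 0 t cexp).
  apply: (@le_trans _ _ (\int[leb]_(s in `[0, t]) (M * K / 2 * expR (M * s)))).
    apply: (normr_Rintegral_le (mitv _)) ie.
      by apply: measurable_funTS; apply: measurable_funB; exact: measurable_field_along.
    move=> s _; have K20 : 0 <= 2 * K * expR (M * s) by rewrite !mulr_ge0// expR_ge0.
    have -> : M * K / 2 * expR (M * s) = C * (b * (2 * K * expR (M * s))) by rewrite /M; field.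
    apply: field_dist => // y v.
    have -> : 2 * K * expR (M * s) = K * expR (M * s) + K * expR (M * s) by ring.
    apply: le_trans (normB_subB _ _ _ _) _.
    by apply: lerD; [exact: (XY (s, v, y))|exact: (XY (s, u, x))].
  rewrite (RintegralZl _ (mitv _) (continuous_Rintegrable 0 t cexp)) Rintegral_expRM ?gt_eqF//.
  rewrite mulr0 expR0 (_ : M * K / 2 * ((expR (M * t) - 1) / M) = K / 2 * (expR (M * t) - 1)); last by field; rewrite gt_eqF.
  by rewrite ler_wpM2l ?divr_ge0// gerBl.
- exists 1; split=> // -[[t u] x]; rewrite mul1r /picard/= addrAC subrr add0r.
  have [t0|t0] := leP 0 t; last first.
    by rewrite set_itv_ge ?bnd_simp -?ltNge// Rintegral_set0 normr0 expR_ge0.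
  have mx0 : measurable_fun setT (fun j : J => j.1.2) by measurable_proj.
  apply: (@le_trans _ _ (\int[leb]_(s in `[0, t]) cst (C * b) s)).
    apply: (normr_Rintegral_le (mitv _)).
    - by apply: measurable_funTS; exact: (measurable_field_along u x mx0).
    - by move=> s _; exact: field_bound.
    - by apply: continuous_Rintegrable; exact: cst_continuous.
  rewrite Rintegral_cst_itv// subr0 mulrC; apply: le_trans (_ : M * t <= _).
    by rewrite mulrC ler_wpM2r// /M -mulrA ler_peMl ?ler1n// mulr_ge0// ltW.
  by apply: le_trans (expR_ge1Dx _); rewrite lerDr.
exists X; split => // t u x; rewrite -[LHS]XE; exact: erefl.
Qed.

Section flow.
Variable X : J -> R.
Hypothesis mX : measurable_fun setT X.
Hypothesis XE : forall t u x, X (t, u, x) = u + \int[leb]_(s in `[0, t]) mean_velocity X s (X (s, u, x)) x.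

Lemma flow0 u x : X (0, u, x) = u.
Proof. by rewrite XE set_itv1 Rintegral_set1 addr0. Qed.

Lemma measurable_flow1 u x : measurable_fun setT ((fun s => X (s, u, x)) : mR -> mR).
Proof. by apply: (measurableT_comp mX); measurable_proj. Qed.

Lemma flow_characteristic t u x : characteristic (fun s z => mean_velocity X s z x) 0 t (fun s => X (s, u, x)).
Proof. by split; [exact: measurable_flow1|move=> r _; rewrite flow0]. Qed.

Lemma measurable_field2 x : measurable_fun setT (fun p : mR * mR => mean_velocity X p.1 p.2 x).
Proof.
have mj : measurable_fun setT (fun p : mR * mR => (p.1, p.2, x) : J) by measurable_proj.
exact: (measurableT_comp (measurable_field mX) mj).
Qed.

Lemma field_lip s z z' x : `|mean_velocity X s z x - mean_velocity X s z' x| <= C * b * `|z - z'|.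
Proof.
rewrite -mulrA; apply: field_dist => // y v.
by apply: le_trans (normB_subB _ _ _ _) _; rewrite subrr normr0 add0r.
Qed.

Lemma field_periodic s x : periodic2pi D -> periodic2pi (mean_velocity X s ^~ x).
Proof.
move=> pD z; rewrite /mean_velocity; congr (_ * _); congr Rintegral; apply/funext => y; rewrite /inner; congr Rintegral.
by apply/funext => v; rewrite -[LHS]pD; congr D; ring.
Qed.

Lemma flow_lip s t u x : 0 <= s -> s <= t -> `|X (t, u, x) - X (s, u, x)| <= C * b * (t - s).
Proof.
move=> s0 st; rewrite (XE t) (XE s).
rewrite (Rintegral_split s0 st (integrable_field_along u x 0 t mX)) opprD addrACA subrr add0r addrAC subrr add0r.
apply: (@le_trans _ _ (\int[leb]_(s in `[s, t]) cst (C * b) s)).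
  apply: (normr_Rintegral_le (mitv _)).
  - by apply: measurable_funTS; exact: measurable_field_along.
  - by move=> r _; exact: field_bound.
  - by apply: continuous_Rintegrable; exact: cst_continuous.
by rewrite Rintegral_cst_itv.
Qed.

Lemma field_dist_time s t z z' x : 0 <= s -> s <= t ->
  `|mean_velocity X t z x - mean_velocity X s z' x| <= C * b * (C * b * (t - s) + `|z - z'|).
Proof.
move=> s0 st.
have Cb : 0 <= C * b by rewrite mulr_ge0// ltW.
(* The flow frozen at time [t] and read as constant in time, so that [field_dist] compares two flows
   at one and the same time. *)
pose Y (j : J) := X (t, j.1.2, j.2).
have mY : measurable_fun setT Y by apply: (measurableT_comp mX); measurable_proj.
have -> : mean_velocity X t z x = mean_velocity Y s z x by [].
rewrite -mulrA; apply: field_dist => //.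
  by rewrite addr_ge0// mulr_ge0// subr_ge0.
move=> y v; apply: le_trans (normB_subB _ _ _ _) _.
by rewrite lerD//; exact: flow_lip.
Qed.
End flow.
End mean_field.

(** * Existence *)

Lemma Rintegral_circle (R : realType) (k f : R -> R) : (forall u, ~ circle u -> k u = 0) ->
  \int[@lebesgue_measure R]_(u in circle) (k u * f u) = \int[@lebesgue_measure R]_u (k u * f u).
Proof.
move=> kc; rewrite Rintegral_mkcond; apply: eq_RintegralL => u _; rewrite patchE.
by case: ifPn => // /negP uc; rewrite kc ?mul0r// => cu; apply: uc; rewrite inE.
Qed.

Section existence.
Context {d : measure_display} {Omega : measurableType d} {R : realType}.
Local Notation leb := (@lebesgue_measure R).
Local Notation mR := (measurableTypeR R).
Variables (C b : R) (D : R -> R) (knu : R.-fker Omega ~> Omega) (kmu : R.-fker Omega ~> mR).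
Hypotheses (C0 : 0 < C) (b0 : 0 < b).
Hypotheses (iD : interaction D).
Hypotheses (nu1 : forall x, (knu x setT <= 1%:E)%E) (mub : forall y, (kmu y setT <= b%:E)%E).
Variables (mu : Omega -> circle_measure R) (rho0 : R -> Omega -> R).
Hypothesis kmuE : forall x, kmu x = circle_mu (mu x).
Hypothesis dens : has_density mu rho0.
Local Notation J := (mR * mR * Omega)%type.
Variable X : J -> R.
Hypothesis mX : measurable_fun setT X.
Hypothesis XE : forall t u x, X (t, u, x) = u + \int[leb]_(s in `[0, t]) mean_velocity C D knu kmu X s (X (s, u, x)) x.
Local Notation field := (mean_velocity C D knu kmu X).

Let D1 := interaction_bound iD.
Let DL := interaction_lip iD.
Let cD := interaction_continuous iD.

Lemma mean_field_lift t x : 0 <= t ->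
  exists2 c, circle_lift (fun u => X (t, u, x)) c & forall z, exists q, X (t, q, x) = z.
Proof.
move=> t0.
have Cb : 0 < C * b by rewrite mulr_gt0.
have := @flow_lift R (fun s z => field s z x) (fun=> C * b) 0 t (C * b) (fun u s => X (s, u, x)).
case=> //.
- exact: measurable_field2.
- by move=> s; exact: field_periodic (interaction_periodic iD).
- by move=> s u; exact: field_bound.
- by move=> s u v; exact: field_lip.
- by apply: continuous_Rintegrable; exact: cst_continuous.
- by move=> q; split; [exact: flow_characteristic|exact: flow0].
by move=> h1 h2; exists (2 * expR (2 * (C * b) * (t - 0))).
Qed.

Definition flow_cdf (t x z : _) : R := \int[kmu x]_v (wrap (X (t, v, x)) <= z)%R%:R.

(* The upper derivative of the distribution function is a density that is jointly
   measurable, which a choice of densities for each [t] and [x] need not be. *)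
Definition solution (t u : R) (x : Omega) : R := fine (limn_esup (fun n : nat =>
  (n.+1%:R * (flow_cdf t x (u + n.+1%:R^-1) - flow_cdf t x u))%:E)).

(** For fixed [t] and [x] the pushforward has a density by [lift_density], and [flow_cdf] measures
    its rays, so [density_limsup] identifies that density with [solution]. *)
Lemma solution_density t x : 0 <= t -> exists k : R -> R, [/\ forall u, 0 <= k u, forall u, ~ circle u -> k u = 0,
    leb.-integrable setT (EFin \o k),
    forall (f : R -> R) (B : R), measurable_fun setT (f : mR -> R) -> (forall u, `|f u| <= B) ->
      \int[leb]_u (k u * f u) = \int[kmu x]_v f (wrap (X (t, v, x))) &
    {ae leb, forall u : mR, solution t u x = k u}].
Proof.
move=> t0; have [c hc hs] := mean_field_lift x t0; have [mr0 mur0] := dens x.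
have mW : measurable_fun setT (fun u : mR => wrap (X (t, u, x)) : mR).
  exact: (measurableT_comp measurable_wrap (lift_measurable hc)).
pose W : {mfun mR >-> mR} := HB.pack (fun u : mR => wrap (X (t, u, x)) : mR) (isMeasurableFun.Build _ _ _ _ _ mW).
have [q0 hq0] := hs 0.
have [k [k0 kc ik [kA kf] _]] := lift_density mr0 mur0 (X := W) hc (fun=> erefl) hq0 hs.
exists k; split => //.
  by move=> f B mf fB; rewrite (kf f B mf fB) kmuE.
have := density_limsup kA ik; apply: filterS => u <-.
have E z : flow_cdf t x z = fine (circle_mu (mu x) (W @^-1` `]-oo, z]%classic)).
  rewrite /flow_cdf kmuE /Rintegral; congr fine.
  rewrite (eq_integral (fun v => (\1_(W @^-1` `]-oo, z]%classic) v)%:E)); last first.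
    move=> v _; rewrite indicE; congr ((nat_of_bool _)%:R%:E); apply/idP/idP; first by move=> vz; apply/mem_set; rewrite /= in_itv.
    by move/set_mem; rewrite /= in_itv.
  rewrite integral_indic ?setIT//.
  by rewrite -[X in measurable X]setTI; exact: (mW measurableT _ (mitv _)).
by rewrite /solution; under eq_fun do rewrite !E.
Qed.

Lemma measurable_solution : measurable_fun setT (fun p : J => solution p.1.1 p.1.2 p.2).
Proof.
apply: measurableT_comp => //; apply: measurable_fun_limn_esup => n.
apply/measurable_EFinP; apply: measurable_funM => //.
have mF : measurable_fun setT (fun p : J => flow_cdf p.1.1 p.2 p.1.2).
  apply: (measurable_pull_Rintegral kmu (g := snd) (H := fun (p : J) v => (wrap (X (p.1.1, v, p.2)) <= p.1.2)%R%:R)) => //.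
  apply: Rmeasurable_bool; apply: measurable_fun_ler; last by measurable_proj.
  apply: (measurableT_comp measurable_wrap); apply: (measurableT_comp mX); measurable_proj.
apply: measurable_funB => //.
have mj : measurable_fun setT (fun p : J => (p.1.1, p.1.2 + n.+1%:R^-1, p.2) : J).
  apply: measurable_fun_pair; last by measurable_proj.
  apply: measurable_fun_pair; first by measurable_proj.
  by apply: measurable_funD => //; measurable_proj.
exact: (measurableT_comp mF mj).
Qed.

Lemma measurable_solution1 t x : measurable_fun setT ((fun u => solution t u x) : mR -> R).
Proof.
have mj : measurable_fun setT (fun u : mR => (t, u, x) : J) by measurable_proj.
exact: (measurableT_comp measurable_solution mj).
Qed.

Lemma solution_Rintegral t x (f : R -> R) B : 0 <= t -> measurable_fun setT (f : mR -> R) -> (forall u, `|f u| <= B) ->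
  \int[leb]_(u in circle) (solution t u x * f u) = \int[kmu x]_v f (wrap (X (t, v, x))).
Proof.
move=> t0 mf fB; have [k [k0 kc ik kf sk]] := solution_density x t0.
rewrite -(kf f B mf fB) -(Rintegral_circle _ kc).
apply: (@ae_eq_Rintegral _ mR R leb) => //; first exact: mcircle.
- by apply: measurable_funTS; apply: measurable_funM => //; exact: measurable_solution1.
- by apply: measurable_funTS; apply: measurable_funM => //; exact: (RintegrableP measurableT ik).
- by apply: filterS sk => u -> _.
Qed.

Lemma solution_mass t x : 0 <= t -> (\int[leb]_(u in circle) `|solution t u x|%:E = kmu x setT)%E.
Proof.
move=> t0; have [k [k0 kc ik kf sk]] := solution_density x t0.
transitivity (\int[leb]_(u in circle) (k u)%:E)%E.
  apply: ae_eq_integral => //; first exact: mcircle.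
  - apply/measurable_EFinP; apply: measurable_funTS; apply: measurableT_comp => //; exact: measurable_solution1.
  - by apply/measurable_EFinP; apply: measurable_funTS; exact: (RintegrableP measurableT ik).
  - by apply: filterS sk => u -> _; rewrite ger0_norm.
have b1 : forall u : R, `|cst (1 : R) u| <= (1 : R) by move=> u; rewrite normr1.
have := kf (cst 1) 1 (measurable_cst _) b1; rewrite Rintegral_cst// mul1r.
rewrite -(Rintegral_circle _ kc) (@eq_RintegralL _ _ _ k) => [h|u _]; last by rewrite mulr1.
have ikc : leb.-integrable circle (EFin \o k) by apply: integrableS ik => //; exact: mcircle.
rewrite -[LHS]fineK; last exact: (integrable_fin_num mcircle ikc).
rewrite -[RHS]fineK; last by rewrite ge0_fin_numE ?measure_ge0//; exact: le_lt_trans (mub x) (ltry _).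
by rewrite -h.
Qed.

Lemma solution_integrable t x : 0 <= t -> leb.-integrable circle (fun u => (solution t u x)%:E).
Proof.
move=> t0; apply/integrableP; split.
  by apply/measurable_EFinP; apply: measurable_funTS; exact: measurable_solution1.
under eq_integral do rewrite abse_EFin.
rewrite solution_mass//; exact: le_lt_trans (mub x) (ltry _).
Qed.
End existence.

Section fmeas.
Local Open Scope ereal_scope.
Context d (T : measurableType d) (R : realType).
Variables (k : {measure set T -> \bar R}) (kf : k setT < +oo).

(* Fibers of kernels are only declared as measures; this makes a finite one
   canonically finite. *)
Definition fmeas of k setT < +oo : set T -> \bar R := k.

Let fmeas_finite : fin_num_fun (fmeas kf).
Proof.
move=> A mA; rewrite /fmeas ge0_fin_numE ?measure_ge0//; apply: le_lt_trans kf.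
by apply: le_measure; rewrite ?inE.
Qed.

HB.instance Definition _ := Measure.on (fmeas kf).
HB.instance Definition _ := Measure_isFinite.Build _ _ _ (fmeas kf) fmeas_finite.
End fmeas.

Section tonelli.
Local Open Scope ereal_scope.
Context d1 d2 (T1 : measurableType d1) (T2 : measurableType d2) (R : realType).
Variables (m1 : {sigma_finite_measure set T1 -> \bar R}) (m2 : {sigma_finite_measure set T2 -> \bar R}).

Lemma tonelli (A : set T1) (f : T1 -> T2 -> \bar R) : measurable A -> (forall x y, 0 <= f x y) ->
  measurable_fun setT (fun p : T1 * T2 => f p.1 p.2) ->
  \int[m1]_(x in A) \int[m2]_y f x y = \int[m2]_y \int[m1]_(x in A) f x y.
Proof.
move=> mA f0 mf.
pose g (p : T1 * T2) := (fun p : T1 * T2 => f p.1 p.2) \_ (A `*` setT) p.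
have mAB : measurable (A `*` [set: T2]) by apply: measurableX.
have mg : measurable_fun setT g by apply/(measurable_restrictT _ mAB); exact: measurable_funTS.
have g0 p : 0 <= g p by rewrite /g patchE; case: ifP.
have gE x y : g (x, y) = if x \in A then f x y else 0 by rewrite /g patchE in_setX in_setT andbT.
have := @fubini_tonelli _ _ _ _ _ m1 m2 g mg g0; rewrite /fubini_F /fubini_G => E.
transitivity (\int[m1]_x \int[m2]_y g (x, y)).
  rewrite integral_mkcond; apply: eq_integral => x _; rewrite patchE; case: ifPn => xA.
    by apply: eq_integral => y _; rewrite gE xA.
  by rewrite integral0_eq// => y _; rewrite gE (negbTE xA).
rewrite E; apply: eq_integral => y _; rewrite [RHS]integral_mkcond.
by apply: eq_integral => x _; rewrite gE patchE.
Qed.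
End tonelli.

(** * Exchange of node and circle integrals *)

Section frozen_time.
Context {d : measure_display} {Omega : measurableType d} {R : realType}.
Local Notation leb := (@lebesgue_measure R).
Local Notation mR := (measurableTypeR R).
Variables (k : {measure set Omega -> \bar R}) (kf : (k setT < +oo)%E).
Variable r : R -> Omega -> R.
Hypothesis mr : measurable_fun setT (fun p : mR * Omega => r p.1 p.2).

Lemma tonelli_circle : (\int[leb]_(v in circle) \int[k]_y `|r v y|%:E = \int[k]_y \int[leb]_(v in circle) `|r v y|%:E)%E.
Proof.
apply: (@tonelli _ _ mR Omega R leb (fmeas kf) circle (fun v y => `|r v y|%:E)) => //; first exact: mcircle.
by apply/measurable_EFinP; exact: measurableT_comp.
Qed.

Lemma measurable_act : measurable_fun setT ((fun v => \int[k]_y r v y) : mR -> R).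
Proof. exact: (@measurable_Rintegral _ _ mR Omega R (fmeas kf) setT r). Qed.

Lemma act_ae_integrable : (\int[leb]_(v in circle) \int[k]_y `|r v y|%:E < +oo)%E ->
  {ae leb, forall v : mR, circle v -> k.-integrable setT (EFin \o r v)}.
Proof.
move=> fin; pose G v := (\int[k]_y `|r v y|%:E)%E.
have mG : measurable_fun setT (G : mR -> \bar R).
  apply: (@measurable_ge0_integral _ _ mR Omega R (fmeas kf) setT (fun v y => `|r v y|%:E)) => //.
  by apply/measurable_EFinP; exact: measurableT_comp.
have G0 v : (0 <= G v)%E by apply: integral_ge0.
have iG : leb.-integrable circle G.
  apply/integrableP; split; first exact: measurable_funTS.
  by under eq_integral do rewrite gee0_abs//.
apply: filterS (integrable_ae mcircle iG) => v hv cv; have := hv cv; rewrite ge0_fin_numE// => lt.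
apply/integrableP; split; last by [].
by apply/measurable_EFinP; exact: measurable_pair1 mr.
Qed.

(** Moves the average over nodes outside, so that the inner integral is over the circle at a single
    node. The factor [h v] may enter the node integral where that converges absolutely, which is the
    case for almost every [v]. *)
Lemma velocity_swap (h : R -> R) (B : R) : measurable_fun setT (h : mR -> R) -> (forall v, `|h v| <= B) ->
  (\int[leb]_(v in circle) \int[k]_y `|r v y|%:E < +oo)%E ->
  \int[leb]_(v in circle) ((\int[k]_y r v y) * h v) = \int[k]_y \int[leb]_(v in circle) (r v y * h v).
Proof.
move=> mh hB fin.
have mrh : measurable_fun setT (fun p : mR * Omega => r p.1 p.2 * h p.1).
  by apply: measurable_funM => //; exact: (measurableT_comp mh measurable_fst).
have B0 : 0 <= B by apply: le_trans (hB 0).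
transitivity (\int[leb]_(v in circle) \int[k]_y (r v y * h v)).
  apply: (@ae_eq_Rintegral _ mR R leb) => //; first exact: mcircle.
  - by apply: measurable_funTS; apply: measurable_funM => //; exact: measurable_act.
  - by apply: measurable_funTS; exact: (@measurable_Rintegral _ _ mR Omega R (fmeas kf) setT (fun v y => r v y * h v)).
  - by apply: filterS (act_ae_integrable fin) => v hv cv; rewrite (RintegralZr _ measurableT (hv cv)).
apply: (@RFubini _ _ mR Omega R leb (fmeas kf) circle setT (fun v y => r v y * h v) mcircle measurableT mrh).
pose G v := (\int[k]_y `|r v y|%:E)%E.
have mG : measurable_fun setT (G : mR -> \bar R).
  apply: (@measurable_ge0_integral _ _ mR Omega R (fmeas kf) setT (fun v y => `|r v y|%:E)) => //.
  by apply/measurable_EFinP; exact: measurableT_comp.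
have G0 v : (0 <= G v)%E by apply: integral_ge0.
apply: (@le_lt_trans _ _ (\int[leb]_(v in circle) (B%:E * G v))%E).
  apply: ge0_le_integral => //; first exact: mcircle.
  - by move=> v _; apply: integral_ge0.
  - apply: measurable_funTS.
    apply: (@measurable_ge0_integral _ _ mR Omega R (fmeas kf) setT (fun v y => `|r v y * h v|%:E)) => //.
    by apply/measurable_EFinP; exact: measurableT_comp.
  - by apply: measurable_funTS; apply: emeasurable_funM.
  move=> v _; rewrite /G -ge0_integralZl//.
  - apply: ge0_le_integral => //.
    + by apply/measurable_EFinP; apply: measurableT_comp => //; exact: (measurable_pair1 (H := fun v y => r v y * h v) v mrh).
    + apply: emeasurable_funM => //; apply/measurable_EFinP; apply: measurableT_comp => //; exact: measurable_pair1 mr.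
    by move=> y _; rewrite -EFinM lee_fin normrM mulrC ler_wpM2r.
  - by apply/measurable_EFinP; apply: measurableT_comp => //; exact: measurable_pair1 mr.
rewrite ge0_integralZl//; [|exact: mcircle|exact: measurable_funTS].
by apply: lte_mul_pinfty.
Qed.
End frozen_time.

(** * Test functions along curves *)

Section test_functions.
Context {R : realType}.
Local Notation leb := (@lebesgue_measure R).
Local Notation mR := (measurableTypeR R).

Lemma is_derive_of_cvg (f : R -> R) (t l : R) :
  (fun h => h^-1 * (f (t + h) - f t)) @ (0 : R)^' --> l -> is_derive t (1 : R) f l.
Proof.
move=> hl.
have E : (fun h : R => h^-1 *: ((f \o shift t) (h *: (1 : R)) - f t)) = (fun h => h^-1 * (f (t + h) - f t)).
  apply/funext => h; rewrite /= (_ : h *: (1 : R) = h); last exact: mulr1.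
  exact: (congr1 (fun z => h^-1 * (f z - f t)) (addrC h t)).
have hl' : (fun h : R => h^-1 *: ((f \o shift t) (h *: (1 : R)) - f t)) @ (0 : R)^' --> l by rewrite E.
split; first by apply/cvg_ex; exists l.
by apply/cvg_lim.
Qed.

Lemma is_derive_unique (f : R -> R) (t a c : R) : is_derive t (1 : R) f a -> is_derive t (1 : R) f c -> a = c.
Proof. by move=> [_ <-] [_ <-]. Qed.

Lemma rectangle_bounded (f : R * R -> R) (a b c e : R) : continuous f ->
  exists B : R, forall t u, a <= t <= b -> c <= u <= e -> `|f (t, u)| <= B.
Proof.
move=> cf.
have cK : compact (`[a, b]%classic `*` `[c, e]%classic : set (R * R)).
  by apply: compact_setX; exact: segment_compact.
have /compact_bounded [B [_ hB]] : compact (f @` (`[a, b]%classic `*` `[c, e]%classic)).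
  by apply: continuous_compact => //; exact: continuous_subspaceT.
exists (B + 1) => t u tab uce; apply: (hB (B + 1)); first by rewrite ltrDl.
by exists (t, u) => //; split; rewrite /= in_itv.
Qed.

Section test_function.
Variables (T : R) (w wt wu : R -> R -> R).
Hypothesis T0 : 0 < T.
Hypothesis tw : test_function T w wt wu.

Let cl t := clamp T t.

Lemma test_clamp_continuous (f : R -> R -> R) : {within `[0, T] `*` setT, continuous (fun p : R * R => f p.1 p.2)} ->
  continuous (fun p : R * R => f (clamp T p.1) p.2).
Proof.
move=> /subspace_continuousP cf p.
pose c (p : R * R) := (clamp T p.1, p.2).
have cp : (`[0, T] `*` setT) (c p) by split => //=; rewrite in_itv/= clamp_itv// ltW.
have := cf _ cp => h.
have -> : (fun p : R * R => f (clamp T p.1) p.2) = (fun p : R * R => f p.1 p.2) \o c by [].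
apply: cvg_comp h.
have c1 : (fun q : R * R => clamp T q.1) @ p --> clamp T p.1.
  apply: (@cvg_comp _ _ _ fst (clamp T) _ (nbhs p.1)); first exact: cvg_fst.
  exact: clamp_continuous.
have c2 : (fun q : R * R => q.2) @ p --> p.2 by exact: cvg_snd.
have cc : c @ p --> c p by exact: (cvg_pair c1 c2).
move=> A; rewrite /within/= => hA.
have h2 : nbhs p (c @^-1` [set q | (`[0, T] `*` setT) q -> A q]) := cc _ hA.
apply: (@filterS _ (nbhs p) _ _ _ _ h2) => q /=; apply.
by split => //; rewrite /c/= in_itv/=; apply: clamp_itv; exact: ltW.
Qed.

Lemma test_clamp_periodic t : periodic2pi (w (clamp T t)).
Proof. by case: tw => pw _ _ _ _; apply: pw; rewrite in_itv/= clamp_itv// ltW. Qed.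

Lemma test_end u : w T u = 0.
Proof.
case: tw => _ _ _ _ h; apply/eqP/negPn/negP => wu0.
have : closure [set p : R * R | p.1 \in `[0, T] /\ w p.1 p.2 != 0] (T, u).
  by apply: subset_closure; split => //=; rewrite in_itv/= lexx ltW.
by move/h; rewrite /= in_itv/= ltxx andbF.
Qed.

(** Only partial derivatives are given, so the time increment is split off as [A], taken at the
    moving position and evaluated by the mean value theorem; the joint continuity of [wt] identifies
    its limit. *)
Lemma test_chain (g : R -> R) (g' t : R) : 0 < t < T -> is_derive t (1 : R) g g' ->
  is_derive t (1 : R) (fun s => w (clamp T s) (g s)) (wt t (g t) + g' * wu t (g t)).
Proof.
move=> /andP[t0 tT] dg; case: (tw) => pw [cw cwt cwu] dwt dwu _.
have tI : t \in `[0, T] by rewrite in_itv/= !ltW.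
have d2 : is_derive t (1 : R) (fun s => w t (g s)) (wu t (g t) * g').
  by apply: dR_comp => //; exact: dwu.
have cg : {for t, continuous g} by apply/differentiable_continuous/derivable1_diffP; case: dg.
pose A s := w (clamp T s) (g s) - w t (g s).
suff d1 : is_derive t (1 : R) A (wt t (g t)).
  have := dR_add d1 d2; rewrite mulrC (_ : (fun s => _) = fun s => w (clamp T s) (g s)) => //.
  by apply/funext => s; rewrite /A subrK.
apply: is_derive_of_cvg.
have A0 : A t = 0 by rewrite /A clamp_id ?subrr// !ltW.
have cwt' := test_clamp_continuous cwt.
apply/cvgrPdist_le => eps eps0.
have /cvgrPdist_le /(_ _ eps0) [[P1 P2] /= [hP1 hP2] hP] := cwt' (t, g t).
have hg : \forall s \near t, P2 (g s) by exact: (cg _ hP2).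
have hI : \forall s \near t, 0 < s < T.
  have := @near_in_itvoo R 0 T t; rewrite in_itv/= t0 tT => /(_ isT).
  by apply: filterS => s; rewrite in_itv.
have /nbhs_ballP[e1 /= e10 he1] := hP1.
have /nbhs_ballP[e2 /= e20 he2] := hI.
have hg' : \forall h \near (0 : R), P2 (g (t + h)).
  have ch : (fun h : R => t + h) @ (0 : R) --> t.
    by rewrite -[X in _ --> X]addr0; apply: cvgD; [exact: cvg_cst|exact: cvg_id].
  exact: (ch _ hg).
pose de := Num.min e1 e2.
have de0 : 0 < de by rewrite lt_min; apply/andP; split.
have hb : \forall h \near (0 : R), `|h| < de.
  apply: (@filterS _ (nbhs (0 : R)) _ (ball (0 : R) de)); last exact: nbhsx_ballx.
  by move=> y; rewrite /ball/= sub0r normrN.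
have H : \forall h \near (0 : R), h != 0 -> `|wt t (g t) - h^-1 * (A (t + h) - A t)| <= eps; last exact: H.
near=> h => h0.
have P2h : P2 (g (t + h)) by near: h.
have he : `|h| < de by near: h.
set u := g (t + h) in P2h *.
have dI s : `|s - t| < de -> 0 < s < T.
  move=> sd; apply: he2; rewrite /ball/= distrC; apply: lt_le_trans sd _.
  by rewrite /de ge_min lexx orbT.
have cwu' : forall a c, a <= c -> 0 < a -> c < T -> {within `[a, c], continuous (w ^~ u)}.
  move=> a c ac a0 cT; apply: derivable_within_continuous => s; rewrite in_itv/= => /andP[as_ sc].
  by case: (dwt s u _) => //; rewrite in_itv/= (lt_le_trans a0)// (le_lt_trans sc).
have key a c : a < c -> 0 < a -> c < T ->
    exists2 s, a < s < c & w c u - w a u = wt s u * (c - a).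
  move=> ac a0 cT.
  have dw s : s \in `]a, c[ -> is_derive s (1 : R) (w ^~ u) (wt s u).
    rewrite in_itv/= => /andP[as_ sc]; apply: dwt; rewrite in_itv/=.
    by rewrite (lt_trans a0)// (lt_trans sc).
  have [s] := MVT ac dw (cwu' a c (ltW ac) a0 cT).
  by rewrite in_itv/= => sac E; exists s.
have th : 0 < t + h < T by apply: dI; rewrite addrAC subrr add0r.
have /andP[th0 thT] := th.
have [s sd hs] : exists2 s, `|s - t| < de & A (t + h) = wt s u * h.
  rewrite /A clamp_id ?(ltW th0) ?(ltW thT)//.
  have [hp|hn|h00] := ltgtP h 0.
  - have [|//|//|s /andP[s1 s2] E] := key (t + h) t; first by rewrite gtrDl.
    exists s; last by rewrite -/u -[LHS]opprB E; ring.
    rewrite ltr_norml; move: he; rewrite ltr_norml => /andP[hd _]; apply/andP; split; lra.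
  - have [|//|//|s /andP[s1 s2] E] := key t (t + h); first by rewrite ltrDl.
    exists s; last by rewrite -/u E; ring.
    rewrite ltr_norml; move: he; rewrite ltr_norml => /andP[_ hd]; apply/andP; split; lra.
  - by rewrite h00 eqxx in h0.
rewrite A0 subr0 hs mulrCA mulVf// mulr1.
have /andP[s0 sT] := dI s sd.
have := hP (s, u); rewrite /= (clamp_id (t := t)) ?(ltW t0) ?(ltW tT)// (clamp_id (t := s)) ?(ltW s0) ?(ltW sT)//.
apply; split => //=; apply: he1; rewrite /ball/= distrC; apply: lt_le_trans sd _.
by rewrite /de ge_min lexx.
Unshelve. all: by end_near. Qed.

(** Periodicity is given for [w] only. The combination is the derivative of [w] along a line of
    slope [V], and [w] takes the same values along that line shifted by a full turn. *)
Lemma test_periodic t z V : 0 < t < T ->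
  wt t (z + 2 * pi) + V * wu t (z + 2 * pi) = wt t z + V * wu t z.
Proof.
move=> tT; pose g s := z + V * (s - t).
have dg c : is_derive t (1 : R) (fun s => g s + c) V.
  apply: (dR_eq (dR_add (dR_add (dR_cst z t) (dR_mulc V (dR_sub (dR_id t) (dR_cst t t)))) (dR_cst c t))).
  by ring.
have gt : g t = z by rewrite /g subrr mulr0 addr0.
have d0 := test_chain tT (dg 0); have d1 := test_chain tT (dg (2 * pi)).
rewrite /= gt addr0 in d0; rewrite /= gt in d1.
apply: is_derive_unique d1 _.
rewrite (_ : (fun s => _) = fun s => w (clamp T s) (g s + 0)) //.
by apply/funext => s; rewrite test_clamp_periodic addr0.
Qed.
End test_function.
End test_functions.

Section plane.
Context {R : realType}.
Local Notation leb := (@lebesgue_measure R).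
Local Notation mR := (measurableTypeR R).

Lemma cvg_comp2 (U : Type) (F : set_system U) {FF : Filter F} (f : R * R -> R) (g h : U -> R) (a c : R) : continuous f ->
  g @ F --> a -> h @ F --> c -> (fun x => f (g x, h x)) @ F --> f (a, c).
Proof.
move=> cf ga hc; have gh : (fun x => (g x, h x)) @ F --> (a, c) by exact: (cvg_pair ga hc).
by move=> A hA; exact: (gh _ (cf (a, c) _ hA)).
Qed.

Lemma continuous_pair1 (f : R * R -> R) (t : R) : continuous f -> continuous (fun u => f (t, u)).
Proof. by move=> cf u; apply: cvg_comp2 => //; exact: cvg_cst. Qed.

(** Measurability is meant for the product of the two Borel sigma-algebras. Rounding the first
    coordinate down to multiples of [1 / (n + 1)] leaves countably many continuous sections, and [f]
    is the limit. *)
Lemma continuous_measurable2 (f : R * R -> R) : continuous f ->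
  measurable_fun setT (fun p : mR * mR => f p).
Proof.
move=> cf.
pose r (n : nat) (k : int) : R := k%:~R / n.+1%:R.
pose q n (t : R) := r n (Num.floor (t * n.+1%:R)).
have n0 (n : nat) : 0 < n.+1%:R :> R by [].
have mq n : measurable_fun setT (fun p : mR * mR => f (q n p.1, p.2)).
  move=> _ Y mY; rewrite setTI.
  rewrite (_ : _ @^-1` _ = \bigcup_(k in [set: int])
      ((fun p : mR * mR => (Num.floor (p.1 * n.+1%:R))%:~R : R) @^-1` [set k%:~R] `&`
       (fun p : mR * mR => f (r n k, p.2)) @^-1` Y)); last first.
    apply/seteqP; split => [p /= Yp|p [k _] /= [/intr_inj hk]].
      by exists (Num.floor (p.1 * n.+1%:R)).
    by rewrite /q hk.
  apply: countable_bigcupT_measurable => // k.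
  apply: measurableI; rewrite -[X in measurable X]setTI.
    have mfl : measurable_fun setT (fun p : mR * mR => (Num.floor (p.1 * n.+1%:R))%:~R : mR).
      apply: (measurableT_comp (f := fun x : R => (Num.floor x)%:~R : R)).
        by apply: nondecreasing_measurable => // x y xy; rewrite ler_int le_floor.
      by apply: measurable_funM => //; exact: measurable_fst.
    by apply: mfl => //; exact: measurable_set1.
  have mf : measurable_fun setT ((fun u => f (r n k, u)) : mR -> R).
    by apply: continuous_measurable_fun; exact: continuous_pair1.
  exact: (measurableT_comp mf measurable_snd).
apply: (measurable_fun_cvg mq) => p _.
have qc : (fun n => q n p.1) @ \oo --> (p.1 : R).
    apply: (@cvg_dist_le R _ (fun n => n.+1%:R^-1)); first exact: cvg_harmonic.
    move=> n; have := floor_itv (p.1 * n.+1%:R : R); move=> /andP[h1 h2].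
    rewrite /q /r distrC ger0_norm; last by rewrite subr_ge0 ler_pdivrMr.
    rewrite lerBlDl -[X in _ + X]mul1r -mulrDl ler_pdivlMr//.
    by move: h2; rewrite intrD1 => /ltW.
rewrite [p in f p]surjective_pairing.
by apply: (@cvg_comp2 _ \oo _ f (fun n => q n p.1) (fun=> p.2)) => //; exact: cvg_cst.
Qed.

(** For identities that are known at interior times only: the end points form a null set. *)
Lemma Rintegral_interior (f g : R -> R) (a c : R) : measurable_fun `]a, c[ (f : mR -> R) ->
  (forall t, a < t < c -> f t = g t) ->
  \int[leb]_(t in `[a, c]) f t = \int[leb]_(t in `[a, c]) g t.
Proof.
move=> mf fg; rewrite /Rintegral; congr fine.
have E t : `]a, c[%classic t -> f t = g t by rewrite /= in_itv/=; exact: fg.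
have mg : measurable_fun `]a, c[ (g : mR -> R).
  by apply: eq_measurable_fun mf => t; rewrite inE => /E.
have mf' : measurable_fun `]a, c[ (fun t : mR => (f t)%:E) by apply/measurable_EFinP.
have mg' : measurable_fun `]a, c[ (fun t : mR => (g t)%:E) by apply/measurable_EFinP.
apply: (etrans (integral_itv_bndoo true false mf')); apply: (etrans _ (esym (integral_itv_bndoo true false mg'))).
by apply: eq_integral => t; rewrite inE => /E ->.
Qed.

Lemma RFTC2_interior (f F : R -> R) (a c : R) : a < c ->
  (forall x : R, a < x < c -> is_derive x (1 : R) F (f x)) -> continuous f ->
  F @ a --> F a -> F @ c --> F c -> \int[leb]_(x in `[a, c]) f x = F c - F a.
Proof.
move=> ac dF cf Fa Fc; rewrite /Rintegral (@continuous_FTC2 _ f F)//.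
- exact: continuous_subspaceT.
- split; [by move=> x; rewrite in_itv/= => /dF; case| |].
  + by apply: cvg_at_right_filter.
  + by apply: cvg_at_left_filter.
- by move=> x; rewrite in_itv/= => /dF[_]; rewrite derive1E.
Qed.

Lemma continuous_within_eq (f g : R -> R) (T : R) : continuous g -> (forall t, 0 <= t <= T -> f t = g t) ->
  {within `[0, T], continuous f}.
Proof.
move=> cg fg; apply: (@subspace_eq_continuous _ _ _ g).
  by move=> t; rewrite inE/= in_itv/= => tt; apply: esym; exact: fg.
exact: continuous_subspaceT.
Qed.
End plane.

Lemma weight_le (R : realType) d (Omega : measurableType d) (k : {measure set Omega -> \bar R}) (g : Omega -> \bar R) (b : R) :
  (k setT <= 1)%E -> (forall y, 0 <= g y <= b%:E)%E -> measurable_fun setT g -> (\int[k]_y g y <= b%:E)%E.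
Proof.
move=> k1 gb mg.
have b0 : (0 <= b%:E)%E by have /andP[h1 h2] := gb point; exact: le_trans h1 h2.
apply: (@le_trans _ _ (\int[k]_y (cst b%:E) y)%E).
  by apply: ge0_le_integral => // y _; have /andP[] := gb y.
by rewrite integral_cst// -[leRHS]mule1 lee_wpmul2l.
Qed.

Lemma clamp_lip_continuous (R : realType) (g : R -> R) (K T : R) : 0 < K -> 0 <= T ->
  (forall s t, 0 <= s -> s <= t -> `|g t - g s| <= K * (t - s)) -> continuous (fun t => g (clamp T t)).
Proof.
move=> K0 T0 gK t; apply/cvgrPdist_le => e e0.
have := @clamp_continuous R T t; move/cvgrPdist_le => /(_ (e / K) (divr_gt0 e0 K0)).
apply: filterS => s; rewrite ler_pdivlMr// mulrC; apply: le_trans.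
have /andP[s0 _] := clamp_itv s T0; have /andP[t0 _] := clamp_itv t T0.
have [st|ts] := leP (clamp T s) (clamp T t).
  by rewrite (ger0_norm (_ : 0 <= _ - clamp T s)) ?subr_ge0//; exact: gK.
rewrite distrC (distrC (clamp T t)) (ger0_norm (_ : 0 <= clamp T s - _)) ?subr_ge0 ?(ltW ts)//.
by apply: gK => //; exact: ltW.
Qed.

Lemma density_Rintegral (R : realType) (mu : circle_measure R) (r0 f : R -> R) (B : R) :
  measurable_fun circle r0 ->
  (forall U : set (measurableTypeR R), measurable U -> circle_mu mu U = (\int[@lebesgue_measure R]_(u in U `&` circle) (r0 u)%:E)%E) ->
  measurable_fun setT (f : measurableTypeR R -> R) -> (forall u, `|f u| <= B) ->
  \int[circle_mu mu]_u f u = \int[@lebesgue_measure R]_(u in circle) (f u * r0 u).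
Proof.
move=> mr0 mur0 mf fB; have [k [k0 kc ik _ [kf rk]]] := circle_density mr0 mur0.
by rewrite (kf f B)// (Rintegral_density mr0 mf fB (RintegrableP measurableT ik) kc rk).
Qed.

Section existence.
Context {d : measure_display} {Omega : measurableType d} {R : realType}.
Local Notation leb := (@lebesgue_measure R).
Local Notation mR := (measurableTypeR R).
Variables (C b : R) (D : R -> R) (knu : R.-fker Omega ~> Omega) (kmu : R.-fker Omega ~> mR).
Hypotheses (C0 : 0 < C) (b0 : 0 < b).
Hypotheses (iD : interaction D).
Hypotheses (nu1 : forall x, (knu x setT <= 1%:E)%E) (mub : forall y, (kmu y setT <= b%:E)%E).
Variables (mu : Omega -> circle_measure R) (rho0 : R -> Omega -> R).
Hypothesis kmuE : forall x, kmu x = circle_mu (mu x).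
Hypothesis dens : has_density mu rho0.
Local Notation J := (mR * mR * Omega)%type.
Variable X : J -> R.
Hypothesis mX : measurable_fun setT X.
Hypothesis XE : forall t u x, X (t, u, x) = u + \int[leb]_(s in `[0, t]) mean_velocity C D knu kmu X s (X (s, u, x)) x.
Local Notation field := (mean_velocity C D knu kmu X).
Local Notation sol := (solution kmu X).

Let D1 := interaction_bound iD.
Let DL := interaction_lip iD.
Let cD := interaction_continuous iD.

Let sol_mass t x : 0 <= t -> (\int[leb]_(u in circle) `|sol t u x|%:E = kmu x setT)%E.
Proof. exact: (solution_mass C0 b0 iD nu1 mub kmuE dens mX XE). Qed.

Let sol_Rintegral t x (f : R -> R) B : 0 <= t -> measurable_fun setT (f : mR -> R) -> (forall u, `|f u| <= B) ->
  \int[leb]_(u in circle) (sol t u x * f u) = \int[kmu x]_v f (wrap (X (t, v, x))).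
Proof. exact: (solution_Rintegral C0 b0 iD nu1 mub kmuE dens mX XE). Qed.

Let msol2 t : measurable_fun setT (fun p : mR * Omega => sol t p.1 p.2).
Proof.
have mj : measurable_fun setT (fun p : mR * Omega => (t, p.1, p.2) : J) by measurable_proj.
exact: (measurableT_comp (measurable_solution kmu mX) mj).
Qed.

Let kf x : (knu x setT < +oo)%E. Proof. exact: le_lt_trans (nu1 x) (ltry _). Qed.

Lemma solution_act t x : 0 <= t ->
  (\int[leb]_(u in circle) \int[knu x]_y `|sol t u y|%:E = \int[knu x]_y kmu y setT)%E.
Proof.
move=> t0; rewrite (tonelli_circle (kf x) (msol2 t)).
by apply: eq_integral => y _; rewrite sol_mass.
Qed.

Lemma solution_act_bound t x : 0 <= t -> (\int[leb]_(u in circle) \int[knu x]_y `|sol t u y|%:E <= b%:E)%E.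
Proof.
move=> t0; rewrite solution_act//; apply: weight_le => //; first by move=> y; rewrite measure_ge0 mub.
by apply: measurable_kernel.
Qed.

(** This closes the loop: the velocity generated by the pushforward densities is the field that
    drives the characteristics. *)
Lemma solution_velocity t u x : 0 <= t -> velocity knu C D sol t u x = field t u x.
Proof.
move=> t0; rewrite /velocity /graphop_act /mean_velocity; congr (_ * _).
have pD : periodic2pi (fun z => D (z - u)).
  by move=> z; rewrite addrAC; exact: interaction_periodic.
have mDu : measurable_fun setT ((fun z => D (z - u)) : mR -> R).
  by apply: continuous_measurable_fun => z; apply: continuous_comp; [apply: cvgB => //; exact: cvg_cst|exact: cD].
rewrite (velocity_swap (kf x) (msol2 t) mDu (B := 1)) => //; last first.
  exact: le_lt_trans (solution_act_bound x t0) (ltry _).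
congr Rintegral; apply/funext => y; rewrite (sol_Rintegral y t0 mDu (B := 1))// /inner.
by congr Rintegral; apply/funext => v; rewrite (periodic_wrap _ pD).
Qed.

Lemma flow_time_continuous T u x : 0 <= T -> continuous (fun t => X (clamp T t, u, x)).
Proof.
move=> T0; apply: (@clamp_lip_continuous _ (fun t => X (t, u, x)) (C * b)) => //; first by rewrite mulr_gt0.
by move=> s t s0 st; exact: (flow_lip C0 b0 D1 cD nu1 mub mX XE).
Qed.

Lemma field_time_continuous T u x : 0 <= T -> continuous (fun t => field (clamp T t) (X (clamp T t, u, x)) x).
Proof.
move=> T0; have Cb : 0 < C * b by rewrite mulr_gt0.
apply: (@clamp_lip_continuous _ (fun t => field t (X (t, u, x)) x) (C * b * (2 * (C * b)))) => //.
  by rewrite !mulr_gt0.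
move=> s t s0 st; apply: le_trans (field_dist_time C0 b0 D1 DL cD nu1 mub mX XE _ _ _ s0 st) _.
rewrite [leRHS](_ : _ = C * b * (C * b * (t - s) + C * b * (t - s))); last by ring.
rewrite ler_wpM2l ?(ltW Cb)// lerD2l.
exact: (flow_lip C0 b0 D1 cD nu1 mub mX XE).
Qed.

Lemma solution_continuous T x (f : R -> R) : 0 <= T -> continuous f -> periodic2pi f ->
  {within `[0, T], continuous (fun t => \int[leb]_(u in circle) (sol t u x * f u))}.
Proof.
move=> T0 cf pf; have [B B0 fB] := periodic_bounded cf pf.
have mf : measurable_fun setT (f : mR -> R) by exact: continuous_measurable_fun.
apply: (@continuous_within_eq _ _ (fun t => \int[kmu x]_v f (X (clamp T t, v, x)))); last first.
  move=> t tT; have /andP[t0 _] := tT; rewrite (sol_Rintegral x t0 mf fB) clamp_id//.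
  by congr Rintegral; apply/funext => v; rewrite periodic_wrap.
move=> t; apply/(@cvg_nbhsP _ R^o) => tn htn.
have mfX s : measurable_fun setT (fun v : mR => f (X (clamp T s, v, x))).
  apply: (measurableT_comp mf); apply: (measurableT_comp mX); measurable_proj.
apply: (@Rdominated_cvg _ mR R (kmu x) setT (fun n v => f (X (clamp T (tn n), v, x))) _ (fun=> B)) => //.
- apply: aeW => v _; have h := cvg_comp _ _ htn (@flow_time_continuous T v x T0 t).
  exact: (cvg_comp _ _ h (cf _)).
- exact: (cst_integrable (mub x)).
Qed.
Section weak.
Variables (T : R) (w wt wu : R -> R -> R) (x : Omega).
Hypothesis T0 : 0 < T.
Hypothesis tw : test_function T w wt wu.

Let cw : continuous (fun p : R * R => w (clamp T p.1) p.2).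
Proof. by case: tw => _ [cw _ _] _ _ _; exact: test_clamp_continuous. Qed.
Let cwt : continuous (fun p : R * R => wt (clamp T p.1) p.2).
Proof. by case: tw => _ [_ h _] _ _ _; exact: test_clamp_continuous. Qed.
Let cwu : continuous (fun p : R * R => wu (clamp T p.1) p.2).
Proof. by case: tw => _ [_ _ h] _ _ _; exact: test_clamp_continuous. Qed.

Let T0' : 0 <= T. Proof. exact: ltW. Qed.

(** The integrand is the derivative of [w] along a flow line, and [w] vanishes at time [T], so only
    the initial value remains. *)
Lemma flow_material_integral (v : R) :
  \int[leb]_(t in `[0, T]) (wt (clamp T t) (X (clamp T t, v, x)) +
     field (clamp T t) (X (clamp T t, v, x)) x * wu (clamp T t) (X (clamp T t, v, x))) = - w 0 v.
Proof.
pose fl (t : R) : R := field (clamp T t) (X (clamp T t, v, x)) x.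
have cfl : continuous fl by exact: field_time_continuous.
have cX : continuous (fun t => X (clamp T t, v, x)) by exact: flow_time_continuous.
(* It agrees with the flow line on [0, T] and is differentiable at 0 as well, since its integral
   starts at -1. *)
pose P (s : R) : R := v - \int[leb]_(r in `[-1, 0]) fl r + \int[leb]_(r in `[-1, s]) fl r.
have PX (s : R) : 0 <= s <= T -> P s = X (s, v, x).
  move=> /andP[s0 sT].
  have n10 : -1 <= 0 :> R by rewrite lerN10.
  have sp := Rintegral_split n10 s0 (continuous_Rintegrable (-1) s cfl).
  have -> : P s = v + \int[leb]_(r in `[0, s]) fl r by rewrite /P sp; ring.
  have E : \int[leb]_(r in `[0, s]) fl r = \int[leb]_(r in `[0, s]) field r (X (r, v, x)) x.
    apply: eq_RintegralL => r; rewrite /= in_itv/= => /andP[r0 rs].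
    by rewrite /fl clamp_id// r0 (le_trans rs).
  exact: (etrans (congr1 (+%R v) E) (esym (XE s v x))).
have dP (s : R) : 0 <= s -> is_derive s (1 : R) P (fl s).
  move=> s0; apply: (dR_eq (dR_add (dR_cst _ s) (is_derive_primitive cfl _))); last by rewrite add0r.
  by rewrite (lt_le_trans _ s0)// ltrN10.
have cP (s : R) : 0 <= s -> P @ s --> P s.
  by move=> /dP dPs; apply/differentiable_continuous/derivable1_diffP; case: dPs.
pose F (s : R) := w (clamp T s) (P s).
have FP (s : R) : 0 <= s <= T -> F @ s --> F s.
  move=> /andP[s0 sT]; exact: (cvg_comp2 cw (cvg_id) (cP s s0)).
have dF (s : R) : 0 < s < T -> is_derive s (1 : R) F (wt (clamp T s) (X (clamp T s, v, x)) + fl s * wu (clamp T s) (X (clamp T s, v, x))).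
  move=> sT; have /andP[s0 sT'] := sT.
  have := test_chain T0 tw sT (dP s (ltW s0)).
  by rewrite PX ?(clamp_id (t := s)) ?(ltW s0) ?(ltW sT').
rewrite (RFTC2_interior T0 dF).
- rewrite /F !clamp_id ?lexx ?T0'// (test_end T0 tw) sub0r PX ?lexx//.
  by rewrite (flow0 XE).
- move=> s; apply: cvgD; last apply: cvgM; first [exact: cfl|exact: (cvg_comp2 cwt cvg_id (cX s))|exact: (cvg_comp2 cwu cvg_id (cX s))].
- by apply: FP; rewrite lexx.
- by apply: FP; rewrite lexx T0'.
Qed.

(** The integrand of the weak formulation, pulled back to the starting point [v]. Wrapped positions
    keep [wt] and [wu] on a compact rectangle, which bounds it. *)
Let phi t v := wt (clamp T t) (wrap (X (clamp T t, v, x))) +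
  field (clamp T t) (wrap (X (clamp T t, v, x))) x * wu (clamp T t) (wrap (X (clamp T t, v, x))).

Let mphi : measurable_fun setT (fun p : mR * mR => phi p.1 p.2).
Proof.
have mcl : measurable_fun setT (clamp T : mR -> mR) by apply: continuous_measurable_fun; exact: clamp_continuous.
have mW : measurable_fun setT (fun p : mR * mR => wrap (X (clamp T p.1, p.2, x)) : mR).
  apply: (measurableT_comp measurable_wrap); apply: (measurableT_comp mX).
  apply: measurable_fun_pair; last by measurable_proj.
  apply: measurable_fun_pair; last by measurable_proj.
  by apply: (measurableT_comp mcl); measurable_proj.
have mc1 : measurable_fun setT (fun p : mR * mR => clamp T p.1 : mR).
  by apply: (measurableT_comp mcl); measurable_proj.
have mf2 : measurable_fun setT (fun p : mR * mR => field p.1 p.2 x) by exact: measurable_field2.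
have mj : measurable_fun setT (fun p : mR * mR => (p.1, wrap (X (clamp T p.1, p.2, x))) : mR * mR).
  by apply: measurable_fun_pair => //; measurable_proj.
apply: measurable_funD; first exact: (measurableT_comp (continuous_measurable2 cwt) mj).
apply: measurable_funM; last exact: (measurableT_comp (continuous_measurable2 cwu) mj).
exact: (measurableT_comp mf2 (measurable_fun_pair mc1 mW)).
Qed.

Let phi_bound : exists B : R, forall t v, `|phi t v| <= B.
Proof.
have [B1 hB1] := rectangle_bounded 0 T 0 (2 * pi) cwt.
have [B2 hB2] := rectangle_bounded 0 T 0 (2 * pi) cwu.
have Cb : 0 <= C * b by rewrite mulr_ge0// ltW.
exists (B1 + C * b * B2) => t v.
have ct := clamp_itv t T0'.
have wc : 0 <= wrap (X (clamp T t, v, x)) <= 2 * pi.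
  by have := wrap_circle (X (clamp T t, v, x)); rewrite /circle/= in_itv/= => /andP[-> /ltW ->].
have h1 := hB1 _ _ ct wc; have h2 := hB2 _ _ ct wc; rewrite /= (clamp_id ct) in h1 h2.
apply: le_trans (ler_normD _ _) _; apply: lerD => //.
by rewrite normrM ler_pM//; exact: field_bound.
Qed.

(** Pulled back to starting points and with the integrals exchanged, the space-time integral is that
    of [flow_material_integral] over the initial measure, and this cancels the initial term. *)
Lemma solution_weak_form : \int[leb]_(t in `[0, T]) \int[leb]_(u in circle)
     (sol t u x * (wt t u + velocity knu C D sol t u x * wu t u))
  + \int[leb]_(u in circle) (w 0 u * rho0 u x) = 0.
Proof.
have [B hB] := phi_bound.
have kmf : (kmu x setT < +oo)%E by exact: le_lt_trans (mub x) (ltry _).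
have [mr0 mur0] := dens x.
have B0 : 0 <= B by apply: le_trans (hB 0 0).
have hp (t : R) : 0 < t < T -> continuous (fun u => wt t u + field t u x * wu t u) /\ periodic2pi (fun u => wt t u + field t u x * wu t u).
  move=> tT; have /andP[t0 tT'] := tT; have ct : clamp T t = t by rewrite clamp_id// !ltW.
  split=> [u|u].
    have c1 : (fun u => wt (clamp T t) u) @ u --> wt (clamp T t) u by exact: (cvg_comp2 cwt (cvg_cst t) cvg_id).
    have c2 : (fun u => wu (clamp T t) u) @ u --> wu (clamp T t) u by exact: (cvg_comp2 cwu (cvg_cst t) cvg_id).
    rewrite ct in c1 c2.
    have c3 : (fun u => field t u x) @ u --> field t u x.
      apply/cvgrPdist_le => e e0; have Cb : 0 < C * b by rewrite mulr_gt0.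
      near=> z.
      apply: le_trans (field_lip C0 b0 D1 DL cD nu1 mub mX _ _ _ _) _.
      rewrite mulrC -ler_pdivlMr//; near: z.
      by apply: cvgr_dist_le; [exact: cvg_id|rewrite divr_gt0].
    by apply: cvgD => //; apply: cvgM.
  rewrite (field_periodic _ _ _ _ _ _ (interaction_periodic iD)).
  exact: (test_periodic T0 tw).
have E1 (t : R) : 0 < t < T -> \int[kmu x]_v phi t v = \int[leb]_(u in circle)
     (sol t u x * (wt t u + velocity knu C D sol t u x * wu t u)).
  move=> tT; have /andP[t0 tT'] := tT; have ct : clamp T t = t by rewrite clamp_id// !ltW.
  have [ch ph] := hp t tT; have [Bh _ hBh] := periodic_bounded ch ph.
  rewrite [RHS](_ : _ = \int[leb]_(u in circle) (sol t u x * (wt t u + field t u x * wu t u))); last first.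
    by apply: eq_RintegralL => u _; rewrite solution_velocity// ltW.
  rewrite (sol_Rintegral x (ltW t0) (continuous_measurable_fun ch) hBh).
  by congr Rintegral; apply/funext => v; rewrite /phi ct.
have mphi1 v : measurable_fun setT ((fun t => phi t v) : mR -> R) by exact: (measurable_pair2 v mphi).
rewrite -(Rintegral_interior _ E1); last first.
  apply: measurable_funTS; exact: (@measurable_Rintegral _ _ mR mR R (fmeas kmf) setT phi).
have mI : measurable (`[0, T]%classic : set mR) by exact: (mitv `[0, T]).
have fub : \int[leb]_(t in `[0, T]) \int[kmu x]_v phi t v = \int[kmu x]_v \int[leb]_(t in `[0, T]) phi t v.
  apply: (@RFubini _ _ mR mR R leb (fmeas kmf) `[0, T]%classic setT phi mI) => //.
  apply: (@iterated_lty _ _ mR mR R leb (fmeas kmf) _ _ phi (fun=> B) (fun=> 1)) => //.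
  - by apply: continuous_Rintegrable; exact: cst_continuous.
  - exact: (cst_integrable (mub x)).
  - by move=> t v _ _; rewrite mulr1.
rewrite fub.
have cw0 : continuous (w 0).
  move=> u; have h : (fun u => w (clamp T 0) u) @ u --> w (clamp T 0) u by exact: (cvg_comp2 cw (cvg_cst 0) cvg_id).
  by rewrite clamp_id ?lexx// in h.
have pw0 : periodic2pi (w 0) by have := test_clamp_periodic T0 tw 0; rewrite clamp_id ?lexx.
have [B3 _ hB3] := periodic_bounded cw0 pw0.
have mw0 := continuous_measurable_fun cw0.
rewrite [X in X + _](_ : _ = \int[kmu x]_v (- 1 * w 0 v)); last first.
  congr Rintegral; apply/funext => v; rewrite mulN1r -(flow_material_integral v).
  apply: Rintegral_interior => [|t tT]; first by apply: measurable_funTS; exact: (mphi1 v).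
  have /andP[t0 tT'] := tT; have ct : clamp T t = t by rewrite clamp_id// !ltW.
  by have [_ ph] := hp t tT; rewrite /phi ct; exact: (periodic_wrap (X (t, v, x)) ph).
rewrite RintegralZl//; last exact: (bounded_integrable (mub x) mw0 hB3).
by rewrite kmuE (density_Rintegral mr0 mur0 mw0 hB3) mulN1r addNr.
Unshelve. all: by end_near. Qed.
End weak.
End existence.

Lemma weak_solution_ext d (Omega : measurableType d) (R : realType) (m : probability Omega R)
    (nu knu : R.-ker Omega ~> Omega) (C T : R) (D : R -> R) (rho0 : R -> Omega -> R) rho :
  (forall x, nu x = knu x) -> weak_solution m nu C T D rho0 rho -> weak_solution m knu C T D rho0 rho.
Proof.
move=> nuE; have E : Kernel.sort nu = Kernel.sort knu by apply/funext.
by rewrite /weak_solution /velocity /graphop_act E.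
Qed.

Section existence.
Context {d : measure_display} {Omega : measurableType d} {R : realType}.
Local Notation leb := (@lebesgue_measure R).
Local Notation mR := (measurableTypeR R).
Variables (m : probability Omega R).
Variables (C b : R) (D : R -> R) (knu : R.-fker Omega ~> Omega) (kmu : R.-fker Omega ~> mR).
Hypotheses (C0 : 0 < C) (b0 : 0 < b).
Hypotheses (iD : interaction D).
Hypotheses (nu1 : forall x, (knu x setT <= 1%:E)%E) (mub : forall y, (kmu y setT <= b%:E)%E).
Variables (mu : Omega -> circle_measure R) (rho0 : R -> Omega -> R).
Hypothesis kmuE : forall x, kmu x = circle_mu (mu x).
Hypothesis dens : has_density mu rho0.
Local Notation J := (mR * mR * Omega)%type.
Variable X : J -> R.
Hypothesis mX : measurable_fun setT X.
Hypothesis XE : forall t u x, X (t, u, x) = u + \int[leb]_(s in `[0, t]) mean_velocity C D knu kmu X s (X (s, u, x)) x.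

Lemma solution_weak_solution T : 0 < T -> weak_solution m knu C T D rho0 (solution kmu X).
Proof.
move=> T0; split.
  exact: measurable_funTS (measurable_solution kmu mX).
apply: aeW => x; split.
- by move=> t; rewrite in_itv/= => /andP[t0 _]; exact: (solution_integrable C0 b0 iD nu1 mub kmuE dens mX XE).
- move=> t; rewrite in_itv/= => /andP[t0 _].
  exact: le_lt_trans (solution_act_bound C0 b0 iD nu1 mub kmuE dens mX XE x t0) (ltry _).
(* Both masses are constant in time for the pushforward, so the integrand is the constant [c]. *)
- pose c := (kmu x setT * \int[knu x]_y kmu y setT)%E.
  have c0 : (0 <= c)%E by rewrite mule_ge0// integral_ge0.
  have cf : (c < +oo)%E.
    have i1 : (\int[knu x]_y kmu y setT <= b%:E)%E.
      by rewrite -(solution_act C0 b0 iD nu1 mub kmuE dens mX XE x (lexx 0)); exact: (solution_act_bound C0 b0 iD nu1 mub kmuE dens mX XE).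
    by rewrite lte_mul_pinfty ?integral_ge0 ?ge0_fin_numE ?(le_lt_trans (mub x)) ?(le_lt_trans i1) ?ltry.
  rewrite (eq_integral (cst c)); last first.
    move=> t; rewrite inE/= in_itv/= => /andP[t0 _].
    by rewrite (solution_mass C0 b0 iD nu1 mub kmuE dens mX XE)// (solution_act C0 b0 iD nu1 mub kmuE dens mX XE).
  rewrite integral_cst; last exact: (mitv _).
  have E : leb (`[0, T]%classic : set mR) = T%:E.
    by apply: (etrans (lebesgue_measure_itv `[0, T])); rewrite /= lte_fin T0 oppr0 adde0.
  apply: lte_mul_pinfty => //; first by rewrite ge0_fin_numE.
  exact: (eq_ind_r (fun z => z < +oo)%E (ltry T) E).
- by move=> f cf pf; apply: (solution_continuous C0 b0 iD nu1 mub kmuE dens mX XE) => //; exact: ltW.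
- by move=> w wt wu tw; exact: (solution_weak_form C0 b0 iD nu1 mub kmuE dens mX XE x T0 tw).
Qed.
End existence.

(** * Uniqueness *)

Lemma normr_fine (R : realType) (z : \bar R) : (`|fine z|%:E <= `|z|)%E.
Proof. by case: z => [r| |] /=; rewrite ?normr0 ?leey. Qed.

Lemma normr_Rintegral_lee d (S : measurableType d) (R : realType) (k : {measure set S -> \bar R}) (D : set S) (f : S -> R) :
  measurable D -> measurable_fun D f -> (`|\int[k]_(x in D) f x|%:E <= \int[k]_(x in D) `|f x|%:E)%E.
Proof.
move=> mD mf; apply: (le_trans (normr_fine _)); apply: le_trans (le_abse_integral _ mD _) _ => //.
exact/measurable_EFinP.
Qed.

Lemma Rintegral_dist_ae d (S : measurableType d) (R : realType) (k : {measure set S -> \bar R}) (c : R)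
    (kc : (k setT <= c%:E)%E) (N : set S) (f g : S -> R) (K B : R) :
  measurable N -> k N = 0%E -> measurable_fun setT f -> measurable_fun setT g ->
  (forall u, ~ N u -> `|f u| <= B) -> (forall u, ~ N u -> `|g u| <= B) ->
  (forall u, ~ N u -> `|f u - g u| <= K) -> 0 <= B -> 0 <= K ->
  `|\int[k]_u f u - \int[k]_u g u| <= c * K.
Proof.
move=> mN N0 mf mg fB gB fg B0 K0.
have mr (h : S -> R) : measurable_fun setT h -> measurable_fun setT (h \_ (~` N)).
  by move=> mh; apply/(measurable_restrictT _ (measurableC mN)); exact: measurable_funTS.
have E (h : S -> R) : measurable_fun setT h -> \int[k]_u h u = \int[k]_u (h \_ (~` N)) u.
  move=> mh; apply: ae_eq_Rintegral => //; first exact: mr.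
  exists N; split => // u /= hu; apply: contrapT => Nu; apply: hu => _.
  by rewrite patchE mem_set.
rewrite (E f mf) (E g mg); apply: (Rintegral_dist kc (B := B)) => //; try exact: mr.
- by move=> u; rewrite patchE; case: ifPn => [/set_mem/fB//|_]; rewrite normr0.
- by move=> u; rewrite patchE; case: ifPn => [/set_mem/gB//|_]; rewrite normr0.
- by move=> u; rewrite !patchE; case: ifPn => [/set_mem/fg//|_]; rewrite subrr normr0.
Qed.

(** * Null sets of nodes *)

Section null_sets.
Context d (Omega : measurableType d) (R : realType) (m : probability Omega R).
Variables (A : LfunType m (leey (1%E : \bar R)) -> LfunType m (lexx (1%E : \bar R))).
Variable nu : R.-ker Omega ~> Omega.
Hypotheses (gA : graphop A) (fA : fiber_measures A nu).

Lemma bounded_Lfun (f : Omega -> R) (B : R) : measurable_fun setT f -> (forall x, `|f x| <= B) -> f \in Lfun m +oo%E.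
Proof.
move=> mf fB; apply/andP; split; rewrite inE//= /finite_norm unlock /Lnorm.
case: ifP => _; last exact: ltry.
by apply: le_lt_trans (ltry B); apply/ess_supP; apply: aeW => x; rewrite /= lee_fin.
Qed.

(* A null set [N] makes [1_N] and [0] the same element of [Linfty], so that the
   graphop cannot distinguish them. *)
Lemma fiber_null (N : set Omega) : measurable N -> m N = 0%E -> {ae m, forall x, nu x N = 0%E}.
Proof.
move=> mN N0; have [[[compat _] _ _ _] [nf fE]] := (gA, fA).
have h1 : (\1_N : Omega -> R) \in Lfun m +oo%E.
  by apply: (@bounded_Lfun _ 1) => // x; rewrite indicE; case: (_ \in _); rewrite ?normr1 ?normr0.
have h0 : (cst 0 : Omega -> R) \in Lfun m +oo%E.
  by apply: (@bounded_Lfun _ 0) => // x; rewrite normr0.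
pose f := Lfun_Sub (leey (1%E : \bar R)) h1; pose g := Lfun_Sub (leey (1%E : \bar R)) h0.
have fg : {ae m, forall x, f x = g x}.
  exists N; split => // x /= h; apply: contrapT => Nx; apply: h.
  by rewrite indicE memNset.
have := compat f g fg; apply: filterS3 (fE f) (fE g) => x Ef Eg; rewrite Ef Eg => E.
have : \int[nu x]_y \1_N y = 0 by rewrite (_ : \int[nu x]_y \1_N y = \int[nu x]_y f y)// E /= Rintegral_cst// mul0r.
rewrite /Rintegral integral_indic// setIT => /eqP; rewrite fine_eq0; first by move/eqP.
rewrite ge0_fin_numE ?measure_ge0//; apply: le_lt_trans (nf x).
by apply: le_measure; rewrite ?inE.
Qed.

(** Adding the nodes whose fiber charges [N] may create new such nodes. The union of all iterates is
    stable, since a node whose fiber charges one iterate belongs to the next. *)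
Lemma invariant_null (N : set Omega) : measurable N -> m N = 0%E ->
  exists N', [/\ measurable N', m N' = 0%E, N `<=` N' & forall x, ~ N' x -> nu x N' = 0%E].
Proof.
move=> mN N0.
pose F M := M `|` [set x | nu x M != 0%E].
have hF M : measurable M -> m M = 0%E -> measurable (F M) /\ m (F M) = 0%E.
  move=> mM M0.
  have mP : measurable [set x | nu x M != 0%E].
    rewrite (_ : [set x | _] = setT `&` (nu ^~ M) @^-1` (~` [set 0%E])); last first.
      by rewrite setTI; apply/seteqP; split => x /=; [move/eqP|move=> h; apply/eqP].
    by apply: (measurable_kernel nu M mM measurableT); apply: measurableC; exact: emeasurable_set1.
  have P0 : m [set x | nu x M != 0%E] = 0%E.
    have [Q [mQ Q0 hQ]] := fiber_null mM M0.
    by apply: (subset_measure0 mP mQ _ Q0) => x /= h; apply: hQ => /= E; rewrite E eqxx in h.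
  split; first exact: measurableU.
  by apply: null_set_setU.
pose Nn n := iter n F N.
have hN n : measurable (Nn n) /\ m (Nn n) = 0%E.
  by elim: n => [|n [mn n0]] //=; exact: hF.
exists (\bigcup_n Nn n); split.
- by apply: bigcup_measurable => n _; have [] := hN n.
- apply/negligibleP; first by apply: bigcup_measurable => n _; have [] := hN n.
  by apply: negligible_bigcup => n; have [mn n0] := hN n; apply/negligibleP.
- by move=> x Nx; exists 0.
- move=> x hx; apply/negligibleP; first by apply: bigcup_measurable => n _; have [] := hN n.
  apply: negligible_bigcup => n; have [mn _] := hN n; apply/negligibleP => //.
  apply/eqP; apply: contrapT => /negP h; apply: hx; exists n.+1 => //=.
  by right.
Qed.
End null_sets.

Section transport_density.
Context {R : realType}.
Local Notation leb := (@lebesgue_measure R).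
Local Notation mR := (measurableTypeR R).
Variables (mu : circle_measure R) (r0 : R -> R).
Hypothesis mr0 : measurable_fun circle r0.
Hypothesis mur0 : forall U : set mR, measurable U -> circle_mu mu U = (\int[leb]_(u in U `&` circle) (r0 u)%:E)%E.

Lemma density_integrable : leb.-integrable circle (EFin \o r0).
Proof.
have [k [k0 kc ik _ [_ rk]]] := circle_density mr0 mur0.
have ikc : leb.-integrable circle (EFin \o k) by apply: integrableS ik => //; exact: mcircle.
have me : measurable_fun circle (EFin \o r0) by apply/measurable_EFinP.
apply/integrableP; split => //.
apply: (@le_lt_trans _ _ (\int[leb]_(u in circle) `|(k u)%:E|)%E); last by have /integrableP[] := ikc.
rewrite le_eqVlt; apply/orP; left; apply/eqP; apply: ae_eq_integral => //.
- exact: mcircle.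
- exact: measurableT_comp.
- by apply: measurableT_comp => //; exact: (measurable_int leb ikc).
- by apply: filterS rk => u h cu; rewrite /= h.
Qed.

Variables (T : R) (rho V : R -> R -> R) (l : R -> R).
Hypothesis T0 : 0 < T.
Hypothesis tr : transport T rho V l.

Section weak.
Hypothesis weak : forall w wt wu, test_function T w wt wu ->
     \int[leb]_(t in `[0, T]) \int[leb]_u (rho t u * (wt t u + V t u * wu t u))
     + \int[leb]_(u in circle) (w 0 u * r0 u) = 0.

Lemma weak_transport_eq : transport_eq T rho V.
Proof.
move=> f f' pf pf' df cf' s t s0 st tT.
have E := transport_weak tr T0 density_integrable weak pf pf' df cf'.
have t0 : 0 <= t by exact: le_trans st.
rewrite (E t) ?t0// (E s) ?s0 ?(le_trans st)//.
have [B B0 hB] := periodic_bounded cf' pf'.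
have mF : measurable_fun setT (fun p : mR * mR => f' p.2).
  by apply: measurableT_comp => //; exact: continuous_measurable_fun.
have il := tr_iV tr (F := fun _ u => f' u) (lexx 0) tT mF (fun _ u => hB u).
by rewrite (Rintegral_split s0 st il); ring.
Qed.

Lemma weak_initial (f f' : R -> R) : (forall x : R, is_derive x (1 : R) f (f' x)) -> continuous f' ->
  periodic2pi f -> periodic2pi f' -> \int[leb]_u (rho 0 u * f u) = \int[leb]_(u in circle) (f u * r0 u).
Proof.
move=> df cf' pf pf'.
rewrite (transport_weak tr T0 density_integrable weak pf pf' df cf'); last by rewrite lexx ltW.
by rewrite set_itv1 Rintegral_set1 addr0.
Qed.
End weak.

Section positive.
Hypothesis treq : transport_eq T rho V.
Hypothesis init : forall f f' : R -> R, (forall x : R, is_derive x (1 : R) f (f' x)) -> continuous f' ->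
  periodic2pi f -> periodic2pi f' -> \int[leb]_u (rho 0 u * f u) = \int[leb]_(u in circle) (f u * r0 u).

(** The initial density is nonnegative, hence so is the density at time [t] by [transport_nonneg];
    its mass is then its integral, which is conserved. *)
Lemma transport_mass t : 0 <= t <= T -> (\int[leb]_u `|rho t u|%:E = circle_mu mu setT)%E.
Proof.
move=> tT; have [k [k0 kc ik kA [kf rk]]] := circle_density mr0 mur0.
have T00 : 0 <= (0 : R) <= T by rewrite lexx ltW.
have Z : 0 <= (0 : R) <= 0 by rewrite lexx.
have mk := RintegrableP measurableT ik.
have c0 z : cdf rho 0 z = cdf (fun=> k) 0 z.
  apply: (cdf_test_eq (tr_irho tr T00) ik (fun u => @tr_circle _ _ _ _ _ tr 0 u) kc) => g g' dg cg' pg pg'.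
  have [B' _ gB] := periodic_bounded (dR_continuous dg) pg.
  have mg : measurable_fun setT (g : mR -> R) by apply: continuous_measurable_fun; exact: (dR_continuous dg).
  by rewrite (init dg cg' pg pg') (Rintegral_density mr0 mg gB mk kc rk).
have ae : {ae leb, forall u : mR, 0 <= rho t u}.
  apply: (transport_nonneg tr treq tT) => x y x0 xy yp; rewrite !c0.
  rewrite !(cdf_lt (static_transport 0 ik kc))// ?x0 ?yp ?(le_trans xy) ?(le_trans x0)//.
  have ib z : leb.-integrable setT (EFin \o (fun u : mR => k u * (u < z)%R%:R)).
    apply: (RintegrableMr (k := 1) measurableT ik) => [|u _].
      by apply: Rmeasurable_bool; exact: measurable_fun_ltr.
    by case: (u < z)%R; rewrite ?normr1 ?normr0.
  apply: le_Rintegral => // u _; rewrite ler_wpM2l// ler_nat.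
  by case: ltP => // /lt_le_trans ->.
have mr := tr_mrho1 tr t; have ir := tr_irho tr tT.
have one : forall u : R, `|cst (1 : R) u| <= 1 by move=> u; rewrite normr1.
have E : \int[leb]_u rho t u = fine (circle_mu mu setT).
  have /andP[t0 tT'] := tT.
  rewrite (mass_conserved treq (lexx 0) t0 tT').
  rewrite (_ : \int[leb]_u rho 0 u = \int[leb]_u (rho 0 u * cst 1 u)); last first.
    by apply: eq_RintegralL => u _; rewrite mulr1.
  rewrite (init (f := cst 1) (f' := cst 0))//; last exact: cst_continuous.
  rewrite -(density_Rintegral mr0 mur0 (measurable_cst _) one).
  by rewrite Rintegral_cst// mul1r.
transitivity (\int[leb]_u (rho t u)%:E)%E.
  apply: ae_eq_integral => //.
  - by apply/measurable_EFinP; exact: measurableT_comp.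
  - exact/measurable_EFinP.
  - by apply: filterS ae => u u0 _; rewrite ger0_norm.
rewrite -[LHS]fineK; last exact: (integrable_fin_num measurableT ir).
rewrite -[RHS]fineK; last by rewrite fin_num_measure.
by rewrite -E.
Qed.
End positive.
End transport_density.

Section frozen_velocity.
Context {d : measure_display} {Omega : measurableType d} {R : realType}.
Local Notation leb := (@lebesgue_measure R).
Local Notation mR := (measurableTypeR R).
Variables (k : {measure set Omega -> \bar R}) (kf : (k setT < +oo)%E).
Variable r : R -> Omega -> R.
Hypothesis mr : measurable_fun setT (fun p : mR * Omega => r p.1 p.2).
Hypothesis fin : (\int[leb]_(v in circle) \int[k]_y `|r v y|%:E < +oo)%E.

Lemma act_norm_le : (\int[leb]_(v in circle) `|\int[k]_y r v y|%:E <= \int[leb]_(v in circle) \int[k]_y `|r v y|%:E)%E.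
Proof.
apply: ge0_le_integral => //; first exact: mcircle.
- apply/measurable_EFinP; apply: measurable_funTS; apply: measurableT_comp => //; exact: measurable_act.
- apply: measurable_funTS.
  apply: (@measurable_ge0_integral _ _ mR Omega R (fmeas kf) setT (fun v y => `|r v y|%:E)) => //.
  by apply/measurable_EFinP; exact: measurableT_comp.
- by move=> v _; apply: normr_Rintegral_lee => //; exact: measurable_pair1 mr.
Qed.

Lemma act_integrable : leb.-integrable circle (EFin \o (fun v => \int[k]_y r v y)).
Proof.
apply/integrableP; split.
  by apply/measurable_EFinP; apply: measurable_funTS; exact: measurable_act.
by apply: le_lt_trans fin; exact: act_norm_le.
Qed.

Lemma act_bound (h : R -> R) (B : R) : measurable_fun setT (h : mR -> R) -> (forall v, `|h v| <= B) ->
  `|\int[leb]_(v in circle) ((\int[k]_y r v y) * h v)| <= fine (\int[leb]_(v in circle) \int[k]_y `|r v y|%:E)%E * B.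
Proof.
move=> mh hB; have B0 : 0 <= B by exact: le_trans (hB 0).
have ma := measurable_act kf mr.
apply: (@le_trans _ _ (\int[leb]_(v in circle) (`|\int[k]_y r v y| * B))).
  apply: (normr_Rintegral_le mcircle).
  - by apply: measurable_funTS; apply: measurable_funM.
  - by move=> v _; rewrite normrM ler_wpM2l.
  - by apply: RintegrableZr; [exact: mcircle|exact: (integrable_norm act_integrable)].
rewrite (RintegralZr _ mcircle (integrable_norm act_integrable)) ler_wpM2r//.
apply: fine_le; last exact: act_norm_le.
- exact: (integrable_fin_num mcircle (integrable_norm act_integrable)).
- by rewrite ge0_fin_numE// integral_ge0// => v _; apply: integral_ge0.
Qed.
End frozen_velocity.

(** * Extension of a weak solution by zero *)

Section patch.
Context {d : measure_display} {Omega : measurableType d} {R : realType}.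
Local Notation leb := (@lebesgue_measure R).
Local Notation mR := (measurableTypeR R).
Local Notation J := (mR * mR * Omega)%type.
Variables (m : probability Omega R) (C T : R) (D : R -> R) (knu : R.-fker Omega ~> Omega) (rho : R -> R -> Omega -> R).
Hypotheses (C0 : 0 < C) (T0 : 0 < T) (iD : interaction D).
Hypothesis nu1 : forall x, (knu x setT <= 1%:E)%E.
Hypothesis mrho : measurable_fun [set p : J | p.1.1 \in `[0, T] /\ circle p.1.2] (fun p => rho p.1.1 p.1.2 p.2).

(** A weak solution is constrained on [0, T] times the circle only; extended by zero it is
    measurable everywhere and vanishes off the circle, as [transport] asks. *)
Definition patch (t u : R) (x : Omega) : R :=
  if (t \in `[0, T]) && (u \in `[0, 2 * pi[) then rho t u x else 0.

Lemma patch_in t u x : 0 <= t <= T -> circle u -> patch t u x = rho t u x.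
Proof. by move=> tT cu; rewrite /patch in_itv/= tT; move: cu; rewrite /circle/= => ->. Qed.

Lemma patch_circle t u x : ~ circle u -> patch t u x = 0.
Proof. by rewrite /patch /circle/=; case: (u \in _); rewrite ?andbF// => /(_ isT). Qed.

Lemma patch_time t u x : ~~ (0 <= t <= T) -> patch t u x = 0.
Proof. by rewrite /patch in_itv/= => /negbTE ->. Qed.

Lemma measurable_patch : measurable_fun setT (fun p : J => patch p.1.1 p.1.2 p.2).
Proof.
have := mrho; set S := [set p : J | _] => mrho'.
have mS : measurable S.
  rewrite (_ : S = (fun p : J => p.1.1) @^-1` `[0, T]%classic `&` (fun p : J => p.1.2) @^-1` circle)//.
  apply: measurableI; rewrite -[X in measurable X]setTI.
    have m1 : measurable_fun setT (fun p : J => p.1.1) by measurable_proj.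
    by apply: m1 => //; exact: (mitv `[0, T]).
  have m2 : measurable_fun setT (fun p : J => p.1.2) by measurable_proj.
  by apply: m2 => //; exact: mcircle.
have := (measurable_restrictT _ mS).1 mrho'.
apply: eq_measurable_fun => p _; rewrite patchE /patch.
case: ifPn => [/set_mem [-> cu]|h]; first by move: cu; rewrite /circle/= => ->.
by case: ifPn => // /andP[h1 h2]; move: h; rewrite mem_set//.
Qed.

Let kf x : (knu x setT < +oo)%E. Proof. exact: le_lt_trans (nu1 x) (ltry _). Qed.

Let mpatch2 t : measurable_fun setT (fun p : mR * Omega => patch t p.1 p.2).
Proof.
have mj : measurable_fun setT (fun p : mR * Omega => (t, p.1, p.2) : J) by measurable_proj.
exact: (measurableT_comp measurable_patch mj).
Qed.

(** The mass that node [x] sees through its fiber; times [C] it bounds the velocity at [x] and its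
    Lipschitz constant. *)
Definition act_mass (t : R) (x : Omega) : \bar R := (\int[leb]_(u in circle) \int[knu x]_y `|patch t u y|%:E)%E.

Lemma act_mass_ge0 t x : (0 <= act_mass t x)%E.
Proof. by apply: integral_ge0 => u _; apply: integral_ge0. Qed.

Lemma measurable_act_mass x : measurable_fun setT ((act_mass ^~ x) : mR -> \bar R).
Proof.
apply: (@measurable_ge0_integral _ _ mR mR R leb circle (fun t u => (\int[knu x]_y `|patch t u y|%:E)%E)).
- exact: mcircle.
- by move=> t u; apply: integral_ge0.
apply: (@measurable_ge0_integral _ _ (mR * mR)%type Omega R (fmeas (kf x)) setT (fun p y => `|patch p.1 p.2 y|%:E)) => //.
by apply/measurable_EFinP; apply: measurableT_comp => //; exact: measurable_patch.
Qed.

Lemma velocity_patch t u x : 0 <= t <= T -> velocity knu C D patch t u x = velocity knu C D rho t u x.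
Proof.
move=> tT; apply: (congr1 ( *%R C)); apply: eq_RintegralL => v cv; apply: (congr1 ( *%R^~ _)).
by rewrite /graphop_act; congr Rintegral; apply/funext => y; rewrite patch_in.
Qed.

Section node.
Variable x : Omega.
Hypothesis h1 : forall t, t \in `[0, T] -> leb.-integrable circle (fun u => (rho t u x)%:E).
Hypothesis h2 : forall t, t \in `[0, T] -> (\int[leb]_(u in circle) \int[knu x]_y `|rho t u y|%:E < +oo)%E.
Hypothesis h3 : (\int[leb]_(t in `[0%R, T])
           ((\int[leb]_(u in circle) `|rho t u x|%:E) *
            (\int[leb]_(u in circle) \int[knu x]_y `|rho t u y|%:E)) < +oo)%E.
Hypothesis h4 : forall f : R -> R, continuous f -> periodic2pi f ->
          {within `[0, T], continuous
            (fun t => \int[leb]_(u in circle) (rho t u x * f u))}.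

Lemma act_mass_fin t : (act_mass t x < +oo)%E.
Proof.
have [tT|tT] := boolP (0 <= t <= T).
  have : t \in `[0, T] by rewrite in_itv.
  move/h2; apply: le_lt_trans; rewrite le_eqVlt; apply/orP; left; apply/eqP.
  apply: eq_integral => u /set_mem cu; apply: eq_integral => y _; by rewrite patch_in.
rewrite /act_mass integral0_eq// => u _; rewrite integral0_eq// => y _.
by rewrite patch_time// normr0.
Qed.

Lemma patch_velocity_bound t u : `|velocity knu C D patch t u x| <= C * fine (act_mass t x).
Proof.
rewrite /velocity normrM (gtr0_norm C0) ler_wpM2l ?(ltW C0)// -[leRHS]mulr1.
apply: (act_bound (kf x) (mpatch2 t) (act_mass_fin t)) => [|v]; last exact: interaction_bound.
apply: continuous_measurable_fun => z; apply: continuous_comp; last exact: (interaction_continuous iD).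
by apply: cvgB => //; exact: cvg_cst.
Qed.

Lemma patch_velocity_lip t u v : `|velocity knu C D patch t u x - velocity knu C D patch t v x| <= C * fine (act_mass t x) * `|u - v|.
Proof.
have mD w : measurable_fun setT ((fun z => D (z - w)) : mR -> R).
  apply: continuous_measurable_fun => z; apply: continuous_comp; last exact: (interaction_continuous iD).
  by apply: cvgB => //; exact: cvg_cst.
have ia := act_integrable (kf x) (mpatch2 t) (act_mass_fin t).
have iaD w := RintegrableMr mcircle ia (measurable_funTS (mD w)) (fun z _ => interaction_bound iD (z - w)).
rewrite /velocity -mulrBr normrM (gtr0_norm C0) -mulrA ler_wpM2l ?(ltW C0)//.
rewrite /graphop_act -(RintegralB mcircle (iaD u) (iaD v)).
rewrite (@eq_RintegralL _ _ _ (fun z => (\int[knu x]_y patch t z y) * (D (z - u) - D (z - v)))) => [|z _]; last by rewrite mulrBr.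
apply: (act_bound (kf x) (mpatch2 t) (act_mass_fin t)); first exact: measurable_funB.
move=> z; apply: le_trans (interaction_lip iD _ _) _.
by rewrite (_ : z - u - (z - v) = - (u - v)) ?normrN//; ring.
Qed.

(** With [C] times [act_mass] as the speed bound, the integrability [tr_Nl] is, up to the factor
    [C], the third clause of the definition of weak solutions. *)
Lemma patch_transport : transport T (fun t u => patch t u x) (fun t u => velocity knu C D patch t u x)
  (fun t => C * fine (act_mass t x)).
Proof.
have mp : measurable_fun setT (fun p : mR * mR => patch p.1 p.2 x).
  have mj : measurable_fun setT (fun p : mR * mR => (p.1, p.2, x) : J) by measurable_proj.
  exact: (measurableT_comp measurable_patch mj).
have ml : measurable_fun setT ((fun t => C * fine (act_mass t x)) : mR -> mR).
  by apply: measurable_funM => //; apply: measurableT_comp => //; exact: measurable_act_mass.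
have circE t (F : R -> R) : \int[leb]_u (patch t u x * F u) = \int[leb]_(u in circle) (patch t u x * F u).
  by rewrite (Rintegral_circle (k := fun u => patch t u x))// => u; exact: patch_circle.
have ip t : 0 <= t <= T -> leb.-integrable setT (EFin \o (fun u => patch t u x)).
  move=> tT; have tI : t \in `[0, T] by rewrite in_itv.
  have := h1 tI; rewrite integrable_mkcond; last exact: mcircle.
  apply: eq_integrable => // u _; rewrite patchE; case: ifPn => [/set_mem cu|/negP cu] /=.
    by rewrite patch_in.
  by rewrite patch_circle// => cu'; apply: cu; exact: mem_set.
split => //.
- by move=> t u; exact: patch_circle.
- apply: measurable_funM => //.
  apply: (@measurable_Rintegral _ _ (mR * mR)%type mR R leb circle (fun p v => graphop_act knu patch p.1 v x * D (v - p.2))).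
    exact: mcircle.
  apply: measurable_funM.
    have ma : measurable_fun setT (fun p : mR * mR => \int[knu x]_y patch p.1 p.2 y).
      apply: (@measurable_Rintegral _ _ (mR * mR)%type Omega R (fmeas (kf x)) setT (fun p y => patch p.1 p.2 y)) => //.
      exact: measurable_patch.
    have mj : measurable_fun setT (fun p : mR * mR * mR => (p.1.1, p.2) : mR * mR) by measurable_proj.
    exact: (measurableT_comp ma mj).
  apply: (measurableT_comp (continuous_measurable_fun (interaction_continuous iD))).
  by apply: measurable_funB; measurable_proj.
- move=> t z; rewrite /velocity; congr (_ * _); apply: eq_RintegralL => v _; congr (_ * _).
  by rewrite -[LHS](interaction_periodic iD); congr D; ring.
- by move=> t u; exact: patch_velocity_bound.
- by move=> t u v; exact: patch_velocity_lip.
- pose M t := (\int[leb]_u `|patch t u x|%:E)%E.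
  have mM : measurable_fun setT (M : mR -> \bar R).
    apply: (@measurable_ge0_integral _ _ mR mR R leb setT (fun t u => `|patch t u x|%:E)) => //.
    by apply/measurable_EFinP; exact: measurableT_comp.
  have M0 t : (0 <= M t)%E by apply: integral_ge0.
  have mG := measurable_act_mass x.
  have MC t : M t = (\int[leb]_(u in circle) `|patch t u x|%:E)%E.
    rewrite [RHS]integral_mkcond; apply: eq_integral => u _; rewrite patchE; case: ifPn => // /negP cu.
    by rewrite patch_circle ?normr0// => cu'; apply: cu; exact: mem_set.
  have fMG : (\int[leb]_(t in `[0%R, T]) (M t * act_mass t x) < +oo)%E.
    apply: le_lt_trans h3; rewrite le_eqVlt; apply/orP; left; apply/eqP; apply: eq_integral => t.
    rewrite inE/= in_itv/= => tT; rewrite MC; congr (_ * _)%E.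
      by apply: eq_integral => u /set_mem cu; rewrite patch_in.
    by apply: eq_integral => u /set_mem cu; apply: eq_integral => y _; rewrite patch_in.
  have mI : measurable (`[0, T]%classic : set mR) by exact: (mitv `[0, T]).
  apply/integrableP; split.
    have mfM : measurable_fun setT ((fun t => fine (M t)) : mR -> R) by apply: measurableT_comp.
    apply/measurable_EFinP; apply: measurable_funTS; exact: (measurable_funM mfM ml).
  apply: (@le_lt_trans _ _ (\int[leb]_(t in `[0%R, T]) (C%:E * (M t * act_mass t x)))%E).
    rewrite le_eqVlt; apply/orP; left; apply/eqP; apply: eq_integral => t.
    rewrite inE/= in_itv/= => tT.
    have Mf : M t \is a fin_num.
      rewrite ge0_fin_numE//; have /integrableP[_] := ip t tT.
      by apply: le_lt_trans.
    have Gf : act_mass t x \is a fin_num by rewrite ge0_fin_numE ?act_mass_ge0// act_mass_fin.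
    have E : \int[leb]_u `|patch t u x| = fine (M t) by [].
    rewrite E ger0_norm; last by rewrite !mulr_ge0 ?(ltW C0)// fine_ge0// act_mass_ge0.
    by rewrite mulrCA !EFinM !fineK.
  rewrite ge0_integralZl//.
  - by apply: lte_mul_pinfty => //; rewrite lee_fin ltW.
  - by apply: measurable_funTS; exact: emeasurable_funM.
  - by move=> t _; rewrite mule_ge0// act_mass_ge0.
  - by rewrite lee_fin ltW.
- move=> f cf pf; apply: (@subspace_eq_continuous _ _ _ (fun t => \int[leb]_(u in circle) (rho t u x * f u))); last exact: h4.
  move=> t; rewrite inE/= in_itv/= => tT; apply: esym; apply: (etrans (circE t f)); apply: eq_RintegralL => u cu.
  by rewrite patch_in.
Qed.
End node.
End patch.

(** * Comparison of a weak solution with the mean-field flow *)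

Section uniqueness.
Context {d : measure_display} {Omega : measurableType d} {R : realType}.
Local Notation leb := (@lebesgue_measure R).
Local Notation mR := (measurableTypeR R).
Variables (m : probability Omega R).
Variables (C b T : R) (D : R -> R) (knu : R.-fker Omega ~> Omega) (kmu : R.-fker Omega ~> mR).
Hypotheses (C0 : 0 < C) (b0 : 0 < b) (T0 : 0 < T).
Hypotheses (iD : interaction D).
Hypotheses (nu1 : forall x, (knu x setT <= 1%:E)%E) (mub : forall y, (kmu y setT <= b%:E)%E).
Variables (mu : Omega -> circle_measure R) (rho0 : R -> Omega -> R).
Hypothesis kmuE : forall x, kmu x = circle_mu (mu x).
Hypothesis dens : has_density mu rho0.
Local Notation J := (mR * mR * Omega)%type.
Variable X : J -> R.
Hypothesis mX : measurable_fun setT X.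
Hypothesis XE : forall t u x, X (t, u, x) = u + \int[leb]_(s in `[0, t]) mean_velocity C D knu kmu X s (X (s, u, x)) x.
Local Notation field := (mean_velocity C D knu kmu X).
Local Notation sol := (solution kmu X).

Let D1 := interaction_bound iD.
Let DL := interaction_lip iD.
Let cD := interaction_continuous iD.
Let kf x : (knu x setT < +oo)%E. Proof. exact: le_lt_trans (nu1 x) (ltry _). Qed.

Variable rho : R -> R -> Omega -> R.
Hypothesis mrho : measurable_fun [set p : J | p.1.1 \in `[0, T] /\ circle p.1.2] (fun p => rho p.1.1 p.1.2 p.2).
Variable N : set Omega.
Hypothesis mN : measurable N.
Hypothesis nuN : forall x, ~ N x -> knu x N = 0%E.
Hypothesis rho_node : forall x, ~ N x ->
    [/\ forall t, t \in `[0, T] ->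
          leb.-integrable circle (fun u => (rho t u x)%:E),
        forall t, t \in `[0, T] ->
          (\int[leb]_(u in circle) \int[knu x]_y `|rho t u y|%:E < +oo)%E,
        (\int[leb]_(t in `[0%R, T])
           ((\int[leb]_(u in circle) `|rho t u x|%:E) *
            (\int[leb]_(u in circle) \int[knu x]_y `|rho t u y|%:E)) < +oo)%E,
        forall f : R -> R, continuous f -> periodic2pi f ->
          {within `[0, T], continuous
            (fun t => \int[leb]_(u in circle) (rho t u x * f u))}
      & forall w wt wu, test_function T w wt wu ->
          \int[leb]_(t in `[0, T]) \int[leb]_(u in circle)
             (rho t u x * (wt t u + velocity knu C D rho t u x * wu t u))
          + \int[leb]_(u in circle) (w 0 u * rho0 u x) = 0].

Local Notation prho := (patch T rho).
Local Notation vel := (velocity knu C D prho).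

Let mprho := measurable_patch mrho.

Let mprho2 t : measurable_fun setT (fun p : mR * Omega => prho t p.1 p.2).
Proof.
have mj : measurable_fun setT (fun p : mR * Omega => (t, p.1, p.2) : J) by measurable_proj.
exact: (measurableT_comp mprho mj).
Qed.

Let tr x : ~ N x -> transport T (fun t u => prho t u x) (fun t u => vel t u x) (fun t => C * fine (act_mass T knu rho t x)).
Proof. by move=> Nx; have [h1 h2 h3 h4 _] := rho_node Nx; exact: patch_transport. Qed.

Lemma patch_weak x : ~ N x -> forall w wt wu, test_function T w wt wu ->
     \int[leb]_(t in `[0, T]) \int[leb]_u (prho t u x * (wt t u + vel t u x * wu t u))
     + \int[leb]_(u in circle) (w 0 u * rho0 u x) = 0.
Proof.
move=> Nx w wt wu tw; have [_ _ _ _ h5] := rho_node Nx.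
apply: (etrans _ (h5 _ _ _ tw)); apply: (congr1 (+%R^~ _)); apply: eq_RintegralL => t; rewrite /= in_itv/= => tT.
transitivity (\int[leb]_(u in circle) (prho t u x * (wt t u + vel t u x * wu t u))).
  by apply: esym; apply: (@Rintegral_circle R (fun u => prho t u x)) => u; exact: patch_circle.
apply: eq_RintegralL => u cu.
have -> : prho t u x = rho t u x by exact: patch_in.
have -> // : vel t u x = velocity knu C D rho t u x by exact: velocity_patch.
Qed.

Let treq x (Nx : ~ N x) := weak_transport_eq (dens x).1 (dens x).2 T0 (tr Nx) (patch_weak Nx).
Let init x (Nx : ~ N x) := weak_initial (dens x).1 (dens x).2 T0 (tr Nx) (patch_weak Nx).

Lemma patch_mass t x : ~ N x -> 0 <= t <= T -> (\int[leb]_(u in circle) `|prho t u x|%:E = kmu x setT)%E.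
Proof.
move=> Nx tT; rewrite kmuE; apply: (etrans _ (transport_mass (dens x).1 (dens x).2 T0 (tr Nx) (treq Nx) (init Nx) tT)).
rewrite integral_mkcond; apply: eq_integral => u _; rewrite patchE; case: ifPn => // /negP cu.
by rewrite patch_circle ?normr0// => cu'; apply: cu; exact: mem_set.
Qed.

(** By Tonelli this is the fiber average of the masses at the nodes [y]. Outside [N] these are the
    masses of [kmu y], and the fiber of [x] does not charge [N]. The resulting bound on the velocity
    is uniform in time and node. *)
Lemma act_mass_bound t x : ~ N x -> 0 <= t <= T -> (act_mass T knu rho t x <= b%:E)%E.
Proof.
move=> Nx tT; rewrite /act_mass (tonelli_circle (kf x) (mprho2 t)).
apply: (@le_trans _ _ (\int[knu x]_y kmu y setT)%E).
  rewrite le_eqVlt; apply/orP; left; apply/eqP; apply: ae_eq_integral => //.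
  - apply: (@measurable_ge0_integral _ _ Omega mR R leb circle (fun y v => `|prho t v y|%:E)) => //; first exact: mcircle.
    apply/measurable_EFinP; apply: measurableT_comp => //.
    have mj : measurable_fun setT (fun p : Omega * mR => (t, p.2, p.1) : J) by measurable_proj.
    exact: (measurableT_comp mprho mj).
  - exact: measurable_kernel.
  exists N; split => //; first exact: nuN.
  by move=> y /= h; apply: contrapT => Ny; apply: h => _; exact: patch_mass.
apply: weight_le => //; first by move=> y; rewrite measure_ge0 mub.
exact: measurable_kernel.
Qed.

Let l x t := C * fine (act_mass T knu rho t x).

Let l_bound x t : ~ N x -> 0 <= t <= T -> l x t <= C * b.
Proof.
move=> Nx tT; rewrite /l ler_wpM2l ?(ltW C0)//.
have := act_mass_bound Nx tT; have := act_mass_ge0 T knu rho t x.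
by case: (act_mass T knu rho t x) => [r| |].
Qed.

Let l_integrable x : ~ N x -> leb.-integrable `[0, T] (EFin \o l x).
Proof.
move=> Nx; apply: (@Rintegrable_le _ mR R leb `[0, T]%classic _ (fun=> C * b)).
- exact: mitv.
- by apply: measurable_funTS; exact: (tr_ml (tr Nx)).
- move=> t; rewrite /= in_itv/= => tT; rewrite ger0_norm; first exact: l_bound.
  exact: (tr_l0 (tr Nx)).
- by apply: continuous_Rintegrable; exact: cst_continuous.
Qed.

Section compare.
Variable Phi : Omega -> R -> R -> R.
Hypothesis PhiE : forall x, ~ N x -> forall q, characteristic (fun t u => vel t u x) 0 T (Phi x q) /\ Phi x q 0 = q.

Let Cb : 0 < C * b. Proof. by rewrite mulr_gt0. Qed.

Lemma patch_pushforward x t (f : R -> R) B : ~ N x -> 0 <= t <= T -> measurable_fun setT (f : mR -> R) -> (forall u, `|f u| <= B) ->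
  \int[leb]_u (prho t u x * f u) = \int[kmu x]_v f (wrap (Phi x v t)).
Proof.
move=> Nx tT mf fB; rewrite kmuE.
exact: (transport_pushforward (dens x).1 (dens x).2 (tr Nx) (treq Nx) Cb (l_integrable Nx)
  (fun t => @l_bound x t Nx) (init Nx) (PhiE Nx) tT mf fB).
Qed.

Lemma measurable_patch_flow x t : ~ N x -> 0 <= t <= T -> measurable_fun setT ((fun v => Phi x v t) : mR -> mR).
Proof.
move=> Nx tT; have /andP[t0 tT'] := tT.
have ilt : leb.-integrable `[0, t] (EFin \o l x).
  by apply: integrableS (l_integrable Nx); [exact: mitv|exact: mitv|apply: subset_itvl; rewrite bnd_simp].
have lt s : 0 <= s <= t -> l x s <= C * b.
  by move=> /andP[s0 st]; apply: l_bound => //; rewrite s0 (le_trans st).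
have flow q : characteristic (fun t u => vel t u x) 0 t (Phi x q) /\ Phi x q 0 = q.
  by have [cq eq] := PhiE Nx q; split=> //; exact: (char_subr tT' cq).
have [hc _] := @flow_lift R (fun t u => vel t u x) (l x) 0 t (C * b) (Phi x) (tr_mV (tr Nx)) (tr_pV (tr Nx))
  (tr_V (tr Nx)) (tr_VL (tr Nx)) t0 Cb ilt
  lt flow.
exact: (lift_measurable hc).
Qed.

(** Both velocities average [D] over the initial measures, transported by [Phi] and by [X]. The
    nodes in [N], where [Phi] is arbitrary, are invisible to the fiber of [x]. *)
Lemma velocity_field_dist x t z z' K : ~ N x -> 0 <= t <= T -> 0 <= K ->
  (forall y v, ~ N y -> `|Phi y v t - z - (X (t, v, y) - z')| <= K) ->
  `|vel t z x - field t z' x| <= C * (b * K).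
Proof.
move=> Nx tT K0 hK.
have mDz w : measurable_fun setT ((fun v => D (v - w)) : mR -> R).
  apply: continuous_measurable_fun => v; apply: continuous_comp; last exact: cD.
  by apply: cvgB => //; exact: cvg_cst.
have Db w v : `|D (v - w)| <= 1 by exact: D1.
have fin : (\int[leb]_(v in circle) \int[knu x]_y `|prho t v y|%:E < +oo)%E.
  exact: le_lt_trans (act_mass_bound Nx tT) (ltry _).
rewrite /velocity /graphop_act (velocity_swap (kf x) (mprho2 t) (mDz z) (Db z) fin).
rewrite /mean_velocity -mulrBr normrM (gtr0_norm C0) ler_wpM2l ?(ltW C0)// -[leRHS]mul1r.
have E y : ~ N y -> \int[leb]_(v in circle) (prho t v y * D (v - z)) = \int[kmu y]_v D (Phi y v t - z).
  move=> Ny; have pD : periodic2pi (fun v => D (v - z)) by move=> v; rewrite addrAC; exact: interaction_periodic.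
  rewrite (@Rintegral_circle R (fun v => prho t v y))=> [|v]; last exact: patch_circle.
  rewrite (patch_pushforward Ny tT (mDz z) (Db z)).
  by congr Rintegral; apply/funext => v; exact: (periodic_wrap _ pD).
have mP y : ~ N y -> measurable_fun setT ((fun v => D (Phi y v t - z)) : mR -> R).
  by move=> Ny; exact: (measurableT_comp (mDz z) (measurable_patch_flow Ny tT)).
have mI y : measurable_fun setT ((fun v => D (X (t, v, y) - z')) : mR -> R).
  apply: (measurableT_comp (mDz z')); apply: (measurableT_comp mX); measurable_proj.
apply: (Rintegral_dist_ae (nu1 x) mN (nuN Nx) (B := b)).
- apply: (@measurable_Rintegral _ _ Omega mR R leb circle (fun y v => prho t v y * D (v - z))); first exact: mcircle.
  apply: measurable_funM; last by apply: (measurableT_comp (mDz z)); exact: measurable_snd.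
  have mj : measurable_fun setT (fun p : Omega * mR => (t, p.2, p.1) : J) by measurable_proj.
  exact: (measurableT_comp mprho mj).
- exact: measurable_inner1.
- move=> y Ny; rewrite E// -[leRHS]mulr1; apply: (Rintegral_bound (mub y)) => //; exact: mP.
- by move=> y Ny; exact: inner_bound.
- move=> y Ny; rewrite E//; apply: (Rintegral_dist (mub y) (B := 1)) => //; first exact: mP.
  by move=> v; apply: le_trans (DL _ _) _; exact: hK.
- exact: ltW.
- by rewrite mulr_ge0// ltW.
Qed.

Lemma patch_flow_eq t u x : ~ N x -> 0 <= t <= T -> Phi x u t = X (t, u, x).
Proof.
move=> Nx tT.
pose M := 4 * C * b; have M0 : 0 < M by rewrite !mulr_gt0.
pose E (i : R * R * Omega) := expR (M * i.1.1).
pose P (i : R * R * Omega) := 0 <= i.1.1 <= T /\ ~ N i.2.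
pose del (i : R * R * Omega) := `|Phi i.2 i.1.2 i.1.1 - X i|.
have bnd (i : R * R * Omega) (g : R -> R) : P i -> leb.-integrable `[0, i.1.1] (EFin \o g) ->
    (forall s, 0 <= s <= i.1.1 -> `|vel s (Phi i.2 i.1.2 s) i.2 - field s (X (s, i.1.2, i.2)) i.2| <= g s) ->
    del i <= \int[leb]_(s in `[0, i.1.1]) g s.
  move: i => [[s v] y] /= [/= sT Ny] ig hg; rewrite /del /=.
  have [[mP cP] P0] := PhiE Ny v; have /andP[s0 sT'] := sT.
  have iV : leb.-integrable `[0, s] (EFin \o (fun r => vel r (Phi y v r) y)).
    apply: (iV_comp (tr_mV (tr Ny)) (tr_V (tr Ny)) mP).
    by apply: integrableS (l_integrable Ny); [exact: mitv|exact: mitv|apply: subset_itvl; rewrite bnd_simp].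
  have iF := integrable_field_along C0 b0 D1 cD nu1 mub v y 0 s mX.
  rewrite (cP s sT) P0 XE opprD addrACA subrr add0r -(RintegralB (mitv _) iV iF).
  apply: (normr_Rintegral_le (mitv _)) ig => [|r].
    by apply: (RintegrableP (mitv _)); exact: (RintegrableB (mitv _) iV iF).
  by rewrite /= in_itv/=; exact: hg.
(* The flows have the same starting points, so [d0 = 0] and the bound collapses to 0. The index runs
   over times, positions and all nodes outside [N] at once, because the velocity at one node
   involves the flows at the others. *)
have := @gronwall_iteration R _ P del E (2 * (C * b) * T) 0.
move=> /(_ _ _ _ _ _ (t, u, x)) H.
suff : del (t, u, x) <= 2 * 0 * E (t, u, x).
  by rewrite mulr0 mul0r normr_le0 subr_eq0 => /eqP.
apply: H => //.
- by move=> [[s v] y] [/= /andP[s0 _] _]; rewrite /E/= -expR0 ler_expR mulr_ge0// ltW.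
- by rewrite !mulr_ge0 ?(ltW T0)// ltW.
- move=> i Pi; have [/andP[i0 iT] Ni] := Pi.
  apply: (le_trans (bnd i (cst (2 * (C * b))) Pi _ _)).
  + by apply: continuous_Rintegrable; exact: cst_continuous.
  + move=> s /andP[s0 si]; have sT : 0 <= s <= T by rewrite s0 (le_trans si).
    apply: le_trans (ler_normB _ _) _; rewrite /= (mulrDl 1 1) !mul1r; apply: lerD.
      exact: le_trans (tr_V (tr Ni) _ _) (l_bound Ni sT).
    exact: field_bound.
  + by rewrite Rintegral_cst_itv// subr0 ler_wpM2l// !mulr_ge0// ltW.
- move=> K K0 hK i Pi; have [/andP[i0 iT] Ni] := Pi; rewrite add0r.
  have cexp : continuous (fun s : R => expR (M * s)).
    move=> r; apply: continuous_comp; last exact: continuous_expR.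
    by apply: cvgM; [exact: cvg_cst|exact: cvg_id].
  have ie := continuous_Rintegrable 0 i.1.1 cexp.
  apply: (le_trans (bnd i (fun s => M * K / 2 * expR (M * s)) Pi (RintegrableZl _ (mitv _) ie) _)).
    move=> s /andP[s0 si]; have sT : 0 <= s <= T by rewrite s0 (le_trans si).
    have -> : M * K / 2 * expR (M * s) = C * (b * (2 * K * expR (M * s))) by rewrite /M; field.
    apply: velocity_field_dist => //; first by rewrite !mulr_ge0// expR_ge0.
    move=> y v Ny.
    have -> : 2 * K * expR (M * s) = K * expR (M * s) + K * expR (M * s) by ring.
    apply: le_trans (normB_subB _ _ _ _) _.
    by apply: lerD; [exact: (hK (s, v, y))|exact: (hK (s, i.1.2, i.2))].
  rewrite (RintegralZl _ (mitv _) ie) Rintegral_expRM ?gt_eqF//.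
  rewrite mulr0 expR0 (_ : M * K / 2 * ((expR (M * i.1.1) - 1) / M) = K / 2 * (expR (M * i.1.1) - 1)); last by field; rewrite gt_eqF.
  by rewrite ler_wpM2l ?divr_ge0// gerBl.
Qed.

Lemma patch_eq_solution t x : ~ N x -> 0 <= t <= T -> {ae leb, forall u : mR, sol t u x = prho t u x}.
Proof.
move=> Nx tT; have /andP[t0 _] := tT.
have [k [k0 kc ik kE sk]] := solution_density C0 b0 iD nu1 mub kmuE dens mX XE x t0.
have pc u : ~ circle u -> prho t u x = 0 by exact: patch_circle.
have ip := tr_irho (tr Nx) tT.
have : {ae leb, forall u : mR, prho t u x = k u}.
  apply: (cdf_ae_eq ip ik pc kc) => z _.
  apply: (cdf_test_eq ip ik pc kc) => h h' dh ch' ph ph'.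
  have [B _ hB] := periodic_bounded (dR_continuous dh) ph.
  have mh : measurable_fun setT (h : mR -> R) by apply: continuous_measurable_fun; exact: (dR_continuous dh).
  rewrite (patch_pushforward Nx tT mh hB) (kE h B mh hB).
  by congr Rintegral; apply/funext => v; rewrite patch_flow_eq.
by apply: filterS2 sk => u -> ->.
Qed.
End compare.

Lemma solution_unique_node x : ~ N x -> forall t, t \in `[0, T] ->
  {ae leb, forall u : mR, circle u -> sol t u x = rho t u x}.
Proof.
move=> Nx t; rewrite in_itv/= => tT.
have H y : exists f : R -> R -> R, ~ N y -> forall q, characteristic (fun t u => vel t u y) 0 T (f q) /\ f q 0 = q.
  (* [choice] asks for a value at every node; in [N] any will do. *)
  have [Ny|Ny] := pselect (N y); first by exists (fun=> cst 0).
  have [f hf] := flow_exists (tr_mV (tr Ny)) (tr_V (tr Ny)) (tr_VL (tr Ny)) (ltW T0) (l_integrable Ny).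
  by exists f.
have [Phi PhiE] := choice H.
by apply: filterS (patch_eq_solution PhiE Nx tT) => u -> cu; rewrite patch_in.
Qed.
End uniqueness.

Theorem theorem2p10 (R : realType) (Omega : ptopologicalType)
  (m : probability (borel_type Omega) R)
  (A : LfunType m (leey (1%E : \bar R)) -> LfunType m (lexx (1%E : \bar R)))
  (nu : R.-ker (borel_type Omega) ~> (borel_type Omega))
  (C T b : R) (D : R -> R)
  (mu0 : borel_type Omega -> circle_measure R)
  (rho0 : R -> borel_type Omega -> R) :
  compact [set: Omega] ->
  Gm A nu ->
  0 < C -> 0 < T -> interaction D ->
  0 < b -> Mb b mu0 ->
  has_density mu0 rho0 ->
  (forall u, circle u -> rho0 u \in Lfun m +oo%E) ->
  exists rho : R -> R -> borel_type Omega -> R,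
    weak_solution m nu C T D rho0 rho /\
    forall rho', weak_solution m nu C T D rho0 rho' ->
      same_density m T rho rho'.
Proof.
move=> _ [gA fA gam1] C0 T0 iD b0 [mmu mub] dens _.
have nu1 x : (nu x setT <= 1%:E)%E by apply: le_trans gam1; apply: ereal_sup_ubound; exists x.
have mub1 x : (circle_mu (mu0 x) setT <= b%:E)%E by apply: le_trans mub; apply: ereal_sup_ubound; exists x.
(* The uniform bounds on the masses make the fiber measures, and below the initial measures, finite
   kernels, for which parameter integrals are measurable. *)
have [knu knuE] := @fkernel_of _ _ _ _ R (fun x => nu x) 1 (measurable_kernel nu) nu1.
have [kmu kmuE] := @fkernel_of _ _ _ (measurableTypeR R) R (fun x => circle_mu (mu0 x)) b (measurable_mu mmu dens) mub1.
have knu1 x : (knu x setT <= 1%:E)%E by rewrite knuE.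
have kmub x : (kmu x setT <= b%:E)%E by rewrite kmuE; exact: mub1.
have [X [mX XE]] := mean_field_flow C0 b0 (interaction_bound iD) (interaction_lip iD) (interaction_continuous iD) knu1 kmub.
exists (solution kmu X); split.
  apply: (@weak_solution_ext _ _ _ _ knu) => //.
  exact: (solution_weak_solution m C0 b0 iD knu1 kmub kmuE dens mX XE T0).
move=> rho' /(@weak_solution_ext _ _ _ _ _ knu _ _ _ _ _ (fun x => esym (knuE x))) [mrho [Q [mQ Q0 hQ]]].
(* The equation at a node involves its whole fiber, so the exceptional set is enlarged until the
   remaining fibers do not see it. *)
have [N [mN N0 QN nuN]] := invariant_null gA fA mQ Q0.
have knuN x : ~ N x -> knu x N = 0%E by move=> Nx; rewrite knuE nuN.
exists N; split => // x /= h; apply: contrapT => Nx; apply: h.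
apply: (solution_unique_node C0 b0 T0 iD knu1 kmub kmuE dens mX XE mrho mN knuN _ Nx) => y Ny.
by apply: contrapT => hy; apply: Ny; apply: QN; exact: hQ.
Qed.
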